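(* Let $\mathcal{P}$ be a finite polysquare translation surface with $d$ square faces, and let the polycube translation $3$-manifold $\mathcal{M}=\mathcal{P}\times[0,1)$ be the cartesian product of $\mathcal{P}$ and the unit torus $[0,1)$. Then any half-infinite geodesic in $\mathcal{M}$ with a Kronecker direction $\mathbf{v}\in\mathbb{R}^3$ is uniformly distributed in $\mathcal{M}$ unless it hits a singularity.
   Context: A vector $\mathbf{v}=(v_1,v_2,v_3)\in\mathbb{R}^3$ is a Kronecker direction if $v_1,v_2,v_3$ are linearly independent over $\mathbb{Q}$. A finite polysquare translation surface is a connected surface obtained from finitely many axis-parallel unit squares by identifying their edges in pairs by translations: every right edge is identified with exactly one left edge, and every top edge with exactly one bottom edge. The product $\mathcal{M}=\mathcal{P}\times[0,1)$ of such a surface (in the $x,y$-coordinates) with the unit torus $[0,1)$ (in the $z$-coordinate, with $z=0$ and $z=1$ identified) is a translation $3$-manifold tiled by $d$ unit (atomic) cubes. A geodesic with direction $\mathbf{v}$ is a straight line trajectory of the linear flow in direction $\mathbf{v}$, continued through the face identifications. A singular point is a point of $\mathcal{M}$ lying on a (singular) edge around which the total angle is not $2\pi$; the geodesic is not defined beyond such a point. Let $\mathcal{L}(t)$, $t\ge0$, denote a half-infinite geodesic with arc-length parametrization. It is uniformly distributed if for every continuous function $f$ on $\mathcal{M}$, $$\lim_{T\to\infty}\frac1T\int_0^Tf(\mathcal{L}(t))\,dt=\frac{1}{d}\int_{\mathcal{M}}f\,d\lambda_3,$$ where $\lambda_3$ is $3$-dimensional Lebesgue measure on $\mathcal{M}$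 (total mass $d$). *)

(* Defs.v *)
From Stdlib Require Import Relations.
From mathcomp Require Import all_boot all_order all_algebra all_fingroup.
From mathcomp Require Import generic_quotient.
From mathcomp Require Import all_classical all_reals all_analysis.
Set Implicit Arguments.
Unset Strict Implicit.
Unset Printing Implicit Defensive.
Import Order.TTheory GRing.Theory Num.Theory.
Import numFieldNormedType.Exports.
Local Open Scope classical_set_scope.
Local Open Scope ring_scope.
Local Open Scope quotient_scope.

(** * Polysquare surfaces *)

Section Surface.
Variables (R : realType) (d : nat).

Definition unit_square : set (R * R) := `[0, 1] `*` `[0, 1].

Fact origin_in_unit_square : ((0, 0) : R * R) \in unit_square.
Proof. by apply/mem_set; split; rewrite /= in_itv /= lexx ler01. Qed.

Definition origin : set_type unit_square :=
  exist (fun p => p \in unit_square) (0, 0) origin_in_unit_square.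

Definition squares : topologicalType := {i : 'I_d & set_type unit_square}.

(* [insubd] sends a pair outside [unit_square] to the origin; [in_square] is
   only ever used at pairs lying in [unit_square]. *)
Definition in_square (i : 'I_d) (x y : R) : squares :=
  existT _ i (insubd origin (x, y)).

(* Since [right] and [top] are bijections, every right (top) edge is glued to
   exactly one left (bottom) edge and conversely. *)
Variables right top : {perm 'I_d}.

Inductive glue : squares -> squares -> Prop :=
| glue_right (i : 'I_d) (s : R) :
    0 <= s <= 1 -> glue (in_square i 1 s) (in_square (right i) 0 s)
| glue_top (i : 'I_d) (s : R) :
    0 <= s <= 1 -> glue (in_square i s 1) (in_square (top i) s 0).

Definition glued (a b : squares) : bool :=
  `[< clos_refl_sym_trans squares glue a b >].

Lemma glued_refl : reflexive glued.
Proof. by move=> a; apply/asboolP; exact: rst_refl. Qed.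

Lemma glued_sym : symmetric glued.
Proof.
by move=> a b; apply/asboolP/asboolP => h; exact: rst_sym.
Qed.

Lemma glued_trans : transitive glued.
Proof.
by move=> b a c /asboolP ab /asboolP bc; apply/asboolP; exact: rst_trans ab bc.
Qed.

Canonical glued_equiv := EquivRel glued glued_refl glued_sym glued_trans.

Definition surface : topologicalType := quotient_topology {eq_quot glued_equiv}.

Definition surface_point (i : 'I_d) (x y : R) : surface :=
  \pi_(quotient_topology {eq_quot glued_equiv}) (in_square i x y).

(* A corner is a square together with the two bits giving the coordinates of
   one of its vertices. *)
Definition corner_point (c : 'I_d * bool * bool) : surface :=
  surface_point c.1.1 c.1.2%:R c.2%:R.

(* Each corner of a square placed at a vertex contributes a right angle. *)
Definition vertex_angle (p : surface) : R :=
  \sum_(c : 'I_d * bool * bool | `[< corner_point c = p >]) (pi / 2).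

Definition singular_vertex (p : surface) : Prop :=
  (exists c, corner_point c = p) /\ vertex_angle p <> 2 * pi.

End Surface.

(** * The unit torus *)

Section Circle.
Variable R : realType.

Definition congr_int (x y : R) : bool := (x - y) \is a Num.int.

Lemma congr_int_refl : reflexive congr_int.
Proof. by move=> x; rewrite /congr_int subrr. Qed.

Lemma congr_int_sym : symmetric congr_int.
Proof. by move=> x y; rewrite /congr_int -opprB rpredN. Qed.

Lemma congr_int_trans : transitive congr_int.
Proof.
move=> y x z; rewrite /congr_int => xy yz.
by rewrite -(subrKA y) rpredD.
Qed.

Canonical congr_int_equiv :=
  EquivRel congr_int congr_int_refl congr_int_sym congr_int_trans.

Definition circle : topologicalType :=
  quotient_topology {eq_quot congr_int_equiv}.

Definition circle_point (z : R) : circle :=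
  \pi_(quotient_topology {eq_quot congr_int_equiv}) z.

End Circle.

(** * The polycube manifold *)

Section Manifold.
Variables (R : realType) (d : nat) (right top : {perm 'I_d}).

Definition manifold : topologicalType :=
  (surface R right top * circle R)%type.

Definition cube_point (i : 'I_d) (x y z : R) : manifold :=
  (surface_point right top i x y, circle_point z).

(* The total angle around a vertical edge is the angle of the surface at the
   corresponding vertex. Around an edge parallel to the x- or y-axis it is
   always 2 pi, so such edges are never singular. *)
Definition singular_point (p : manifold) : Prop := singular_vertex p.1.

Definition lambda3 := ((@lebesgue_measure R \x @lebesgue_measure R) \x
  @lebesgue_measure R)%E.

Definition unit_cube : set (R * R * R) := `[0, 1] `*` `[0, 1] `*` `[0, 1].

Definition manifold_integral (f : manifold -> R) : R :=
  \sum_(i < d) \int[lambda3]_(w in unit_cube) f (cube_point i w.1.1 w.1.2 w.2).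

Definition euclidean_norm (v : 'rV[R]_3) : R :=
  Num.sqrt (\sum_(k < 3) v 0 k ^+ 2).

Definition unit_vector (v : 'rV[R]_3) : 'rV[R]_3 := (euclidean_norm v)^-1 *: v.

(* [gamma] is a segment with velocity [u] inside a single closed cube. *)
Definition straight_segment (u : 'rV[R]_3) (e : R) (gamma : R -> manifold) :=
  exists (i : 'I_d) (x y z : R), forall s : R, 0 <= s <= e ->
    [/\ 0 <= x + s * u 0 0 <= 1,
        0 <= y + s * u 0 1 <= 1 &
        gamma s = cube_point i (x + s * u 0 0) (y + s * u 0 1)
                    (z + s * u 0 2%:R)].

(* Unit speed, so [t] is arc length. Immediately after and immediately before
   each time, the trajectory is straight inside one closed cube, with the same
   direction on both sides. Only the values of [L] on [0, +oo[ matter. *)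
Definition half_infinite_geodesic (v : 'rV[R]_3) (L : R -> manifold) : Prop :=
  forall t : R, 0 <= t ->
    (exists2 e : R, 0 < e &
       straight_segment (unit_vector v) e (fun s => L (t + s))) /\
    (0 < t -> exists2 e : R, 0 < e <= t &
       straight_segment (- unit_vector v) e (fun s => L (t - s))).

Definition hits_singularity (L : R -> manifold) : Prop :=
  exists2 t : R, 0 <= t & singular_point (L t).

Definition uniformly_distributed (L : R -> manifold) : Prop :=
  forall f : manifold -> R, continuous f ->
    (T^-1 * \int[lebesgue_measure]_(t in `[0, T]) f (L t)) @[T --> +oo]
      --> d%:R^-1 * manifold_integral f.

End Manifold.

Definition kronecker_direction (R : realType) (v : 'rV[R]_3) : Prop :=
  forall q : 'rV[rat]_3, \sum_(k < 3) ratr (q 0 k) * v 0 k = 0 -> q = 0.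

(* Main.v *)
Require Import Defs.
From Stdlib Require Import Relations.
From mathcomp Require Import all_boot all_order all_algebra all_fingroup.
From mathcomp Require Import generic_quotient.
From mathcomp Require Import all_classical all_reals all_analysis.
From mathcomp Require Import measurable_realfun.
From mathcomp Require Import ring lra zify.
Set Implicit Arguments.
Unset Strict Implicit.
Unset Printing Implicit Defensive.
Import Order.TTheory GRing.Theory Num.Theory.
Import numFieldNormedType.Exports.
Local Open Scope ring_scope.

(** After reflecting the first two axes if necessary, the direction has positive
    first two components. Let [al] and [be] be the increments of the second and
    third coordinates while the first advances by one; a Kronecker direction
    means that 1, [al] and [be] are linearly independent over the rationals.
    Since the slope [al] is irrational, the trajectory meets the vertices of the
    squares at most once, and averages do not see an initial part, so one may
    start after that. From there on the square visited at abscissa [X] is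
    determined by the integer parts of [X] and of the height ([coding]). The
    passages at integer abscissas form an orbit of a skew product over the
    rotation by [(al, be)] of the two-torus, whose fibre is the finite set of
    squares.

    The rotation is equidistributed, uniformly in the starting point
    ([equidistribution]). It remains to see that no square is favoured. Along an
    ultrafilter, the frequencies of the visits to boxes (a square, a height
    interval and an interval of the third coordinate) have limits, which form a
    finitely additive content ([mean_content]): its sum over the squares is the
    area, and it is invariant under the skew product on boxes that no horizontal
    edge cuts. Such a content is unique ([solid_uniform]), so the frequencies
    converge ([frequency_cvg]).

    Uniqueness rests on an extremal argument. Let [M] be the supremum of the
    densities of the content on boxes of a fixed thickness in the third
    coordinate, and [kappa] the largest number of squares whose densities over a
    common box can be arbitrarily close to [M] simultaneously ([extremal]).

    For boxes that are full in the third direction ([planar_uniform]), take a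
    best approximation time [q] of [al]. An interval of length about [1 / q] is
    not cut by horizontal edges for about [q / 2] steps in one of the two time
    directions ([uncut_long]); its positions are disjoint and equidistributed, so
    one of them falls into an almost extremal box and has small deficiency there,
    for [kappa] squares at once. By invariance, all intervals of this scale have
    [kappa] almost extremal squares ([good_scale]). Overlapping intervals have the
    same almost extremal squares, by maximality of [kappa]; so these do not depend
    on the interval ([almost_full]). In the limit one obtains a nonempty set of
    squares with density [M] everywhere; invariance makes it stable under both
    gluing permutations, and connectedness makes it the set of all squares.

    For thinner boxes, an almost extremal box has a small piece that is moved,
    uncut, to one and the same height interval at a dense set of levels of the
    third coordinate ([common_piece]). Maximality of [kappa] and continuity in the
    level show that one square is almost extremal at all levels; stacking the
    levels and comparing with the full box bounds [M] by the mean density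
    ([extremal_le]).

    Finally, a continuous function on the manifold is uniformly continuous in
    cube coordinates ([cube_function_unif]). Cutting the unit of abscissa into
    [Q] parts, its time average is close to a mean of section averages
    ([time_average]), these are close to Riemann sums ([section_average]), and so
    is the space average ([space_average]). *)

(** * Fractional parts and simultaneous approximation *)

Section Frac.
Variable R : realType.
Implicit Types (x y : R) (p : int).

Definition frac x : R := x - (Num.floor x)%:~R.

Lemma frac_ge0 x : 0 <= frac x.
Proof. by rewrite subr_ge0 floor_le. Qed.

Lemma frac_lt1 x : frac x < 1.
Proof. by rewrite ltrBlDl; have := floorD1_gt x; rewrite intrD. Qed.

Lemma frac_eq x p : 0 <= x - p%:~R < 1 -> frac x = x - p%:~R.
Proof.
move=> /andP[h0 h1]; rewrite /frac (@floor_def _ x p) //.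
by rewrite intrD; lra.
Qed.

Lemma floor_unique x y p : x = y + p%:~R -> 0 <= y < 1 -> Num.floor x = p.
Proof. by move=> -> /andP[y0 y1]; apply: floor_def; rewrite intrD; apply/andP; split; lra. Qed.

Lemma frac_unique x y p : x = y + p%:~R -> 0 <= y < 1 -> frac x = y.
Proof. by move=> E h; rewrite /frac (floor_unique E h) E addrK. Qed.

Lemma floor01 x : 0 <= x < 1 -> Num.floor x = 0.
Proof. by move=> h; apply: floor_def; rewrite intrD add0r. Qed.

Lemma frac_id x : 0 <= x < 1 -> frac x = x.
Proof. by move=> h; rewrite (@frac_eq x 0) subr0. Qed.

Lemma fracDz x p : frac (x + p%:~R) = frac x.
Proof.
have h0 := frac_ge0 x; have h1 := frac_lt1 x.
rewrite (@frac_eq _ (Num.floor x + p)) /frac intrD; first by lra.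
by apply/andP; move: h0 h1; rewrite /frac; split; lra.
Qed.

Lemma frac_floor x : x = frac x + (Num.floor x)%:~R.
Proof. by rewrite /frac subrK. Qed.

Lemma floorDz x p : Num.floor (x + p%:~R) = Num.floor x + p.
Proof. by rewrite floorDrz ?intr_int // intrKfloor. Qed.

End Frac.

Section Kronecker.
Variables (R : realType) (al be : R).
Hypothesis indep : forall a b c : int,
  a%:~R + b%:~R * al + c%:~R * be = 0 -> [/\ a = 0, b = 0 & c = 0].

Lemma mesh_lt (Q : nat) (x : R) : (Num.truncn (frac x * Q.+1%:R) < Q.+1)%N.
Proof.
rewrite truncn_lt_nat ?mulr_ge0 ?frac_ge0 //.
by rewrite gtr_pMl ?ltr0n // frac_lt1.
Qed.

Definition mesh (Q : nat) (x : R) : 'I_Q.+1 := Ordinal (mesh_lt Q x).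

Lemma mesh_close (Q : nat) (x y : R) : mesh Q x = mesh Q y ->
  `|frac x - frac y| < Q.+1%:R^-1.
Proof.
move=> /(congr1 val) /= h.
have Q0 : 0 < Q.+1%:R :> R by rewrite ltr0n.
have /andP[a1 a2] := truncn_itv (mulr_ge0 (frac_ge0 x) (ltW Q0)).
have /andP[b1 b2] := truncn_itv (mulr_ge0 (frac_ge0 y) (ltW Q0)).
rewrite -h in b1 b2; set T := Num.truncn _ in a1 a2 b1 b2.
rewrite -[T.+1%:R]natr1 in a2 b2.
rewrite ltr_norml -[_^-1]mul1r -mulNr ltr_pdivrMr // ltr_pdivlMr //.
by apply/andP; split; lra.
Qed.

(** Pigeonhole applied to the multiples of [N0.+1], so that the difference of
    two of them automatically exceeds [N0]. *)
Lemma recurrence (N0 : nat) (eta : R) : 0 < eta ->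
  exists n : nat, exists p r : int,
    [/\ (N0 < n)%N, `|n%:R * al - p%:~R| < eta & `|n%:R * be - r%:~R| < eta].
Proof.
move=> eta0; pose Q := Num.truncn eta^-1.
have Qe : Q.+1%:R^-1 < eta.
  have h := truncnS_gt eta^-1; rewrite -[eta]invrK ltf_pV2 //= ?posrE ?ltr0n //.
  by rewrite invr_gt0.
pose f (k : 'I_(Q.+1 * Q.+1).+1) : 'I_Q.+1 * 'I_Q.+1 :=
  (mesh Q ((k * N0.+1)%:R * al), mesh Q ((k * N0.+1)%:R * be)).
have /injectivePn[k [k' nkk' e]] : ~~ injectiveb f.
  apply/negP => /injectiveP/leq_card.
  by rewrite card_prod !card_ord ltnn.
wlog lt : k k' nkk' e / (k < k')%N.
  move=> H; have [|lt|/val_inj eqk] := ltngtP k k'; first exact: H.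
    by apply: (H k' k) => //; rewrite eq_sym.
  by rewrite eqk eqxx in nkk'.
have [e1 e2] := (congr1 fst e, congr1 snd e); rewrite /= in e1 e2.
have c1 := mesh_close e1; have c2 := mesh_close e2.
exists ((k' - k) * N0.+1)%N.
exists (Num.floor ((k' * N0.+1)%:R * al) - Num.floor ((k * N0.+1)%:R * al)).
exists (Num.floor ((k' * N0.+1)%:R * be) - Num.floor ((k * N0.+1)%:R * be)).
have E (t : R) : ((k' - k) * N0.+1)%:R * t -
   (Num.floor ((k' * N0.+1)%:R * t) - Num.floor ((k * N0.+1)%:R * t))%:~R =
   frac ((k' * N0.+1)%:R * t) - frac ((k * N0.+1)%:R * t).
  rewrite mulnBl natrB ?leq_mul2r ?(ltnW lt) ?orbT // intrB /frac; ring.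
split; first by rewrite leq_pmull // subn_gt0.
  by rewrite E distrC (lt_trans c1).
by rewrite E distrC (lt_trans c2).
Qed.

Lemma irr_mul (n : nat) (p : int) : (0 < n)%N -> n%:R * al - p%:~R != 0.
Proof.
move=> n0; apply/negP => /eqP h.
have [] := @indep (- p) n 0.
  by rewrite mul0r addr0 intrN -[n%:~R]/(n%:R) addrC.
by move=> _ /eqP; rewrite eqz_nat => /eqP n00; rewrite n00 in n0.
Qed.

(** Two small return vectors [(u1, u2)] and [(v1, v2)] of the rotation that are
    not parallel generate a fine lattice, which comes close to [(s, t)]. If the
    determinant [D] vanished, independence would make the second vector the
    multiple of the first by [n2 / n1], hence longer; but it was chosen
    shorter. *)
Lemma kronecker_int (eta s t : R) : 0 < eta ->
  exists n p r : int,
    `|n%:~R * al - s - p%:~R| < eta /\ `|n%:~R * be - t - r%:~R| < eta.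
Proof.
move=> eta0; have e2 : 0 < eta / 2 by lra.
have [n1 [p1 [r1 [n1_gt0 ua ub]]]] := recurrence 0 e2.
set u1 := n1%:R * al - p1%:~R in ua; set u2 := n1%:R * be - r1%:~R in ub.
have u1n0 : u1 != 0 by exact: irr_mul.
have mpos : 0 < Num.min `|u1| (eta / 2) by rewrite lt_min normr_gt0 u1n0 e2.
have [n2 [p2 [r2 [n2_gt va vb]]]] := recurrence n1 mpos.
set v1 := n2%:R * al - p2%:~R in va; set v2 := n2%:R * be - r2%:~R in vb.
move: va vb; rewrite !lt_min => /andP[va1 va2] /andP[vb1 vb2].
have n2_gt0 : (0 < n2)%N by apply: leq_ltn_trans n2_gt.
pose D := u1 * v2 - u2 * v1.
have Dn0 : D != 0.
  apply/negP => /eqP D0.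
  have [] := @indep (p1 * r2 - r1 * p2) (r1 * n2%:Z - n1%:Z * r2) (n1%:Z * p2 - p1 * n2%:Z).
    rewrite !intrB !intrM -[n1%:~R]/(n1%:R) -[n2%:~R]/(n2%:R) -[RHS]D0 /D /u1 /u2 /v1 /v2; ring.
  move=> _ _ /eqP; rewrite subr_eq0 => /eqP hp.
  have hp' : n1%:R * p2%:~R = p1%:~R * n2%:R :> R.
    by have := congr1 (fun z : int => z%:~R : R) hp; rewrite !intrM.
  have E : n1%:R * v1 = n2%:R * u1 by rewrite /v1 /u1 !mulrBr hp'; ring.
  have E' : n1%:R * `|v1| = n2%:R * `|u1|.
    by rewrite -[n1%:R]normr_nat -normrM E normrM normr_nat.
  have n12 : n1%:R < n2%:R :> R by rewrite ltr_nat.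
  have n1p : 0 < n1%:R :> R by rewrite ltr0n.
  have n2p : 0 < n2%:R :> R by rewrite ltr0n.
  have : n1%:R * `|v1| < n1%:R * `|u1| by rewrite ltr_pM2l.
  have : n1%:R * `|u1| < n2%:R * `|u1| by rewrite ltr_pM2r ?normr_gt0.
  by rewrite E'; lra.
pose X := (s * v2 - t * v1) / D; pose Y := (u1 * t - u2 * s) / D.
have Es : s = X * u1 + Y * v1 by rewrite /X /Y /D; field.
have Et : t = X * u2 + Y * v2 by rewrite /X /Y /D; field.
pose a := Num.floor X; pose b := Num.floor Y.
exists (a * n1%:Z + b * n2%:Z), (a * p1 + b * p2), (a * r1 + b * r2).
have fX0 := frac_ge0 X; have fX1 := frac_lt1 X.
have fY0 := frac_ge0 Y; have fY1 := frac_lt1 Y.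
have bound (w1 w2 : R) : `|w1| < eta / 2 -> `|w2| < eta / 2 ->
    `|- (frac X * w1) - frac Y * w2| < eta.
  move=> h1 h2; apply: le_lt_trans (ler_normB _ _) _.
  rewrite normrN !normrM (ger0_norm fX0) (ger0_norm fY0).
  have : frac X * `|w1| <= `|w1| by rewrite ler_piMl // ltW.
  have : frac Y * `|w2| <= `|w2| by rewrite ler_piMl // ltW.
  by lra.
split.
  have -> : (a * n1%:Z + b * n2%:Z)%:~R * al - s - (a * p1 + b * p2)%:~R =
      - (frac X * u1) - frac Y * v1.
    rewrite {1}Es /frac !intrD !intrM /a /b /u1 /v1 -[n1%:~R]/(n1%:R) -[n2%:~R]/(n2%:R); ring.
  exact: bound.
have -> : (a * n1%:Z + b * n2%:Z)%:~R * be - t - (a * r1 + b * r2)%:~R =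
    - (frac X * u2) - frac Y * v2.
  rewrite {1}Et /frac !intrD !intrM /a /b /u2 /v2 -[n1%:~R]/(n1%:R) -[n2%:~R]/(n2%:R); ring.
exact: bound.
Qed.

(** A large return time is added to the integer time, making it nonnegative. *)
Lemma kronecker (eta s t : R) : 0 < eta ->
  exists (n : nat) (p r : int),
    `|n%:R * al - s - p%:~R| < eta /\ `|n%:R * be - t - r%:~R| < eta.
Proof.
move=> eta0; have e2 : 0 < eta / 2 by lra.
have [n [p [r [h1 h2]]]] := kronecker_int s t e2.
have [m [p' [r' [mn h1' h2']]]] := recurrence `|n|%N e2.
have nm : 0 <= n + m%:Z by lia.
exists (absz (n + m%:Z)), (p + p'), (r + r').
have -> : (absz (n + m%:Z))%:R = n%:~R + m%:R :> R.
  by rewrite natr_absz ger0_norm // intrD.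
split; rewrite intrD.
  have -> : (n%:~R + m%:R) * al - s - (p%:~R + p'%:~R) =
     (n%:~R * al - s - p%:~R) + (m%:R * al - p'%:~R) by ring.
  by apply: le_lt_trans (ler_normD _ _) _; lra.
have -> : (n%:~R + m%:R) * be - t - (r%:~R + r'%:~R) =
   (n%:~R * be - t - r%:~R) + (m%:R * be - r'%:~R) by ring.
by apply: le_lt_trans (ler_normD _ _) _; lra.
Qed.

(** [q'] is the first time whose distance [x] to the integers is below [eps],
    and [q] the first time whose distance is below [x]. The determinant of the
    two approximations is a nonzero integer, so that its absolute value bounds
    [1] by [q * x + q' * D q], which is at most [2 * q * x]. *)
Lemma best_approx (eps : R) : 0 < eps ->
  exists (q : nat) (x : R), [/\ 0 < x, x < eps, 1 <= 2 * q%:R * x &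
    forall (j : nat) (p : int), (0 < j < q)%N -> x <= `|j%:R * al - p%:~R|].
Proof.
move=> eps0.
pose D (n : nat) : R := Num.min (frac (n%:R * al)) (1 - frac (n%:R * al)).
have Dle n p : D n <= `|n%:R * al - p%:~R|.
  have f0 := frac_ge0 (n%:R * al); have f1 := frac_lt1 (n%:R * al).
  have E := frac_floor (n%:R * al); rewrite /D ge_min.
  set w := Num.floor _ in E; set y := frac _ in f0 f1 E *.
  have [hp|hp] := leP p w.
    apply/orP; left; have : p%:~R <= w%:~R :> R by rewrite ler_int.
    by move=> h; rewrite ger0_norm; lra.
  apply/orP; right; have : (w + 1)%:~R <= p%:~R :> R by rewrite ler_int; lia.
  by rewrite intrD => h; rewrite ler0_norm; lra.
have Dex n : exists p, D n = `|n%:R * al - p%:~R|.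
  have f0 := frac_ge0 (n%:R * al); have f1 := frac_lt1 (n%:R * al).
  have E := frac_floor (n%:R * al); rewrite /D.
  set w := Num.floor _ in E; set y := frac _ in f0 f1 E *.
  have [h|h] := leP y (1 - y); first by exists w; rewrite ger0_norm; lra.
  by exists (w + 1); rewrite intrD ler0_norm; lra.
have Dpos n : (0 < n)%N -> 0 < D n.
  by move=> n0; have [p ->] := Dex n; rewrite normr_gt0 irr_mul.
have Dsmall e : 0 < e -> exists n, (0 < n)%N && (D n < e).
  move=> e0; have [n [p [r [n0 h1 _]]]] := recurrence 0 e0.
  by exists n; rewrite n0 (le_lt_trans (Dle n p)).
have [q' /andP[q'0 hq'] q'min] := ex_minnP (Dsmall _ eps0).
set x := D q' in hq'.
have x0 : 0 < x by exact: Dpos.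
have [q /andP[q0 hq] qmin] := ex_minnP (Dsmall _ x0).
exists q, x.
have below j p : (0 < j < q)%N -> x <= `|j%:R * al - p%:~R|.
  move=> /andP[j0 jq]; apply: le_trans (Dle j p).
  rewrite leNgt; apply/negP => h; have := qmin j; rewrite j0 h => /(_ isT).
  by rewrite leqNgt jq.
have q'q : (q' < q)%N.
  rewrite ltnNge; apply/negP => h.
  have hqe : D q < eps by apply: lt_trans hq hq'.
  have := q'min q; rewrite q0 hqe => /(_ isT) h2.
  have eqq : q = q' by apply/eqP; rewrite eqn_leq h h2.
  by move: hq; rewrite eqq ltxx.
split => //.
have [p hp] := Dex q; have [p' hp'] := Dex q'.
have nz : q%:Z * p' - q'%:Z * p != 0.
  apply/negP => /eqP; move=> /eqP; rewrite subr_eq0 => /eqP e.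
  have e' : q%:R * p'%:~R = q'%:R * p%:~R :> R.
    by have := congr1 (fun z : int => z%:~R : R) e; rewrite !intrM.
  have E : q%:R * D q' = q'%:R * D q.
    rewrite hp hp' -[q%:R]normr_nat -[q'%:R]normr_nat -!normrM !mulrBr ![`|_%:R|]normr_nat e'.
    by congr (`|_ - _|); ring.
  have qq : q'%:R < q%:R :> R by rewrite ltr_nat.
  have : q'%:R * D q < q'%:R * D q' by rewrite ltr_pM2l ?ltr0n.
  have : q'%:R * D q' < q%:R * D q' by rewrite ltr_pM2r.
  by rewrite E; lra.
have one : 1 <= `|q%:R * p'%:~R - q'%:R * p%:~R| :> R.
  have : (1 <= `|q%:Z * p' - q'%:Z * p|) by move: nz; lia.
  by rewrite -(@ler_int R) intr_norm intrB !intrM.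
have E : q%:R * p'%:~R - q'%:R * p%:~R =
   q'%:R * (q%:R * al - p%:~R) - q%:R * (q'%:R * al - p'%:~R) by ring.
move: one; rewrite E => one.
have := le_trans one (ler_normB _ _); rewrite !normrM !normr_nat -hp -hp' -/x.
have : q'%:R * D q <= q%:R * x.
  by apply: ler_pM => //; [exact/ltW/Dpos | rewrite ler_nat ltnW | exact: ltW].
by lra.
Qed.

End Kronecker.

(** * Equidistribution of a rotation of the two-torus *)

Section Equidistribution.
Variables (R : realType) (al be : R).
Hypothesis indep : forall a b c : int,
  a%:~R + b%:~R * al + c%:~R * be = 0 -> [/\ a = 0, b = 0 & c = 0].

Definition in_box (y z l zeta : R) (n : nat) : bool :=
  (frac (y + n%:R * al) < l) && (frac (z + n%:R * be) < zeta).

Definition visits (N : nat) (y z l zeta : R) : nat :=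
  (\sum_(n < N) in_box y z l zeta n)%N.

Lemma leq_sum_shift (g : nat -> nat) (N c D : nat) : (c <= D)%N ->
  (\sum_(n < N) g (n + c)%N <= \sum_(n < N + D) g n)%N.
Proof.
move=> cD; rewrite -(big_mkord xpredT (fun n => g (n + c)%N)) -(big_mkord xpredT).
have -> : (\sum_(0 <= n < N) g (n + c) = \sum_(c <= n < N + c) g n)%N.
  by rewrite -{2}[c]add0n big_addn addnK.
rewrite [leqRHS](@big_cat_nat _ _ _ (N + c)) ?leq_add2l //=.
rewrite (leq_trans _ (leq_addr _ _)) //.
by rewrite [leqRHS](@big_cat_nat _ _ _ c) ?leq_addl //= leq_addl.
Qed.

(** By Kronecker there is a time moving a square of side slightly less than
    [m^-1] into any prescribed tile of the [m] by [m] grid. The [m * m] tiles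
    are disjoint, so the [m * m] delayed copies of the visits to the small
    square are visits at different times, up to finitely many. *)
Lemma packing (m : nat) (eta : R) : (0 < m)%N -> 0 < eta < m%:R^-1 ->
  exists D : nat, forall N (y z : R),
    (m * m * visits N y z (m%:R^-1 - eta) (m%:R^-1 - eta) <= N + D)%N.
Proof.
move=> m0 /andP[eta0 etam]; set s := _ - eta.
have m0R : 0 < m%:R :> R by rewrite ltr0n.
have e2 : 0 < eta / 2 by lra.
have /choice[t ht] : forall jk : 'I_m * 'I_m, exists n : nat, exists p r : int,
    `|n%:R * al - (jk.1%:R / m%:R + eta / 2) - p%:~R| < eta / 2 /\
    `|n%:R * be - (jk.2%:R / m%:R + eta / 2) - r%:~R| < eta / 2.
  by move=> jk; exact: kronecker.
pose D := (\sum_jk t jk)%N; exists D => N y z.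
pose tile (x : R) (j : 'I_m) := j%:R <= m%:R * x < j%:R + 1.
pose g jk n := nat_of_bool (tile (frac (y + n%:R * al)) jk.1 && tile (frac (z + n%:R * be)) jk.2).
have tD jk : (t jk <= D)%N by rewrite /D (bigD1 jk) //= leq_addr.
have key (x ga theta : R) (n k : nat) (j : 'I_m) (p : int) :
    `|k%:R * ga - (j%:R / m%:R + eta / 2) - p%:~R| < eta / 2 ->
    frac (x + n%:R * ga) < s -> tile (frac (x + (n + k)%:R * ga)) j.
  rewrite ltr_norml => /andP[h1 h2] h; have h0 := frac_ge0 (x + n%:R * ga).
  have fl := frac_floor (x + n%:R * ga).
  set u := frac (x + n%:R * ga) in h h0 fl; set w := Num.floor _ in fl.
  have E : x + (n + k)%:R * ga = u + w%:~R + k%:R * ga.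
    by rewrite -fl natrD; ring.
  have jm : j%:R / m%:R + m%:R^-1 <= 1 :> R.
    rewrite -[X in _ + X]mul1r -mulrDl ler_pdivrMr // mul1r natr1 ler_nat; exact: ltn_ord.
  have j0 : 0 <= j%:R / m%:R :> R by rewrite divr_ge0.
  rewrite /s in h.
  rewrite (@frac_eq _ _ (w + p)); last by rewrite E intrD; apply/andP; split; lra.
  rewrite E intrD /tile.
  have Em : m%:R * (j%:R / m%:R) = j%:R :> R by field; rewrite gt_eqF.
  have Em1 : m%:R * m%:R^-1 = 1 :> R by rewrite divff ?gt_eqF.
  have a1 : m%:R * (j%:R / m%:R) <= m%:R * (u + w%:~R + k%:R * ga - (w%:~R + p%:~R)).
    by rewrite ler_pM2l //; lra.
  have a2 : m%:R * (u + w%:~R + k%:R * ga - (w%:~R + p%:~R)) < m%:R * (j%:R / m%:R + m%:R^-1).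
    by rewrite ltr_pM2l //; lra.
  by rewrite [X in _ < X]mulrDr Em Em1 in a2; rewrite Em in a1; rewrite a1 a2.
have -> : (m * m * visits N y z s s = \sum_(jk : 'I_m * 'I_m) visits N y z s s)%N.
  by rewrite sum_nat_const card_prod card_ord.
apply: (@leq_trans (\sum_(jk : 'I_m * 'I_m) \sum_(n < N + D) g jk n)%N).
  apply: leq_sum => jk _; apply: leq_trans (leq_sum_shift (g jk) N (tD jk)).
  apply: leq_sum => n _; rewrite /in_box /g; case: andP => //= -[h1 h2].
  have [p [r [hp hr]]] := ht jk.
  by rewrite (key _ _ 0 _ _ _ _ hp h1) (key _ _ 0 _ _ _ _ hr h2).
rewrite exchange_big /= -[X in (_ <= X)%N]card_ord -sum1_card; apply: leq_sum => n _.
have tile_inj x j j' : tile x j -> tile x j' -> j = j'.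
  move=> /andP[a1 a2] /andP[b1 b2]; apply/val_inj => /=; apply/eqP; rewrite eqn_leq.
  have : j%:R < j'%:R + 1 :> R by lra.
  have : j'%:R < j%:R + 1 :> R by lra.
  by rewrite !natr1 !ltr_nat !ltnS => -> ->.
case: (pickP (fun jk => g jk n == 1%N)) => [jk /eqP h|h].
  rewrite (bigD1 jk) //= big1 ?addn0; first by rewrite h.
  move=> jk' ne; apply/eqP; rewrite /g eqb0; apply/negP => /andP[h1 h2].
  move: h; rewrite /g; case: andP => //= -[h3 h4] _.
  move/negP: ne; apply; apply/eqP.
  by case: jk' jk h1 h2 h3 h4 => ? ? [? ?] /= h1 h2 h3 h4; congr pair; exact: (tile_inj _ _ _ h1 h3) || exact: (tile_inj _ _ _ h2 h4).
by rewrite big1 // => jk _; have := h jk; rewrite /g; case: andP.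
Qed.

Lemma covering (s : R) (a b N : nat) (y z l zeta : R) : 0 < s <= 1 ->
  l <= a%:R * s -> zeta <= b%:R * s ->
  (visits N y z l zeta <= \sum_(i < a) \sum_(j < b)
     visits N (y - i%:R * s) (z - j%:R * s) s s)%N.
Proof.
move=> /andP[s0 s1] la zb.
have key (c : nat) (x L ga : R) (n : nat) : L <= c%:R * s -> frac (x + n%:R * ga) < L ->
    exists i : 'I_c, frac (x - i%:R * s + n%:R * ga) < s.
  move=> Lc h; have h0 := frac_ge0 (x + n%:R * ga); have h1 := frac_lt1 (x + n%:R * ga).
  have fl := frac_floor (x + n%:R * ga).
  set u := frac (x + n%:R * ga) in h h0 h1 fl; set w := Num.floor _ in fl.
  have /andP[t1 t2] := truncn_itv (divr_ge0 h0 (ltW s0)).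
  set k := Num.truncn _ in t1 t2.
  rewrite ler_pdivlMr // in t1; rewrite -natr1 ltr_pdivrMr // in t2.
  have kc : (k < c)%N by rewrite -(ltr_nat R) -(ltr_pM2r s0); lra.
  exists (Ordinal kc) => /=.
  have E : x - k%:R * s + n%:R * ga = u + w%:~R - k%:R * s by rewrite -fl; ring.
  rewrite (@frac_eq _ _ w); first by rewrite E; lra.
  rewrite E.
  have e1 : u + w%:~R - k%:R * s - w%:~R = u - k%:R * s by ring.
  by rewrite e1; apply/andP; split; lra.
under eq_bigr do rewrite exchange_big /=.
rewrite exchange_big /=; apply: leq_sum => n _.
rewrite {1}/in_box; case: andP => //= -[h1 h2].
have [i hi] := key _ _ _ _ _ la h1; have [j hj] := key _ _ _ _ _ zb h2.
rewrite (bigD1 i) //= (bigD1 j) //= {1}/in_box hi hj /= -addnA.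
exact: leq_addr.
Qed.

(** Boxes are covered by the small squares of [packing]; the excess of the
    covering is at most [15 / m]. *)
Lemma visits_upper (eps : R) : 0 < eps -> exists D : nat,
  forall N (y z l zeta : R), 0 <= l <= 1 -> 0 <= zeta <= 1 ->
  (visits N y z l zeta)%:R <= (l * zeta + eps) * (N + D)%:R :> R.
Proof.
move=> eps0; pose m := (Num.truncn (15 / eps)).+2.
have m0 : 0 < m%:R :> R by rewrite ltr0n.
have m2 : 2 <= m%:R :> R by rewrite (ler_nat R 2).
have me : 15 <= m%:R * eps.
  have h := truncnS_gt (15 / eps); rewrite ltr_pdivrMr // in h.
  have : (Num.truncn (15 / eps)).+1%:R * eps <= m%:R * eps by rewrite ler_pM2r // ler_nat.
  by lra.
have mN : (0 < m)%N by [].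
clearbody m.
have mi : m%:R * m%:R^-1 = 1 :> R by rewrite divff ?gt_eqF.
pose eta : R := m%:R^-1 / m%:R.
have mi0 : 0 < m%:R^-1 :> R by rewrite invr_gt0.
have mi2 : m%:R^-1 <= 2^-1 :> R by rewrite lef_pV2 // posrE.
have eta0 : 0 < eta < m%:R^-1.
  apply/andP; split; first by rewrite divr_gt0.
  by rewrite /eta gtr_pMr //; lra.
have [D hD] := packing mN eta0; exists D => N y z l zeta hl hzeta.
set s := _ - eta in hD.
have ms : m%:R * s = 1 - m%:R^-1 by rewrite /s /eta mulrBr mulrA mi mul1r.
have s01 : 0 < s <= 1.
  by move: eta0 => /andP[e0 e1]; rewrite /s; apply/andP; split; lra.
have /andP[s0 s1] := s01.
have cover (x : R) : 0 <= x <= 1 -> exists2 a : nat, x <= a%:R * s & a%:R <= m%:R * x + 3.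
  move=> /andP[x0 x1]; exists (Num.truncn (x / s)).+1.
    by have := truncnS_gt (x / s); rewrite ltr_pdivrMr // => /ltW.
  have /andP[t _] := truncn_itv (divr_ge0 x0 (ltW s0)).
  rewrite -natr1; set k := Num.truncn _ in t *; rewrite ler_pdivlMr // in t.
  have : k%:R * (m%:R * s) <= x * m%:R by rewrite mulrCA mulrC ler_pM2r.
  rewrite ms mulrBr mulr1 => h.
  (* k (1 - 1/m) <= m x, where 1 / (1 - 1/m) <= 1 + 2/m *)
  rewrite -[k%:R + 1 <= _](@ler_pM2r _ (1 - m%:R^-1)); last by lra.
  have e : (m%:R * x + 3) * (1 - m%:R^-1) = m%:R * x + 3 - x - 3 * m%:R^-1.
    by rewrite mulrDl mulrBr mulr1 mulrAC mi; ring.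
  by rewrite e mulrDl mul1r mulrBr mulr1; lra.
have [a ha1 ha2] := cover l hl; have [b hb1 hb2] := cover zeta hzeta.
have /andP[l0 l1] := hl; have /andP[z0 z1] := hzeta.
have h1 := covering N y z s01 ha1 hb1.
have h2 : (m * m * visits N y z l zeta <= a * b * (N + D))%N.
  apply: leq_trans (leq_mul (leqnn _) h1) _.
  rewrite big_distrr /= -[X in (_ <= X)%N]mulnA -[a in X in (_ <= X)%N]card_ord -sum_nat_const.
  apply: leq_sum => i _; rewrite big_distrr /= -[b in X in (_ <= X)%N]card_ord -sum_nat_const.
  by apply: leq_sum => j _; exact: hD.
have h3 : m%:R * m%:R * (visits N y z l zeta)%:R <= a%:R * b%:R * (N + D)%:R :> R.
  by rewrite -!natrM ler_nat.
have ab : a%:R * b%:R <= m%:R * m%:R * (l * zeta + eps).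
  have ab1 : a%:R * b%:R <= (m%:R * l + 3) * (m%:R * zeta + 3) by exact: ler_pM.
  apply: le_trans ab1 _.
  have c1 : m%:R * l <= m%:R by rewrite ler_piMr // ltW.
  have c2 : m%:R * zeta <= m%:R by rewrite ler_piMr // ltW.
  have c3 : m%:R * 15 <= m%:R * (m%:R * eps) by rewrite ler_pM2l.
  have -> : (m%:R * l + 3) * (m%:R * zeta + 3) =
     m%:R * m%:R * (l * zeta) + 3 * (m%:R * l) + 3 * (m%:R * zeta) + 9 by ring.
  by rewrite [_ * (_ + eps)]mulrDr -(mulrA _ _ eps); lra.
rewrite -(@ler_pM2l _ (m%:R * m%:R)) ?mulr_gt0 //; apply: le_trans h3 _.
by rewrite mulrA ler_wpM2r.
Qed.

(** The complement of a box is covered by two boxes, which turns upper bounds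
    into lower bounds. *)
Lemma visits_complement (N : nat) (y z l zeta : R) : 0 <= l <= 1 -> 0 <= zeta <= 1 ->
  (N <= visits N y z l zeta + visits N (y - l) z (1 - l) 1
      + visits N y (z - zeta) l (1 - zeta))%N.
Proof.
move=> /andP[l0 l1] /andP[z0 z1]; rewrite -!big_split /=.
rewrite -[X in (X <= _)%N]card_ord -sum1_card; apply: leq_sum => n _.
have key (x L ga : R) : 0 <= L -> L <= frac (x + n%:R * ga) ->
    frac (x - L + n%:R * ga) < 1 - L.
  move=> L0 h; have h1 := frac_lt1 (x + n%:R * ga).
  have fl := frac_floor (x + n%:R * ga).
  set u := frac (x + n%:R * ga) in h h1 fl; set w := Num.floor _ in fl.
  have E : x - L + n%:R * ga = u + w%:~R - L by rewrite -fl; ring.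
  rewrite (@frac_eq _ _ w); first by rewrite E; lra.
  rewrite E.
  have e1 : u + w%:~R - L - w%:~R = u - L by ring.
  by rewrite e1; apply/andP; split; lra.
rewrite /in_box frac_lt1 andbT.
have [h|h] := ltP (frac (y + n%:R * al)) l; last by rewrite key.
have [h'|h'] //= := ltP (frac (z + n%:R * be)) zeta.
by rewrite (key z) // addn1.
Qed.

(** The starting point is quantified after the threshold [N0]: this uniformity
    is what later allows the threshold to be compared with the scale given by
    [best_approx]. *)
Theorem equidistribution (eps : R) : 0 < eps -> exists N0 : nat,
  forall N (y z l zeta : R), (N0 <= N)%N -> 0 <= l <= 1 -> 0 <= zeta <= 1 ->
  `|(visits N y z l zeta)%:R - l * zeta * N%:R| <= eps * N%:R :> R.
Proof.
move=> eps0; have e4 : 0 < eps / 4 by lra.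
have [D hD] := visits_upper e4.
exists (Num.truncn ((2 + eps) * D%:R / (eps / 2))).+1 => N y z l zeta hN hl hz.
have big : (2 + eps) * D%:R <= eps / 2 * N%:R.
  have h := truncnS_gt ((2 + eps) * D%:R / (eps / 2)).
  rewrite [leRHS]mulrC -ler_pdivrMr; last by lra.
  by apply: le_trans (ltW h) _; rewrite ler_nat.
have /andP[l0 l1] := hl; have /andP[z0 z1] := hz.
have lz0 : 0 <= l * zeta by rewrite mulr_ge0.
have lz1 : l * zeta <= 1 by rewrite mulr_ile1.
have D0 : 0 <= D%:R :> R by []. 
have N0 : 0 <= N%:R :> R by []. 
have lzD : l * zeta * D%:R <= D%:R by rewrite ler_piMl.
have u1 := hD N y z l zeta hl hz.
have hl' : 0 <= 1 - l <= 1 by apply/andP; split; lra.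
have h11 : 0 <= (1 : R) <= 1 by rewrite ler01 lexx.
have hz' : 0 <= 1 - zeta <= 1 by apply/andP; split; lra.
have u2 := hD N (y - l) z (1 - l) 1 hl' h11.
have u3 := hD N y (z - zeta) l (1 - zeta) hl hz'.
have lo := visits_complement N y z hl hz; rewrite -(ler_nat R) !natrD in lo.
rewrite !natrD in u1 u2 u3.
set v1 := (visits N y z l zeta)%:R in u1 lo *.
set v2 := (visits N (y - l) _ _ _)%:R in u2 lo; set v3 := (visits N y (z - zeta) _ _)%:R in u3 lo.
have epsD : 0 <= eps * D%:R by rewrite mulr_ge0 // ltW.
rewrite mulr1 in u2.
have u1' : v1 <= l * zeta * N%:R + l * zeta * D%:R + eps / 4 * N%:R + eps / 4 * D%:R.
  by apply: le_trans u1 _; rewrite le_eqVlt; apply/orP; left; apply/eqP; ring.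
have lD : l * D%:R <= D%:R by rewrite ler_piMl.
have lD0 : 0 <= l * D%:R by rewrite mulr_ge0.
have lzD0 : 0 <= l * zeta * D%:R by rewrite mulr_ge0.
have u23 : v2 + v3 <= (1 - l * zeta) * N%:R + (1 - l * zeta) * D%:R + eps / 2 * N%:R + eps / 2 * D%:R.
  by apply: le_trans (lerD u2 u3) _; rewrite le_eqVlt; apply/orP; left; apply/eqP; field.
rewrite mulrDl in big.
rewrite !mulrBl !mul1r in u23.
by rewrite ler_norml; apply/andP; split; lra.
Qed.

End Equidistribution.

(** * Contents invariant under the section map *)

Section Nocut.
Variable R : realType.
Implicit Types (a l : R).

(** No horizontal edge lies strictly inside the vertical interval from [a] to
    [a + l]; such an interval moves rigidly through the squares. *)
Definition uncut a l : bool := a + l <= (Num.floor a)%:~R + 1.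

Lemma uncut_floor a l r : uncut a l -> 0 <= r < l -> Num.floor (a + r) = Num.floor a.
Proof.
rewrite /uncut => h /andP[r0 rl]; apply: floor_def.
have := floor_le a; rewrite intrD => h1; apply/andP; split; lra.
Qed.

Lemma uncut_le1 a l : uncut a l -> l <= 1.
Proof. by rewrite /uncut; have := floor_le a; lra. Qed.

Lemma uncut_sub a l a' l' : uncut a l -> a <= a' -> 0 < l' -> a' + l' <= a + l ->
  uncut a' l'.
Proof.
move=> h aa l0 hl; rewrite /uncut.
have -> : Num.floor a' = Num.floor a.
  have -> : a' = a + (a' - a) by lra.
  by apply: (uncut_floor h); apply/andP; split; lra.
by move: h; rewrite /uncut; lra.
Qed.

Lemma uncut_floor_sub a l a' l' : uncut a l -> a <= a' -> 0 < l' -> a' + l' <= a + l ->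
  Num.floor a' = Num.floor a.
Proof.
move=> h aa l0 hl; have -> : a' = a + (a' - a) by lra.
by apply: (uncut_floor h); apply/andP; split; lra.
Qed.

Lemma uncutDz a l (p : int) : uncut (a + p%:~R) l = uncut a l.
Proof. by rewrite /uncut floorDz intrD addrAC -[X in _ <= X]addrA [p%:~R + 1]addrC addrA lerD2r. Qed.

Lemma uncutPn a l : ~~ uncut a l -> 0 <= l -> exists p : int, a < p%:~R < a + l.
Proof.
rewrite /uncut -ltNge => h l0; exists (Num.floor a + 1); rewrite intrD h andbT.
by have := floorD1_gt a; rewrite intrD.
Qed.

End Nocut.

Section Content.
Variables (R : realType) (d : nat) (rho tau : {perm 'I_d}) (al be : R).

(** When the abscissa advances by one, the height goes from [a] to [a + al]:
    the trajectory crosses that many horizontal edges and then one vertical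
    edge. *)
Definition wall_perm (a : R) : {perm 'I_d} :=
  ((tau ^+ absz (Num.floor (a + al) - Num.floor a)) * rho)%g.

(** [nu i a l c] stands for the mass of the points of square [i] whose height
    lies in an interval of length [l] starting at [a] and whose third coordinate
    lies in an interval of fixed length starting at [c]. *)
Record density_bounded_content (nu : 'I_d -> R -> R -> R -> R) : Prop := {
  nu_ge0 : forall i a l c, 0 <= nu i a l c;
  nu_le : forall i (a l c : R), 0 <= l <= 1 -> nu i a l c <= l;
  nu_add : forall i (a l l' c : R), 0 <= l -> 0 <= l' -> l + l' <= 1 ->
    nu i a (l + l') c = nu i a l c + nu i (a + l) l' c;
  nu_per : forall i a l c (p : int), nu i (a + p%:~R) l c = nu i a l c;
  nu_step : forall i (a l c : R), 0 < l -> uncut a l -> uncut (a + al) l ->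
    nu (wall_perm a i) (a + al) l (c + be) = nu i a l c }.

Variable nu : 'I_d -> R -> R -> R -> R.
Hypothesis hnu : density_bounded_content nu.

(** An interval that no horizontal edge cuts during [n] steps, together with all
    its subintervals, is carried along by a single permutation of the
    squares. *)
Lemma transport (n : nat) (a l : R) : 0 < l ->
  (forall r, (r <= n)%N -> uncut (a + r%:R * al) l) ->
  exists s : {perm 'I_d}, forall i a' l' c, a <= a' -> 0 < l' -> a' + l' <= a + l ->
    nu (s i) (a' + n%:R * al) l' (c + n%:R * be) = nu i a' l' c.
Proof.
move=> l0; elim: n => [|n IH] h.
  by exists 1%g => i a' l' c *; rewrite perm1 !mul0r !addr0.
have [r rn|s hs] := IH; first by apply: h; rewrite leqW.
exists (s * wall_perm (a + n%:R * al))%g => i a' l' c aa l'0 al'.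
rewrite permM -(hs i a' l' c) //.
have E (t : R) : t + n.+1%:R * al = t + n%:R * al + al by rewrite -natr1; ring.
have u1 := h n (leqnSn _); have u2 := h n.+1 (leqnn _); rewrite E in u2.
rewrite E -[in LHS]natr1 mulrDl mul1r addrA.
have f1 : Num.floor (a' + n%:R * al) = Num.floor (a + n%:R * al).
  by apply: (uncut_floor_sub u1 (l' := l')) => //; lra.
have f2 : Num.floor (a' + n%:R * al + al) = Num.floor (a + n%:R * al + al).
  by apply: (uncut_floor_sub u2 (l' := l')) => //; lra.
have -> : wall_perm (a + n%:R * al) = wall_perm (a' + n%:R * al).
  by rewrite /wall_perm f1 f2.
apply: (nu_step hnu) => //.
  by apply: (uncut_sub u1) => //; lra.
by apply: (uncut_sub u2) => //; lra.
Qed.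

Definition deficient (M eps a l c : R) : {set 'I_d} :=
  [set i | M * l - nu i a l c < eps * l].

(** [M] is the supremum of the densities and [kappa] the largest number of
    squares that can have density arbitrarily close to [M] over a common box.
    Maximality of [kappa] provides the gap [eps0]: [kappa] squares that are
    almost extremal over a box are all the squares within [eps0] of the maximum
    there, which is how the sets for neighbouring boxes are compared. *)
Lemma extremal (i0 : 'I_d) : exists (M : R) (kappa : nat) (eps0 : R),
  [/\ (0 < kappa)%N, 0 < eps0,
    forall i (a l c : R), 0 < l -> uncut a l -> nu i a l c <= M * l,
    forall a l c : R, 0 < l -> uncut a l -> (#|deficient M eps0 a l c| <= kappa)%N &
    forall eps : R, 0 < eps -> exists a l c : R, [/\ 0 < l, uncut a l &
      (kappa <= #|deficient M eps a l c|)%N]].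
Proof.
pose S : set R := fun x => exists i a l c, [/\ 0 < l, uncut a l & x = nu i a l c / l].
have S0 : (S !=set0)%classic.
  exists (nu i0 0 1 0 / 1); exists i0, 0, 1, 0; split => //.
  by rewrite /uncut floor0 lexx.
have Sub : has_ubound S.
  exists 1 => x [i [a [l [c [l0 u ->]]]]]; rewrite ler_pdivrMr // mul1r.
  by apply: (nu_le hnu); rewrite ltW //= (uncut_le1 u).
pose M := sup S.
have leM i a l c : 0 < l -> uncut a l -> nu i a l c <= M * l.
  move=> l0 u; rewrite -ler_pdivrMr //; apply: ub_le_sup => //.
  by exists i, a, l, c.
pose Q (k : nat) : bool := `[< forall eps : R, 0 < eps -> exists a l c, [/\ 0 < l, uncut a l &
      (k <= #|deficient M eps a l c|)%N] >].
have Q1 : Q 1%N.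
  apply/asboolP => eps eps0.
  have [x [i [a [l [c [l0 u ->]]]]] hx] := sup_adherent eps0 (conj S0 Sub).
  exists a, l, c; split => //; apply/card_gt0P; exists i; rewrite inE.
  by move: hx; rewrite ltr_pdivlMr // -/M mulrBl; lra.
have Qd k : Q k -> (k <= d)%N.
  move=> /asboolP /(_ 1 ltr01) [a [l [c [_ _ h]]]].
  by apply: leq_trans h _; rewrite -[X in (_ <= X)%N]card_ord max_card.
have [kappa /asboolP Qk kmax] := ex_maxnP (ex_intro Q _ Q1) Qd.
have k0 : (0 < kappa)%N by apply: kmax.
have nQ : ~~ Q kappa.+1 by apply/negP => /kmax; rewrite ltnn.
have [eps0 eps00 heps0] : exists2 eps0 : R, 0 < eps0 &
    forall a l c : R, 0 < l -> uncut a l -> (#|deficient M eps0 a l c| <= kappa)%N.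
  apply: contrapT => H; apply: (negP nQ); apply/asboolP => eps e0; apply: contrapT => H2.
  apply: H; exists eps => // a l c l0 u; rewrite leqNgt; apply/negP => h.
  by apply: H2; exists a, l, c.
by exists M, kappa, eps0.
Qed.

End Content.

Section SuperAdditive.
Variable R : realType.
Variables (E : R -> R -> R) (A B : R).
Hypothesis E_ge0 : forall a l, A <= a -> 0 <= l -> a + l <= B -> 0 <= E a l.
Hypothesis E_add : forall a l l', A <= a -> 0 <= l -> 0 <= l' -> a + (l + l') <= B ->
  E a (l + l') = E a l + E (a + l) l'.

Lemma superadditive_sorted (l : R) (s : seq R) (a L : R) : 0 < l -> A <= a -> 0 <= L ->
  a + L <= B ->
  path (fun x y => x + l <= y) (a - l) s -> all (fun x => x + l <= a + L) s ->
  \sum_(x <- s) E x l <= E a L.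
Proof.
move=> l0; elim: s a L => [|p s IH] a L Aa L0 aB; first by rewrite big_nil => _ _; exact: E_ge0.
rewrite /= subrK => /andP[ap hp] /andP[pL hs].
have -> : E a L = E a (p - a) + E p l + E (p + l) (a + L - p - l).
  have {1}-> : L = (p - a) + (l + (a + L - p - l)) by ring.
  rewrite E_add; [|lra..]; have -> : a + (p - a) = p by ring.
  by rewrite (@E_add p) ?addrA //; lra.
rewrite big_cons -addrA -[X in X <= _]add0r lerD //; first by apply: E_ge0; lra.
rewrite lerD2l; apply: IH; try lra; first by rewrite addrK.
by have -> : p + l + (a + L - p - l) = a + L by ring.
Qed.

(** Disjoint pieces of an interval share at most the deficiency of the
    interval. *)
Lemma superadditive (T : eqType) (l : R) (s : seq T) (pos : T -> R) (a L : R) :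
  0 < l -> A <= a -> 0 <= L -> a + L <= B -> uniq s ->
  {in s &, forall x y, x != y -> l <= `|pos x - pos y|} ->
  {in s, forall x, a <= pos x /\ pos x + l <= a + L} ->
  \sum_(x <- s) E (pos x) l <= E a L.
Proof.
move=> l0 Aa L0 aB us gap ran.
rewrite -(big_map pos xpredT (fun x => E x l)).
pose t := sort <=%R (map pos s).
have pt : perm_eq t (map pos s) by rewrite perm_sort.
rewrite -(perm_big _ pt) /=.
have ut : uniq t.
  rewrite (perm_uniq pt) map_inj_in_uniq // => x y xs ys e; apply/eqP/negP => /negP ne.
  by have := gap _ _ xs ys ne; rewrite e subrr normr0; lra.
have st : sorted <%R t by rewrite lt_sorted_uniq_le ut /= (sort_sorted (@le_total _ _)).
have mt x : x \in t -> exists2 y, y \in s & x = pos y.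
  by rewrite (perm_mem pt) => /mapP.
apply: superadditive_sorted => //.
  have : sorted (fun x y => x + l <= y) t.
    apply: (sub_in_sorted (P := mem t) _ _ st); last by apply/allP.
    move=> x y /mt[x' xs ->] /mt[y' ys ->] lt.
    have ne : x' != y' by apply/eqP => e; rewrite e ltxx in lt.
    by have := gap _ _ xs ys ne; rewrite ler0_norm; lra.
  case: t mt {pt ut st} => //= p t mt ->; rewrite andbT subrK.
  by have [|y ys ->] := mt p; [rewrite mem_head | case: (ran y ys)].
by apply/allP => x /mt[y ys ->]; case: (ran y ys).
Qed.

End SuperAdditive.

(** * Uniqueness at full height *)

Lemma half_pred_bounds (q N0 : nat) : (2 * N0 + 4 <= q)%N ->
  [/\ (q.-1./2 + q.-1./2 < q)%N, (q <= 2 * (q.-1./2).+1)%N & (N0 <= (q.-1./2).+1)%N].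
Proof. by move=> h; have := odd_double_half q.-1; split; lia. Qed.

Section Planar.
Variables (R : realType) (d : nat) (rho tau : {perm 'I_d}) (al be : R).
Hypothesis indep : forall a b c : int,
  a%:~R + b%:~R * al + c%:~R * be = 0 -> [/\ a = 0, b = 0 & c = 0].
Hypothesis al0 : 0 < al.
Hypothesis trans : forall C : {set 'I_d}, C != finset.set0 ->
  (forall i, i \in C -> rho i \in C) -> (forall i, i \in C -> tau i \in C) ->
  forall i, i \in C.
Variable mu : 'I_d -> R -> R -> R.
Let nu (i : 'I_d) (a l : R) (c : R) := mu i a l.
Hypothesis hmu : density_bounded_content rho tau al be nu.
Hypothesis total : forall a l : R, 0 <= l <= 1 -> \sum_i mu i a l = l.

Lemma transport_between (N : nat) (a l : R) : 0 < l ->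
  (forall r, (r <= N)%N -> uncut (a + r%:R * al) l) ->
  forall n n', (n <= N)%N -> (n' <= N)%N ->
  exists s : {perm 'I_d}, forall i,
    mu (s i) (a + n'%:R * al) l = mu i (a + n%:R * al) l.
Proof.
move=> l0 h n n' nN nN'.
have fwd k k' : (k <= N)%N -> (k' <= N)%N -> (k <= k')%N ->
  exists s : {perm 'I_d}, forall i,
    mu (s i) (a + k'%:R * al) l = mu i (a + k%:R * al) l.
  move=> kN kN' kk.
  have [r rn|s hs] := transport hmu (n := (k' - k)%N) (a := a + k%:R * al) l0.
    have -> : a + k%:R * al + r%:R * al = a + (k + r)%:R * al by rewrite natrD; ring.
    by apply: h; lia.
  exists s => i; have := hs i (a + k%:R * al) l 0 (lexx _) l0 (lexx _).
  by rewrite /nu => <-; congr mu; rewrite natrB //; ring.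
have [le|/ltnW le] := leqP n n'; first exact: fwd.
have [s hs] := fwd _ _ nN' nN le.
by exists s^-1%g => i; rewrite -{2}[i](permKV s) hs.
Qed.

Section Extremal.
Variables (M : R) (kappa : nat) (eps0 : R).
Hypothesis kappa0 : (0 < kappa)%N.
Hypothesis eps00 : 0 < eps0.
Hypothesis leM : forall i (a l : R), 0 < l -> uncut a l -> mu i a l <= M * l.
Hypothesis few : forall a l : R, 0 < l -> uncut a l -> (#|deficient nu M eps0 a l 0| <= kappa)%N.
Hypothesis many : forall eps : R, 0 < eps -> exists a l : R, [/\ 0 < l, uncut a l &
      (kappa <= #|deficient nu M eps a l 0|)%N].

Let e (i : 'I_d) (a l : R) := M * l - mu i a l.

Lemma e_ge0 i a l : 0 < l -> uncut a l -> 0 <= e i a l.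
Proof. by move=> l0 u; rewrite subr_ge0 leM. Qed.

Lemma mu_add i a l l' : 0 <= l -> 0 <= l' -> l + l' <= 1 ->
  mu i a (l + l') = mu i a l + mu i (a + l) l'.
Proof. exact: (nu_add hmu i a 0). Qed.

Lemma mu_per i a l (p : int) : mu i (a + p%:~R) l = mu i a l.
Proof. exact: (nu_per hmu i a l 0 p). Qed.

Lemma mu0 i a : mu i a 0 = 0.
Proof.
have := @mu_add i a 0 0 (lexx 0) (lexx 0).
by rewrite !addr0 ler01 => /(_ isT); lra.
Qed.

Lemma e_add i a l l' : 0 <= l -> 0 <= l' -> l + l' <= 1 ->
  e i a (l + l') = e i a l + e i (a + l) l'.
Proof. by move=> *; rewrite /e mu_add //; ring. Qed.

Lemma e_ge0' i a l a' l' : 0 < l -> uncut a l -> 0 <= l' -> a <= a' -> a' + l' <= a + l ->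
  0 <= e i a' l'.
Proof.
move=> l0 u; rewrite le_eqVlt => /orP[/eqP <-|w0] ap pw; first by rewrite /e mu0 mulr0 subrr.
by apply: e_ge0 => //; apply: (uncut_sub u).
Qed.

Lemma e_le i a l a' l' : 0 < l' -> a <= a' -> a' + l' <= a + l -> uncut a l ->
  e i a' l' <= e i a l.
Proof.
move=> l'0 aa al' u.
have l1 := uncut_le1 u.
have -> : e i a l = e i a (a' - a) + e i a' l' + e i (a' + l') (a + l - a' - l').
  have {1}-> : l = (a' - a) + (l' + (a + l - a' - l')) by ring.
  rewrite e_add; [|lra..]; have -> : a + (a' - a) = a' by ring.
  by rewrite (@e_add i a') ?addrA //; lra.
have h1 : 0 <= e i a (a' - a) by apply: (e_ge0' _ _ u); lra.
have h2 : 0 <= e i (a' + l') (a + l - a' - l') by apply: (e_ge0' _ _ u); lra.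
by lra.
Qed.

(** A cut at forward time [n] and a cut at backward time [n'] would bring
    [(n + n') * al] within [l] of an integer, although [n + n' < q]. Hence cuts
    cannot occur in both time directions. *)
Lemma uncut_long (N q : nat) (b l x : R) : 0 <= l -> l < x -> (N + N < q)%N ->
  (forall (j : nat) (p : int), (0 < j < q)%N -> x <= `|j%:R * al - p%:~R|) ->
  uncut b l ->
  (forall n, (n <= N)%N -> uncut (b + n%:R * al) l) \/
  (forall n, (n <= N)%N -> uncut (b - n%:R * al) l).
Proof.
move=> l0 lx Nq hx u; apply: contrapT => /not_orP[].
move=> /asboolPn/existsp_asboolPn[n /asboolPn/imply_asboolPn[nN /negP cutn]].
move=> /asboolPn/existsp_asboolPn[n' /asboolPn/imply_asboolPn[nN' /negP cutn']].
have [p /andP[p1 p2]] := uncutPn cutn l0.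
have [p' /andP[p1' p2']] := uncutPn cutn' l0.
have n0 : (0 < n)%N by rewrite lt0n; apply: contra cutn => /eqP ->; rewrite mul0r addr0.
have nn : (0 < n + n' < q)%N by rewrite addn_gt0 n0 (leq_ltn_trans _ Nq) // leq_add.
have := hx _ (p - p') nn; apply/negP; rewrite -ltNge natrD intrB ltr_norml.
by apply/andP; split; lra.
Qed.

(** At a scale comparable to [1 / q], for a best approximation time [q], every
    uncut interval has [kappa] almost extremal squares. Such an interval
    travels for about [q / 2] steps without being cut; its positions are
    disjoint and enter a given almost extremal interval in the right
    proportion, so at one of them each of the [kappa] squares has small
    deficiency, and these squares are transported back. *)
Lemma good_scale (eps eps' : R) : 0 < eps -> 24 * d%:R * eps < eps' ->
  exists m : nat, (1 < m)%N /\ forall b, uncut b (2 / m%:R) ->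
    (kappa <= #|deficient nu M eps' b (2 / m%:R) 0|)%N.
Proof.
move=> epsp hee'.
have eps'0 : 0 < eps'.
  by apply: le_lt_trans hee'; rewrite mulr_ge0 ?mulr_ge0 // ltW.
have [a0 [L [L0 uK hC]]] := many epsp.
set C := deficient _ _ _ _ _ _ in hC.
have L1 := uncut_le1 uK.
have L4 : 0 < L / 4 by lra.
have [N0 hN0] := equidistribution indep L4.
have NN0 : 0 < (2 * (2 * N0 + 4))%:R^-1 :> R by rewrite invr_gt0 ltr0n muln_gt0 addn_gt0 orbT.
have x40 : 0 < Num.min (L / 4) (Num.min 4^-1 (2 * (2 * N0 + 4))%:R^-1).
  by rewrite !lt_min L4 NN0 !andbT /=; lra.
have [q [x [x0 + qx hx]]] := best_approx indep x40.
rewrite !lt_min => /and3P[xL x4 xN].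
have q1 : (2 * N0 + 4 <= q)%N.
  rewrite -(ler_nat R) -(@ler_pM2r _ (2 * x)) ?mulr_gt0 //.
  apply: (@le_trans _ _ 1); last by lra.
  have N4 : 0 < (2 * (2 * N0 + 4))%:R :> R by rewrite -invr_gt0.
  move: xN; rewrite -[_^-1]mul1r ltr_pdivlMr // natrM; set y := (2 * N0 + 4)%:R; lra.
pose N := (q.-1)./2.
have [NNq Nq N0N] := half_pred_bounds q1; rewrite -/N in NNq Nq N0N.
(* 2 < m x <= 3: the length 2 / m is just below x *)
pose m := (Num.truncn (2 / x)).+1.
have m0 : 0 < m%:R :> R by rewrite ltr0n.
have mx : 2 < m%:R * x.
  by have := truncnS_gt (2 / x); rewrite ltr_pdivrMr.
have mx3 : m%:R * x <= 3.
  have /andP[t _] := truncn_itv (divr_ge0 (ler0n R 2) (ltW x0)).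
  rewrite ler_pdivlMr // in t.
  by rewrite /m -natr1 mulrDl mul1r; lra.
have m1 : (1 < m)%N.
  rewrite -(ltr_nat R) -(ltr_pM2r x0); lra.
clearbody m.
exists m; split => // b ub.
set l := 2 / m%:R in ub *.
have l0 : 0 < l by rewrite divr_gt0.
have lx : l < x by rewrite /l ltr_pdivrMr // mulrC.
have [b' [n0 [n0N hb' ub']]] : exists b' n0, [/\ (n0 <= N)%N, b = b' + n0%:R * al &
    forall n, (n <= N)%N -> uncut (b' + n%:R * al) l].
  have [h|h] := uncut_long (ltW l0) lx NNq hx ub.
    by exists b, 0%N; rewrite mul0r addr0.
  exists (b - N%:R * al), N; split => //; first by rewrite subrK.
  move=> n nN; have := h (N - n)%N (leq_subr _ _).
  by rewrite natrB //; apply: etrans; congr uncut; ring.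
(* times at which the moving interval starts in the left half of the extremal
   interval, and hence is contained in it *)
pose V := [seq n <- iota 0 N.+1 | in_box al be (b' - a0) 0 (L / 2) 1 n].
have sizeV : L / 4 * N.+1%:R <= (size V)%:R.
  have sV : size V = visits al be N.+1 (b' - a0) 0 (L / 2) 1.
    rewrite /V size_filter -sum1_count big_mkcond /visits.
    by rewrite -(big_mkord xpredT (fun n => nat_of_bool (in_box al be (b' - a0) 0 (L / 2) 1 n))).
  have hL2 : 0 <= L / 2 <= 1 by apply/andP; split; lra.
  have h11 : 0 <= (1 : R) <= 1 by rewrite ler01 lexx.
  have := hN0 N.+1 (b' - a0) 0 (L / 2) 1 N0N hL2 h11.
  by rewrite -sV mulr1 ler_norml => /andP[h _]; lra.
pose pos n := a0 + frac (b' - a0 + n%:R * al).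
have posE n : exists p : int, b' + n%:R * al = pos n + p%:~R.
  exists (Num.floor (b' - a0 + n%:R * al)); rewrite /pos -addrA.
  have := frac_floor (b' - a0 + n%:R * al); set u := frac _; set w := _%:~R; lra.
have inV n : n \in V -> (n <= N)%N /\ frac (b' - a0 + n%:R * al) < L / 2.
  by rewrite mem_filter mem_iota /= add0n ltnS /in_box => /andP[/andP[-> _] ->].
have [n nV good] : exists2 n, n \in V & forall i, i \in C -> e i (pos n) l < eps' * l.
  apply: contrapT => H.
  have bad n : n \in V -> eps' * l <= \sum_(i in C) e i (pos n) l.
    move=> nV.
    have [i iC hi] : exists2 i, i \in C & eps' * l <= e i (pos n) l.
      apply: contrapT => H2; apply: H; exists n => // i iC; rewrite ltNge.
      by apply/negP => h; apply: H2; exists i.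
    have [nN _] := inV _ nV; have [p hp] := posE n.
    have upos : uncut (pos n) l by rewrite -(uncutDz _ _ p) -hp ub'.
    rewrite (bigD1 i) //= -[X in X <= _]addr0; apply: lerD => //.
    by apply: sumr_ge0 => j _; exact: e_ge0.
  have S1 : eps' * l * (size V)%:R <= \sum_(n <- V) \sum_(i in C) e i (pos n) l.
    have -> : eps' * l * (size V)%:R = \sum_(n <- V) eps' * l.
      by rewrite big_const_seq count_predT iter_addr_0 mulr_natr.
    by rewrite big_seq [leRHS]big_seq; apply: ler_sum => k kV; exact: bad.
  have S2 : \sum_(n <- V) \sum_(i in C) e i (pos n) l <= d%:R * (eps * L).
    rewrite exchange_big /=.
    apply: (@le_trans _ _ (\sum_(i in C) eps * L)).
      apply: ler_sum => i iC; apply: (@le_trans _ _ (e i a0 L)); last first.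
        by move: iC; rewrite inE => /ltW.
      have Lge := ltW L0.
      apply: (@superadditive _ (e i) a0 (a0 + L) _ _ _ l V pos a0 L) => //.
      - by move=> p w ap w0 pw; apply: (e_ge0' _ L0 uK).
      - by move=> p w w' ap w0 w'0 pw; apply: e_add => //; lra.
      - by rewrite filter_uniq // iota_uniq.
      - move=> k k' kV k'V ne.
        have [kN _] := inV _ kV; have [kN' _] := inV _ k'V.
        have [p hp] := posE k; have [p' hp'] := posE k'.
        wlog lt : k k' p p' kV k'V ne kN kN' hp hp' / (k < k')%N.
          move=> W; have [lt|lt|eqk] := ltngtP k k'; first exact: (W k k' p p').
            by rewrite distrC; apply: (W k' k p' p) => //; rewrite eq_sym.
          by rewrite eqk eqxx in ne.
        have kk : (0 < k' - k < q)%N by rewrite subn_gt0 lt (leq_ltn_trans _ NNq) // leq_subLR (leq_trans kN') // addnA leq_addl.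
        have := hx _ (p' - p) kk; rewrite natrB ?(ltnW lt) // intrB (distrC (pos k)).
        have -> : pos k' - pos k = (k'%:R - k%:R) * al - (p'%:~R - p%:~R).
          have -> : pos k = b' + k%:R * al - p%:~R by rewrite hp; ring.
          have -> : pos k' = b' + k'%:R * al - p'%:~R by rewrite hp'; ring.
          by ring.
        by move=> h; apply: ltW; apply: lt_le_trans lx h.
      - move=> k kV; have [kN] := inV _ kV; have := frac_ge0 (b' - a0 + k%:R * al).
        by rewrite /pos; split; lra.
    have cC : #|C|%:R <= d%:R :> R by rewrite ler_nat -[X in (_ <= X)%N]card_ord max_card.
    by rewrite sumr_const -[leLHS]mulr_natl ler_wpM2r // mulr_ge0 // ltW.
  have S3 := le_trans S1 S2.
  (* l * (size V) >= (2/m) (L/4) (N+1) >= L/24 since m <= 3/x and q x >= 1/2 *)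
  have lN : L / 24 <= l * (size V)%:R.
    apply: (@le_trans _ _ (l * (L / 4 * N.+1%:R))); last by rewrite ler_pM2l.
    have mP : m%:R <= 12 * N.+1%:R :> R.
      rewrite -(@ler_pM2r _ x) //.
      have : q%:R * x <= (2 * N.+1)%:R * x by rewrite ler_pM2r // ler_nat.
      by rewrite natrM; set P := N.+1%:R; lra.
    have -> : l * (L / 4 * N.+1%:R) = L * N.+1%:R / 2 / m%:R.
      by rewrite /l; field; rewrite gt_eqF.
    rewrite ler_pdivlMr //.
    have : L * m%:R <= L * (12 * N.+1%:R) by rewrite ler_pM2l.
    by set P := N.+1%:R; lra.
  have : eps' * (L / 24) <= d%:R * (eps * L).
    by apply: le_trans S3; rewrite -mulrA ler_pM2l.
  have : 24 * d%:R * eps * (L / 24) < eps' * (L / 24) by rewrite ltr_pM2r //; lra.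
  by lra.
have [nN _] := inV _ nV.
have [s hs] := transport_between l0 ub' nN n0N.
have [p hp] := posE n.
apply: leq_trans hC _; rewrite -(card_imset C (@perm_inj _ s)); apply: subset_leq_card.
apply/fintype.subsetP => _ /imsetP[i iC ->]; rewrite inE /nu hb' hs hp.
by rewrite mu_per; exact: good.
Qed.

(** Two overlapping intervals of the good scale determine the same set of
    almost extremal squares on their common half, because there are never more
    than [kappa] of them. Chaining from the bottom to the top of a square, one
    set of [kappa] squares is almost extremal over the full height. *)
Lemma almost_full (eps : R) : 0 < eps -> 2 * eps <= eps0 ->
  (kappa <= #|[set i | (e i 0 1 <= 2 * eps)%R]|)%N.
Proof.
move=> epsp he.
have dpos : 0 < 24 * d%:R + 1 :> R by rewrite ltr_wpDl // mulr_ge0.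
have [||m [m1 hm]] := @good_scale (eps / (24 * d%:R + 1)) eps.
- by rewrite divr_gt0.
- by rewrite mulrA ltr_pdivrMr // mulrDr mulr1 mulrC; lra.
have m0 : 0 < m%:R :> R by rewrite ltr0n ltnW.
have mi0 : 0 < 1 / m%:R :> R by rewrite divr_gt0.
have E2 : 2 / m%:R = 1 / m%:R + 1 / m%:R :> R by rewrite -mulrDl.
have ES t : t.+1%:R / m%:R = t%:R / m%:R + 1 / m%:R :> R by rewrite -mulrDl natr1.
have um t (w : R) : (t < m)%N -> t%:R / m%:R + w <= 1 -> uncut (t%:R / m%:R) w.
  move=> tm h; have h1 : 0 <= (t%:R / m%:R : R) < 1.
    by rewrite divr_ge0 //= ltr_pdivrMr // mul1r ltr_nat.
  by rewrite /uncut (floor01 h1) mulr0z add0r.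
have tm1 t : (t < m)%N -> t%:R / m%:R + 1 / m%:R <= 1 :> R.
  by move=> tm; rewrite -mulrDl natr1 ler_pdivrMr // mul1r ler_nat.
pose J t := deficient nu M eps0 (t%:R / m%:R) (1 / m%:R) 0.
pose G t := deficient nu M eps (t%:R / m%:R) (2 / m%:R) 0.
have pair t : (t.+1 < m)%N -> G t = J t /\ G t = J t.+1.
  move=> tm; have tm' := ltnW tm.
  have t2 : t%:R / m%:R + 2 / m%:R <= 1 :> R by rewrite E2 addrA -ES tm1.
  have u2 := um _ _ tm' t2.
  have hG := hm _ u2; rewrite -/(G t) in hG.
  have sub a : uncut a (1 / m%:R) -> t%:R / m%:R <= a ->
      a + 1 / m%:R <= t%:R / m%:R + 2 / m%:R ->
      G t = deficient nu M eps0 a (1 / m%:R) 0.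
    move=> ua ta at2; apply/eqP; rewrite eqEcard; apply/andP; split.
      apply/fintype.subsetP => i; rewrite !inE => h.
      apply: (le_lt_trans (e_le i mi0 ta at2 u2)); apply: (lt_le_trans h).
      by rewrite E2 -mulr2n mulrnAr -mulrnAl ler_pM2r // -mulr_natl.
    by apply: leq_trans hG; exact: few.
  split; apply: sub; rewrite ?ES ?E2; try lra.
  - by apply: um => //; exact: tm1.
  - by rewrite -ES; apply: um => //; exact: tm1.
have JJ t : (t < m)%N -> J t = J 0%N.
  elim: t => // t IH tm; have [h1 h2] := pair t tm.
  by rewrite -h2 h1; apply: IH; apply: ltnW.
have small i t : i \in J 0%N -> (t < m)%N -> e i (t%:R / m%:R) (1 / m%:R) <= 2 * eps * (1 / m%:R).
  move=> iJ tm.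
  have [s [sm st]] : exists s, (s.+1 < m)%N /\ (t = s \/ t = s.+1).
    have [lt|ge] := ltnP t.+1 m; first by exists t; split=> //; left.
    by exists t.-1; split; [|right]; lia.
  have sm' := ltnW sm.
  have [hs _] := pair s sm.
  have : i \in G s by rewrite hs JJ.
  rewrite inE => /ltW h.
  have s2 : s%:R / m%:R + 2 / m%:R <= 1 :> R by rewrite E2 addrA -ES tm1.
  have u2 := um _ _ sm' s2.
  have -> : 2 * eps * (1 / m%:R) = eps * (2 / m%:R) by rewrite E2; ring.
  apply: le_trans h; apply: e_le => //.
    by have := ES s; case: st => ->; lra.
  by have := ES s; case: st => ->; lra.
have J0 : (kappa <= #|J 0%N|)%N.
  have [<- _] := pair 0%N m1; apply: hm.
  by apply: um; rewrite ?mul0r ?add0r ?(ltnW m1) // ler_pdivrMr // mul1r (ler_nat R 2).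
apply: leq_trans J0 _; apply: subset_leq_card; apply/fintype.subsetP => i iJ; rewrite inE.
have claim t : (t <= m)%N -> e i 0 (t%:R / m%:R) <= t%:R * (2 * eps * (1 / m%:R)).
  elim: t => [|t IH] tm; first by rewrite !mul0r /e mu0 mulr0 subrr.
  rewrite ES e_add ?divr_ge0 //; last exact: tm1.
  have := IH (ltnW tm); have := small i t iJ tm; rewrite add0r -[t.+1%:R]natr1.
  by set K := 2 * eps * _; lra.
have := claim m (leqnn _); rewrite divff ?gt_eqF //.
by have -> : m%:R * (2 * eps * (1 / m%:R)) = 2 * eps by field; rewrite gt_eqF.
Qed.

Let Cmax : {set 'I_d} := [set i | e i 0 1 <= 0].

(** There are finitely many squares, hence a positive gap between full-height
    deficiencies that vanish and those that do not. *)
Lemma Cmax_card : (kappa <= #|Cmax|)%N.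
Proof.
pose w := \big[Num.min/eps0]_(i | 0 < e i 0 1) e i 0 1.
have w0 : 0 < w by apply/bigmin_gtP; split.
have we : w <= eps0 by apply/bigmin_leP; left.
have w4 : 0 < w / 4 by lra.
have w2 : 2 * (w / 4) <= eps0 by lra.
apply: leq_trans (almost_full w4 w2) _; apply: subset_leq_card; apply/fintype.subsetP => i.
rewrite !inE => h; rewrite leNgt; apply/negP => ep.
have : w <= e i 0 1 by exact: bigmin_le_cond.
by lra.
Qed.

Lemma Cmax_e i a l : i \in Cmax -> 0 < l -> uncut a l -> e i a l = 0.
Proof.
rewrite inE => hi l0 u; apply/eqP; rewrite eq_le e_ge0 // andbT.
have E : a = frac a + (Num.floor a)%:~R := frac_floor a.
have -> : e i a l = e i (frac a) l by rewrite /e {1}E mu_per.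
move: u; rewrite {1}E uncutDz /uncut floor01 ?frac_ge0 ?frac_lt1 // mulr0z add0r => u.
apply: le_trans hi; apply: e_le => //; rewrite ?frac_ge0 ?add0r //.
by rewrite /uncut floor0 add0r.
Qed.

Lemma CmaxE a l : 0 < l -> uncut a l -> Cmax = deficient nu M eps0 a l 0.
Proof.
move=> l0 u; apply/eqP; rewrite eqEcard (leq_trans (few l0 u) Cmax_card) andbT.
by apply/fintype.subsetP => i iC; rewrite inE; have := Cmax_e iC l0 u; rewrite /e /nu => ->; rewrite mulr_gt0.
Qed.

Lemma Cmax_wall a l i : 0 < l -> uncut a l -> uncut (a + al) l -> i \in Cmax ->
  wall_perm rho tau al a i \in Cmax.
Proof.
move=> l0 u u' iC; rewrite (CmaxE l0 u') inE -[0]addr0.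
have := nu_step hmu i 0 l0 u u'; have := Cmax_e iC l0 u.
by rewrite /e /nu => h ->; rewrite h mulr_gt0.
Qed.

Lemma stable_perm (C : {set 'I_d}) (s : {perm 'I_d}) :
  (forall i, i \in C -> s i \in C) -> forall i, (s i \in C) = (i \in C).
Proof.
move=> h i; apply/idP/idP; last exact: h.
have E : s @: C = C.
  apply/eqP; rewrite eqEcard card_imset ?leqnn ?andbT; last exact: perm_inj.
  by apply/fintype.subsetP => _ /imsetP[j jC ->]; exact: h.
by rewrite -{1}E => /imsetP[j jC /perm_inj ->].
Qed.

(** The left side of a square is split by the flow at height [1 - frac al]: the
    part below crosses [k] horizontal edges before the vertical edge and the
    part above [k + 1] of them. Comparing the two, the set of extremal squares
    is stable under [tau] and [rho]. *)
Lemma Cmax_full : forall i, i \in Cmax.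
Proof.
have fl : 0 < frac al.
  rewrite lt_neqAle frac_ge0 andbT eq_sym; apply/negP => /eqP h.
  have := frac_floor al; rewrite h add0r => e0.
  have [] := @indep (- Num.floor al) 1 0; last by [].
  by rewrite intrN -e0; ring.
have fl1 := frac_lt1 al.
have E : al = frac al + (Num.floor al)%:~R := frac_floor al.
set k := absz (Num.floor al).
have fk : Num.floor al = k%:Z by rewrite /k gez0_abs // floor_ge0 ltW.
have w0 i : i \in Cmax -> rho ((tau ^+ k)%g i) \in Cmax.
  move=> iC; have := @Cmax_wall 0 (1 - frac al) i _ _ _ iC.
  rewrite /wall_perm add0r floor0 subr0 permM; apply; first by lra.
    by rewrite /uncut floor0; lra.
  by rewrite /uncut {1}E; lra.
have w1 i : i \in Cmax -> rho ((tau ^+ k)%g (tau i)) \in Cmax.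
  move=> iC; have := @Cmax_wall (1 - frac al) (frac al) i _ _ _ iC.
  have e1 : 1 - frac al + al = (Num.floor al + 1)%:~R by rewrite intrD {2}E; ring.
  have e0 : Num.floor (1 - frac al) = 0 by apply: floor01; apply/andP; split; lra.
  have e2 : absz (Num.floor al + 1) = k.+1 by rewrite fk; lia.
  rewrite /wall_perm /uncut e1 e0 subr0 intrKfloor e2 expgS !permM; apply; try lra.
have tauC i : i \in Cmax -> tau i \in Cmax.
  move=> iC; have := w1 i iC.
  by have := @stable_perm Cmax ((tau ^+ k) * rho)%g _ (tau i); rewrite permM => -> // j jC; rewrite permM w0.
have tauk j : ((tau ^+ k)%g j \in Cmax) = (j \in Cmax).
  apply: stable_perm => {}j jC; elim: k {fk w0 w1} => [|n IH]; first by rewrite expg0 perm1.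
  by rewrite expgSr permM tauC.
apply: trans => //.
  by rewrite -card_gt0; apply: leq_trans Cmax_card.
move=> i iC; rewrite -[i](permKV (tau ^+ k)%g); apply: w0.
by rewrite -tauk permKV.
Qed.

Lemma extremal_uniform i a l : 0 < l -> uncut a l -> mu i a l = l / d%:R.
Proof.
move=> l0 u; have u1 : uncut (0 : R) 1 by rewrite /uncut floor0 add0r.
have eq0 j b w : 0 < w -> uncut b w -> mu j b w = M * w.
  move=> w0 ub; have := @Cmax_e j b w; move=> /(_ (Cmax_full j) w0 ub).
  by rewrite /e; lra.
have d0 : 0 < d%:R :> R by rewrite ltr0n (leq_ltn_trans _ (ltn_ord i)).
have Md : M * d%:R = 1.
  have h11 : 0 <= (1 : R) <= 1 by rewrite ler01 lexx.
  have := total 0 h11; rewrite (eq_bigr (fun=> M)); last by move=> j _; rewrite eq0 // mulr1.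
  by rewrite sumr_const card_ord mulr_natr.
by rewrite eq0 // -[l]mulr1 -{2}Md; field; rewrite gt_eqF.
Qed.

End Extremal.

(** Extremal density is attained by every square, so all densities are equal. *)
Theorem planar_uniform i a l : 0 < l -> uncut a l -> mu i a l = l / d%:R.
Proof.
have [M [kappa [eps0 [k0 e0 leM few many]]]] := extremal hmu i.
apply: (@extremal_uniform M kappa eps0) => //.
- by move=> j b w w0 ub; exact: leM j b w 0 w0 ub.
- by move=> b w; exact: few.
- by move=> eps /many[b [w [c h]]]; exists b, w.
Qed.

End Planar.

(** * Uniqueness for boxes *)

Lemma sum_bool_le1 (T : finType) (P : pred T) :
  (forall x y, P x -> P y -> x = y) -> (\sum_x P x <= 1)%N.
Proof.
move=> h; case: (pickP P) => [x Px|h0]; last by rewrite big1 // => x _; rewrite h0.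
rewrite (bigD1 x) //= Px big1 // => y ne; apply/eqP; rewrite eqb0; apply/negP => Py.
by rewrite (h _ _ Py Px) eqxx in ne.
Qed.

Section Solid.
Variables (R : realType) (d : nat) (rho tau : {perm 'I_d}) (al be : R).
Hypothesis indep : forall a b c : int,
  a%:~R + b%:~R * al + c%:~R * be = 0 -> [/\ a = 0, b = 0 & c = 0].
Hypothesis al0 : 0 < al.
Hypothesis trans : forall C : {set 'I_d}, C != finset.set0 ->
  (forall i, i \in C -> rho i \in C) -> (forall i, i \in C -> tau i \in C) ->
  forall i, i \in C.
Variable mu : 'I_d -> R -> R -> R -> R -> R.

(** Here both the height interval and the interval of the third coordinate are
    variable. A box that is full in the third direction does not depend on where
    it starts. *)
Record box_content : Prop := {
  box_slice : forall zeta : R, 0 <= zeta <= 1 ->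
    density_bounded_content rho tau al be (fun i a l c => mu i a l c zeta);
  box_add : forall i (a l c zeta zeta' : R), 0 <= zeta -> 0 <= zeta' -> zeta + zeta' <= 1 ->
    mu i a l c (zeta + zeta') = mu i a l c zeta + mu i a l (c + zeta) zeta';
  box_per : forall i (a l c zeta : R) (p : int), mu i a l (c + p%:~R) zeta = mu i a l c zeta;
  box_full : forall i (a l c c' : R), mu i a l c 1 = mu i a l c' 1;
  box_total : forall a l c zeta : R, 0 <= l <= 1 -> 0 <= zeta <= 1 ->
    \sum_i mu i a l c zeta = l * zeta }.

Hypothesis hmu : box_content.

Lemma box_ge0 i (a l c zeta : R) : 0 <= zeta <= 1 -> 0 <= mu i a l c zeta.
Proof. by move=> h; exact: (nu_ge0 (box_slice hmu h)). Qed.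

Lemma box_le i (a l c zeta : R) : 0 <= l <= 1 -> 0 <= zeta <= 1 -> mu i a l c zeta <= l * zeta.
Proof.
move=> hl hz; rewrite -(box_total hmu a c hl hz) (bigD1 i) //= lerDl.
by apply: sumr_ge0 => j _; exact: box_ge0.
Qed.

(** Boxes whose third coordinates are shifted by [v] differ by two boxes of
    thickness [v], whose mass is controlled by [box_total]. *)
Lemma box_lip i (a l c c' zeta : R) : 0 <= l <= 1 -> zeta <= 1 -> `|c - c'| <= zeta ->
  mu i a l c zeta <= mu i a l c' zeta + l * `|c - c'|.
Proof.
move=> hl z1.
have step (u v : R) : 0 <= v <= zeta ->
    mu i a l (u + v) zeta <= mu i a l u zeta + l * v /\
    mu i a l u zeta <= mu i a l (u + v) zeta + l * v.
  move=> /andP[v0 vz].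
  have e1 : mu i a l u zeta = mu i a l u v + mu i a l (u + v) (zeta - v).
    by rewrite -(box_add hmu) ?subr_ge0 //; [congr mu; ring | lra].
  have e2 : mu i a l (u + v) zeta = mu i a l (u + v) (zeta - v) + mu i a l (u + v + (zeta - v)) v.
    by rewrite -(box_add hmu) ?subr_ge0 //; [congr mu; ring | lra].
  have v01 : 0 <= v <= 1 by apply/andP; split; lra.
  have b1 := box_le i a u hl v01; have b2 := box_le i a (u + v + (zeta - v)) hl v01.
  have b3 := box_ge0 i a l u v01; have b4 := box_ge0 i a l (u + v + (zeta - v)) v01.
  by split; lra.
move=> h; have := h; rewrite ler_norml => /andP[h1 h2].
have [le|lt] := leP c c'.
  have hv : 0 <= c' - c <= zeta by rewrite subr_ge0 le /=; lra.
  have [_] := step c _ hv; have -> : c + (c' - c) = c' by ring.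
  have -> : `|c - c'| = c' - c by rewrite ler0_norm; lra.
  by [].
have hv : 0 <= c - c' <= zeta by apply/andP; split; lra.
have [] := step c' _ hv; have -> : c' + (c - c') = c by ring.
by have -> : `|c - c'| = c - c' by rewrite ger0_norm; lra.
Qed.

Lemma box_planar i (a l c : R) : 0 < l -> uncut a l -> mu i a l c 1 = l / d%:R.
Proof.
move=> l0 u; have h11 : 0 <= (1 : R) <= 1 by rewrite ler01 lexx.
have hs := box_slice hmu h11.
apply: (@planar_uniform R d rho tau al be indep al0 trans (fun i a l => mu i a l c 1)) => //.
  split.
  - by move=> j b w _; exact: (nu_ge0 hs).
  - by move=> j b w _; exact: (nu_le hs).
  - by move=> j b w w' _; exact: (nu_add hs).
  - by move=> j b w _; exact: (nu_per hs).
  - move=> j b w _ w0 ub ub'; rewrite (box_full hmu _ _ _ c (c + be)); exact: (nu_step hs).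
by move=> b w hw; rewrite (box_total hmu) // mulr1.
Qed.

Section Extremal.
Variables (Q : nat).
Hypothesis Q0 : (0 < Q)%N.
Let zeta : R := Q%:R^-1.
Let nu i a l c := mu i a l c zeta.
Variables (M : R) (kappa : nat) (eps0 : R).
Hypothesis kappa0 : (0 < kappa)%N.
Hypothesis eps00 : 0 < eps0.
Hypothesis leM : forall i (a l c : R), 0 < l -> uncut a l -> nu i a l c <= M * l.
Hypothesis few : forall a l c : R, 0 < l -> uncut a l -> (#|deficient nu M eps0 a l c| <= kappa)%N.
Hypothesis many : forall eps : R, 0 < eps -> exists a l c : R, [/\ 0 < l, uncut a l &
      (kappa <= #|deficient nu M eps a l c|)%N].

Let e (i : 'I_d) (a l c : R) := M * l - nu i a l c.

Lemma zeta01 : 0 <= zeta <= 1.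
Proof.
by rewrite invr_ge0 ler0n /= /zeta invf_le1 ?ltr0n // ler1n.
Qed.

Lemma slice_add i (a l l' c : R) : 0 <= l -> 0 <= l' -> l + l' <= 1 ->
  e i a (l + l') c = e i a l c + e i (a + l) l' c.
Proof. by move=> *; rewrite /e /nu (nu_add (box_slice hmu zeta01)) //; ring. Qed.

Lemma slice0 i (a c : R) : e i a 0 c = 0.
Proof.
have := @slice_add i a 0 0 c (lexx 0) (lexx 0).
by rewrite !addr0 ler01 => /(_ isT); lra.
Qed.

Lemma slice_ge0 i (a l a' l' c : R) : 0 < l -> uncut a l -> 0 <= l' -> a <= a' ->
  a' + l' <= a + l -> 0 <= e i a' l' c.
Proof.
move=> l0 u; rewrite le_eqVlt => /orP[/eqP <-|w0] ap pw; first by rewrite slice0.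
by rewrite subr_ge0 leM //; apply: (uncut_sub u).
Qed.

Lemma slice_sub i (a l a' l' c : R) : 0 < l -> uncut a l -> 0 <= l' -> a <= a' ->
  a' + l' <= a + l -> e i a' l' c <= e i a l c.
Proof.
move=> l0 u l'0 aa al'; have l1 := uncut_le1 u.
have -> : e i a l c = e i a (a' - a) c + e i a' l' c + e i (a' + l') (a + l - a' - l') c.
  have {1}-> : l = (a' - a) + (l' + (a + l - a' - l')) by ring.
  rewrite slice_add; [|lra..]; have -> : a + (a' - a) = a' by ring.
  by rewrite (@slice_add i a') ?addrA //; lra.
have h1 : 0 <= e i a (a' - a) c by apply: (slice_ge0 _ _ l0 u); lra.
have h2 : 0 <= e i (a' + l') (a + l - a' - l') c by apply: (slice_ge0 _ _ l0 u); lra.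
by lra.
Qed.

Lemma slice_grid i (a l c : R) (m : nat) : 0 <= l -> m%:R * l <= 1 ->
  \sum_(t < m) e i (a + t%:R * l) l c = e i a (m%:R * l) c.
Proof.
move=> l0; elim: m => [|m IH] hm; first by rewrite big_ord0 mul0r slice0.
have hm' : m%:R * l <= 1.
  by apply: le_trans hm; rewrite ler_wpM2r // ler_nat.
have E : m.+1%:R * l = m%:R * l + l by rewrite -natr1; ring.
by rewrite big_ord_recr /= IH // E slice_add // ?mulr_ge0 // -E.
Qed.

(** The times [n j] bring the height back to within [L / 4] while moving the third
    coordinate by about [j / A.+1]. The middle half of the extremal interval is
    divided into [m] pieces. Only a small proportion of the pieces is bad for
    some [j], and at each time at most one piece is cut; a large [m] leaves a
    piece that is good and uncut for all [j] at once. Transporting the extremal squares by [n j] shows [kappa] almost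
    extremal squares above the same piece at all the levels. *)
Lemma common_piece (eps' : R) (A : nat) : 0 < eps' ->
  exists (b l c0 : R) (n : nat -> nat) (r : nat -> int),
   [/\ 0 < l, uncut b l &
     forall j, (j <= A)%N -> `|(n j)%:R * be - j%:R / A.+1%:R - (r j)%:~R| < A.+1%:R^-1 /\
       (kappa <= #|deficient nu M eps' b l (c0 + (n j)%:R * be)|)%N].
Proof.
move=> e'0.
pose eps := eps' / (8 * d.+1%:R * A.+1%:R).
have epsp : 0 < eps by rewrite divr_gt0 // !mulr_gt0.
have [a0 [L [c0 [L0 uK hC]]]] := many epsp.
set C := deficient _ _ _ _ _ _ in hC.
have L1 := uncut_le1 uK.
have eta0 : 0 < Num.min (L / 4) A.+1%:R^-1 by rewrite lt_min invr_gt0 ltr0n andbT; lra.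
have /boolp.choice[n /boolp.choice[p /boolp.choice[r hnpr]]] : forall j : nat, exists (n : nat) (p r : int),
    `|n%:R * al - 0 - p%:~R| < Num.min (L / 4) A.+1%:R^-1 /\
    `|n%:R * be - j%:R / A.+1%:R - r%:~R| < Num.min (L / 4) A.+1%:R^-1.
  by move=> j; exact: kronecker.
pose s j := (n j)%:R * al - (p j)%:~R.
have sL j : `|s j| < L / 4.
  by have [h _] := hnpr j; move: h; rewrite subr0 lt_min => /andP[].
pose B := (\sum_(j < A.+1) (n j).+1)%N.
(* at most m / 4 pieces are bad for some j, and the cuts spoil at most B *)
have [m mE] : exists m, m = (4 * B).+1 by exists (4 * B).+1.
have m0 : 0 < m%:R :> R by rewrite mE ltr0n.
pose l := L / 2 / m%:R.
have l0 : 0 < l by rewrite !divr_gt0.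
have ml : m%:R * l = L / 2 by rewrite /l; field; rewrite gt_eqF.
pose b (t : nat) := a0 + L / 4 + t%:R * l.
pose badE j (t : 'I_m) := [exists i in C, eps' * l <= e i (b t - s j) l c0].
pose cut j k (t : 'I_m) := ~~ uncut (b t - s j + k%:R * al) l.
have bl (t : 'I_m) : 0 <= t%:R * l /\ t%:R * l + l <= L / 2.
  split; first by rewrite mulr_ge0 // ltW.
  have -> : t%:R * l + l = t.+1%:R * l by rewrite -natr1; ring.
  by rewrite -ml ler_pM2r // ler_nat ltn_ord.
have inK (t : 'I_m) j : a0 <= b t - s j /\ b t - s j + l <= a0 + L.
  have := sL j; rewrite ltr_norml => /andP[h1 h2]; have [h3 h4] := bl t.
  by rewrite /b; split; lra.
have cardE j : (\sum_(t < m) badE j t)%:R * (8 * A.+1%:R) <= 2 * m%:R :> R.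
  have h1 : (\sum_(t < m) badE j t)%:R * (eps' * l) <= \sum_(t < m) \sum_(i in C) e i (b t - s j) l c0.
    rewrite natr_sum mulr_suml; apply: ler_sum => t _.
    have nn i : 0 <= e i (b t - s j) l c0.
      by have [u1 u2] := inK t j; apply: (slice_ge0 _ _ L0 uK) => //; exact: ltW.
    case: (boolP (badE j t)) => [/existsP[i /andP[iC hi]]|_]; last by rewrite mul0r sumr_ge0.
    by rewrite mul1r (bigD1 i) //= -[leLHS]addr0 lerD // sumr_ge0.
  have h2 : \sum_(t < m) \sum_(i in C) e i (b t - s j) l c0 <= d.+1%:R * (eps * L).
    rewrite exchange_big /=; apply: (@le_trans _ _ (\sum_(i in C) eps * L)).
      apply: ler_sum => i; rewrite inE => /ltW iC; apply: (@le_trans _ _ (e i a0 L c0)) iC.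
      have -> : \sum_(t < m) e i (b t - s j) l c0 = e i (a0 + L / 4 - s j) (L / 2) c0.
        rewrite -ml -slice_grid ?(ltW l0) ?ml //; last by lra.
        by apply: eq_bigr => t _; congr (e i _ l c0); rewrite /b; ring.
      have := sL j; rewrite ltr_norml => /andP[h3 h4].
      by apply: (slice_sub _ _ L0 uK); lra.
    have cC : #|C|%:R <= d.+1%:R :> R by rewrite ler_nat (leq_trans (max_card _)) // card_ord.
    by rewrite sumr_const -[leLHS]mulr_natl ler_wpM2r // mulr_ge0 // ltW.
  have h3 := le_trans h1 h2.
  have d0 : 0 < d.+1%:R :> R by rewrite ltr0n.
  have A0 : 0 < A.+1%:R :> R by rewrite ltr0n.
  have E1 : d.+1%:R * (eps * L) = eps' * l * (2 * m%:R) / (8 * A.+1%:R).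
    by rewrite /l /eps; field; rewrite (gt_eqF m0) !nat1r !pnatr_eq0.
  move: h3; rewrite E1 ler_pdivlMr ?mulr_gt0 // [X in X <= _](_ : _ =
    eps' * l * ((\sum_(t < m) badE j t)%:R * (8 * A.+1%:R))); last by ring.
  by rewrite ler_pM2l // mulr_gt0.
have cardcut j k : (\sum_(t < m) cut j k t <= 1)%N.
  apply: sum_bool_le1.
  have wl (t t' : 'I_m) : cut j k t -> cut j k t' -> (t < t')%N -> False.
    move=> /uncutPn/(_ (ltW l0))[q /andP[q1 q2]] /uncutPn/(_ (ltW l0))[q' /andP[q1' q2']] lt.
    have : b t + l <= b t'.
      rewrite /b -addrA lerD2l -[X in _ + X]mul1r -mulrDl natr1 ler_pM2r // ler_nat //.
    have [h1 h2] := bl t; have [h3 h4] := bl t'; rewrite /b in q1 q2 q1' q2' * => h.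
    have qq : (q < q')%R by rewrite -(ltr_int R); lra.
    have : (q + 1)%:~R <= q'%:~R :> R by rewrite ler_int -ltzD1 ltrD2r.
    by rewrite intrD; lra.
  move=> t t' ct ct'; apply/val_inj; case: (ltngtP t t') => // lt.
    by case: (wl _ _ ct ct' lt).
  by case: (wl _ _ ct' ct lt).
have [t good] : exists t : 'I_m, forall j, (j < A.+1)%N ->
    ~~ badE j t /\ forall k, (k <= n j)%N -> ~~ cut j k t.
  apply: contrapT => H.
  have : (m <= \sum_(j < A.+1) (\sum_(t < m) badE j t + \sum_(k < (n j).+1) \sum_(t < m) cut j k t))%N.
    under eq_bigr do rewrite exchange_big /= -big_split /=.
    rewrite exchange_big /= -[X in (X <= _)%N]card_ord -sum1_card; apply: leq_sum => t _.
    rewrite lt0n; apply/negP; rewrite sum_nat_eq0 => /forallP H2; apply: H; exists t => j jA.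
    have := H2 (Ordinal jA); rewrite /= addn_eq0 eqb0 => /andP[-> ]; split=> // k kn.
    have kn' : (k < (n j).+1)%N by rewrite ltnS.
    by move: b0; rewrite sum_nat_eq0 => /forallP/(_ (Ordinal kn')); rewrite /= eqb0.
  rewrite big_split /= => h.
  have h1 : (\sum_(j < A.+1) \sum_(k < (n j).+1) \sum_(t < m) cut j k t <= B)%N.
    apply: leq_sum => j _; rewrite -[X in (_ <= X)%N]card_ord -sum1_card; apply: leq_sum => k _.
    exact: cardcut.
  have h2 : (\sum_(j < A.+1) \sum_(t < m) badE j t)%:R * (8 * A.+1%:R) <= A.+1%:R * (2 * m%:R) :> R.
    rewrite natr_sum mulr_suml -[A.+1 in X in _ <= X]card_ord -sum1_card natr_sum mulr_suml.
    by apply: ler_sum => j _; rewrite mul1r; exact: cardE.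
  have h3 : (m <= \sum_(j < A.+1) \sum_(t < m) badE j t + B)%N by apply: leq_trans h _; rewrite leq_add2l.
  move: h2; set S := (\sum_(j < A.+1) _)%N in h3 *.
  have A0 : 0 < A.+1%:R :> R by rewrite ltr0n.
  have -> : S%:R * (8 * A.+1%:R) = A.+1%:R * (8 * S%:R) :> R by ring.
  rewrite ler_pM2l // -!natrM ler_nat => h2.
  by move: h2 h3; rewrite mE; clear; lia.
exists (b t), l, c0, n, r.
have inst j : (j <= A)%N -> (forall i, i \in C -> e i (b t - s j) l c0 < eps' * l) /\
   forall k, (k <= n j)%N -> uncut (b t - s j + k%:R * al) l.
  move=> jA; have [h1 h2] := good j jA; split.
    by move=> i iC; rewrite ltNge; apply: contra h1 => h; apply/existsP; exists i; rewrite iC.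
  by move=> k /h2; rewrite negbK.
have back j : b t - s j + (n j)%:R * al = b t + (p j)%:~R by rewrite /s; ring.
split => //.
  by have [_ /(_ (n 0%N) (leqnn _))] := inst 0%N (leq0n _); rewrite back uncutDz.
move=> j jA; have [hE hu] := inst j jA.
split; first by have [_] := hnpr j; rewrite lt_min => /andP[].
have [w hw] := transport (box_slice hmu zeta01) l0 hu.
apply: leq_trans hC _; rewrite -(card_imset C (@perm_inj _ w)); apply: subset_leq_card.
apply/fintype.subsetP => _ /imsetP[i iC ->]; rewrite inE.
have := hw i (b t - s j) l c0 (lexx _) l0 (lexx _).
rewrite back (nu_per (box_slice hmu zeta01)) /nu => ->.
exact: hE.
Qed.

(** Above the piece given by [common_piece], consecutive levels are closer than
    the scale at which [box_lip] changes the density noticeably, so the set of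
    almost extremal squares is the same at all levels. One square of this set is
    almost extremal in each of the [Q] boxes stacked above the piece, and these
    fill the full height, where the density is known. *)
Lemma extremal_le : M <= zeta / d%:R.
Proof.
apply/ler_addgt0Pr => eta eta0.
have z0 : 0 < zeta by rewrite invr_gt0 ltr0n.
have mn0 : 0 < Num.min (zeta / 3) (Num.min (eps0 / 6) (eta / 6)).
  by rewrite !lt_min !divr_gt0.
pose A := Num.truncn (Num.min (zeta / 3) (Num.min (eps0 / 6) (eta / 6)))^-1.
have AN : A.+1%:R^-1 < Num.min (zeta / 3) (Num.min (eps0 / 6) (eta / 6)).
  rewrite -[X in _ < X]invrK ltf_pV2 ?posrE ?ltr0n ?invr_gt0 //.
  exact: truncnS_gt.
set h := A.+1%:R^-1 in AN.
have h0 : 0 < h by rewrite invr_gt0.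
move: AN; rewrite !lt_min => /and3P[hz he heta].
have e'0 : 0 < Num.min (eps0 / 2) (eta / 2) by rewrite lt_min !divr_gt0.
have [b [l [c0 [n [r [l0 ub H]]]]]] := common_piece A e'0.
set eps' := Num.min _ _ in e'0 H.
have [e'1 e'2] : eps' <= eps0 / 2 /\ eps' <= eta / 2.
  by split; rewrite ge_min lexx ?orbT.
have l1 : 0 <= l <= 1 by rewrite (ltW l0) (uncut_le1 ub).
have z1 : zeta <= 1 by have /andP[] := zeta01.
pose c j := c0 + (n j)%:R * be - (r j)%:~R.
have cclose j : (j <= A)%N -> `|c j - (c0 + j%:R * h)| < h.
  move=> jA; have [hj _] := H j jA.
  by have -> : c j - (c0 + j%:R * h) = (n j)%:R * be - j%:R / A.+1%:R - (r j)%:~R by rewrite /c /h; ring.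
pose D j := deficient nu M eps' b l (c j).
have Dcard j : (j <= A)%N -> (kappa <= #|D j|)%N.
  move=> jA; have [_] := H j jA; rewrite /D.
  have -> : deficient nu M eps' b l (c0 + (n j)%:R * be) = deficient nu M eps' b l (c j).
    by apply/setP => i; rewrite !inE /nu -[in LHS](subrK (r j)%:~R (c0 + _)) (box_per hmu).
  by [].
have lip i u u' : `|u - u'| <= 3 * h -> M * l - nu i b l u' <= M * l - nu i b l u + l * (3 * h).
  move=> hu; have := @box_lip i b l u u' zeta l1 z1 _; rewrite -/(nu _ _ _ _) -/(nu _ _ _ _).
  have hz' : `|u - u'| <= zeta by lra.
  move=> /(_ hz'); have : l * `|u - u'| <= l * (3 * h) by rewrite ler_pM2l.
  by lra.
have DF j u : (j <= A)%N -> `|c j - u| <= 3 * h -> D j = deficient nu M eps0 b l u.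
  move=> jA ju; apply/eqP; rewrite eqEcard (leq_trans (few u l0 ub) (Dcard j jA)) andbT.
  apply/fintype.subsetP => i; rewrite !inE => hi; apply: le_lt_trans (lip i _ _ ju) _.
  have : eps' * l <= eps0 / 2 * l by rewrite ler_pM2r.
  have : l * (3 * h) <= l * (eps0 / 2) by rewrite ler_pM2l //; lra.
  by lra.
have D0 j : (j <= A)%N -> D j = D 0%N.
  elim: j => // j IH jA; apply: etrans (IH (ltnW jA)).
  have self : `|c j.+1 - c j.+1| <= 3 * h by rewrite subrr normr0 mulr_ge0 // ltW.
  apply: etrans (DF _ _ jA self) (esym (DF _ _ (ltnW jA) _)).
  have := cclose _ (ltnW jA); have := cclose _ jA; rewrite !ltr_norml -[j.+1%:R]natr1 ler_norml.
  by move=> /andP[h1 h2] /andP[h3 h4]; apply/andP; split; lra.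
have [i iD] : exists i, i \in D 0%N.
  by apply/card_gt0P; apply: leq_trans (Dcard 0%N (leq0n _)).
have tile g : (g < Q)%N -> M * l - eta * l <= nu i b l (c0 + g%:R * zeta).
  move=> gQ; pose j := (g * A.+1 %/ Q)%N.
  have jA : (j <= A)%N by rewrite -ltnS /j ltn_divLR // mulnC ltn_pmul2l.
  have QR : 0 < Q%:R :> R by rewrite ltr0n.
  have AR : 0 < A.+1%:R :> R by rewrite ltr0n.
  have j1 : j%:R * h <= g%:R * zeta.
    rewrite /h /zeta ler_pdivrMr // mulrAC ler_pdivlMr // -!natrM ler_nat.
    exact: leq_trunc_div.
  have j2 : g%:R * zeta < j.+1%:R * h.
    rewrite /h /zeta ltr_pdivrMr // mulrAC ltr_pdivlMr // -!natrM ltr_nat.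
    by rewrite /j mulnC ltn_ceil // mulnC.
  have := cclose j jA; rewrite -[j.+1%:R]natr1 mulrDl mul1r in j2.
  rewrite ltr_norml => /andP[h1 h2].
  have cj : `|c j - (c0 + g%:R * zeta)| <= 3 * h by rewrite ler_norml; apply/andP; split; lra.
  have := lip i _ _ cj; have : i \in D j by rewrite D0.
  rewrite inE => h3 h4.
  have : eps' * l <= eta / 2 * l by rewrite ler_pM2r.
  have : l * (3 * h) <= l * (eta / 2) by rewrite ler_pM2l //; lra.
  by lra.
have claim k : (k <= Q)%N -> k%:R * (M * l - eta * l) <= mu i b l c0 (k%:R * zeta).
  elim: k => [|k IH] kQ.
    rewrite !mul0r; apply: box_ge0; rewrite lexx; exact: ler01.
  have E : k.+1%:R * zeta = k%:R * zeta + zeta by rewrite -natr1; ring.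
  have kz : k.+1%:R * zeta <= 1.
    by rewrite /zeta ler_pdivrMr ?ltr0n // mul1r ler_nat.
  rewrite E (box_add hmu) ?mulr_ge0 ?(ltW z0) //; last by rewrite -E.
  by have := IH (ltnW kQ); have := tile k kQ; rewrite -natr1 mulrDl mul1r /nu; lra.
have := claim Q (leqnn _); rewrite /zeta divff ?pnatr_eq0 -?lt0n //.
rewrite (box_planar _ _ l0 ub) -mulrBl => h5.
have d0 : 0 < d%:R :> R by rewrite ltr0n (leq_ltn_trans _ (ltn_ord i)).
have QR : 0 < Q%:R :> R by rewrite ltr0n.
have h6 : Q%:R * (M - eta) <= d%:R^-1.
  by rewrite -(ler_pM2r l0) -mulrA (le_trans h5) // mulrC.
rewrite -lerBlDr mulrC ler_pdivlMr // mulrC.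
exact: h6.
Qed.

End Extremal.

(** No square exceeds the mean density, and the densities add up to [d] times
    the mean. *)
Theorem solid_uniform (Q : nat) i (a l c : R) : (0 < Q)%N -> 0 < l -> uncut a l ->
  mu i a l c Q%:R^-1 = l * Q%:R^-1 / d%:R.
Proof.
move=> Q0 l0 u; have hz := zeta01 Q0.
have [M [kappa [eps0 [k0 e0 leM few many]]]] := extremal (box_slice hmu hz) i.
have hM := extremal_le Q0 k0 e0 leM few many.
have up j : mu j a l c Q%:R^-1 <= l * Q%:R^-1 / d%:R.
  by apply: le_trans (leM j a l c l0 u) _; rewrite -mulrA [l * _]mulrC ler_pM2r.
have d0 : 0 < d%:R :> R by rewrite ltr0n (leq_ltn_trans _ (ltn_ord i)).
apply/eqP; rewrite eq_le up /=.
have hl : 0 <= l <= 1 by rewrite (ltW l0) (uncut_le1 u).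
have := box_total hmu a c hl hz; rewrite (bigD1 i) //= => E.
have : \sum_(j | j != i) mu j a l c Q%:R^-1 <= \sum_(j | j != i) l * Q%:R^-1 / d%:R.
  by apply: ler_sum => j _; exact: up.
have : l * Q%:R^-1 / d%:R + \sum_(j | j != i) l * Q%:R^-1 / d%:R = l * Q%:R^-1.
  rewrite -(bigD1 (P := predT) (F := fun=> l * Q%:R^-1 / d%:R) i) //= sumr_const card_ord.
  by rewrite -[LHS]mulr_natr divfK // gt_eqF.
by lra.
Qed.

End Solid.

(** * Visit frequencies of the section map *)

Local Open Scope classical_set_scope.
Local Open Scope ring_scope.

Section Ultralimit.
Variable R : realType.
Implicit Types u v : nat -> R.

Lemma ultra_cvg (U : set_system nat) u : UltraFilter U ->
  (forall n, 0 <= u n <= 1) -> cvg (u n @[n --> U]).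
Proof.
move=> UU ub; have UP := @ultra_proper _ _ UU.
have cpt : compact (`[0, 1] : set R) by exact: segment_compact.
have [|p [_ clp]] := cpt (u @ U) (fmap_proper_filter _ UP).
  have : U (u @^-1` `[0, 1]) by apply: filterE => n; rewrite /= in_itv /= ub.
  by [].
apply/cvg_ex; exists p => V nV.
have [//|h] := in_ultra_setVsetC (u @^-1` V) UU.
by have [x [h1 h2]] := clp (~` V) V h nV.
Qed.

(** If a sequence stayed away from [L] infinitely often, some ultrafilter
    containing those times would not converge to [L]. *)
Lemma cvg_all_ultra u (L : R) :
  (forall U : set_system nat, UltraFilter U -> \oo `<=` U -> u n @[n --> U] --> L) ->
  u n @[n --> \oo] --> L.
Proof.
move=> H; apply/cvgrPdist_lt => e e0; apply: contrapT => bad.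
pose D := [set n | ~ (`|L - u n| < e)].
have WP : ProperFilter (within D \oo).
  apply: Build_ProperFilter.
  rewrite /within /= => h; apply: bad; apply: filterS h => n hn.
  by apply: contrapT.
have [U [UU sU]] := ultraFilterLemma WP.
have UP := @ultra_proper _ _ UU.
have ooU : \oo `<=` U.
  by move=> A hA; apply: sU; rewrite /within /=; apply: filterS hA => n.
have /cvgrPdist_lt/(_ e e0) h1 := H U UU ooU.
have h2 : U D by apply: sU; apply: withinT.
by have [n [/= a b]] := filter_ex (filterI h1 h2).
Qed.

End Ultralimit.

Section Itinerary.
Variables (R : realType) (d : nat) (rho tau : {perm 'I_d}) (al be y0 z0 : R) (i0 : 'I_d).

Definition height (n : nat) : R := y0 + n%:R * al.

(** The square entered through its left side at integer abscissa [n]. *)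
Fixpoint itinerary (n : nat) : 'I_d :=
  if n is m.+1 then wall_perm rho tau al (height m) (itinerary m) else i0.

Definition hit i (a l c zeta : R) (n : nat) : bool :=
  (itinerary n == i) && in_box al be (y0 - a) (z0 - c) l zeta n.

Definition frequency (N : nat) i (a l c zeta : R) : R :=
  (\sum_(n < N) hit i a l c zeta n)%:R / N%:R.

Lemma frac_split (x l l' : R) : 0 <= l -> 0 <= l' -> l + l' <= 1 ->
  nat_of_bool (frac x < l + l') = ((frac x < l)%R + (frac (x - l) < l')%R)%N.
Proof.
move=> l0 l'0 ll; have f0 := frac_ge0 x; have f1 := frac_lt1 x; have E := frac_floor x.
set u := frac x in f0 f1 E *; set w := Num.floor x in E.
have [h|h] := ltP u l.
  have -> : frac (x - l) = u - l + 1.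
    have e : x - l - (w - 1)%:~R = u - l + 1 by rewrite intrB; lra.
    by rewrite (@frac_eq _ _ (w - 1)) e //; apply/andP; split; lra.
  have -> : u < l + l' by lra.
  by have -> : (u - l + 1 < l') = false by apply/negP; lra.
have -> : frac (x - l) = u - l.
  have e : x - l - w%:~R = u - l by lra.
  by rewrite (@frac_eq _ _ w) e //; apply/andP; split; lra.
have -> : (u - l < l') = (u < l + l') by apply/idP/idP; lra.
by case: (_ < _).
Qed.

Lemma hit_add_y i (a l l' c zeta : R) n : 0 <= l -> 0 <= l' -> l + l' <= 1 ->
  nat_of_bool (hit i a (l + l') c zeta n) = (hit i a l c zeta n + hit i (a + l) l' c zeta n)%N.
Proof.
move=> l0 l'0 ll; rewrite /hit /in_box.
have -> : y0 - (a + l) + n%:R * al = y0 - a + n%:R * al - l by ring.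
have := frac_split (y0 - a + n%:R * al) l0 l'0 ll.
by case: eqP => //= _; case: (frac (z0 - c + _) < zeta); rewrite ?andbT ?andbF.
Qed.

Lemma hit_add_z i (a l c zeta zeta' : R) n : 0 <= zeta -> 0 <= zeta' -> zeta + zeta' <= 1 ->
  nat_of_bool (hit i a l c (zeta + zeta') n) = (hit i a l c zeta n + hit i a l (c + zeta) zeta' n)%N.
Proof.
move=> l0 l'0 ll; rewrite /hit /in_box.
have -> : z0 - (c + zeta) + n%:R * be = z0 - c + n%:R * be - zeta by ring.
have := frac_split (z0 - c + n%:R * be) l0 l'0 ll.
by case: eqP => //= _; case: (frac (y0 - a + _) < l).
Qed.

(** Invariance under the section map: all heights of an uncut interval cross the
    same edges, hence undergo the same permutation. *)
Lemma hit_step i (a l c zeta : R) n : 0 < l -> uncut a l -> uncut (a + al) l ->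
  hit (wall_perm rho tau al a i) (a + al) l (c + be) zeta n.+1 = hit i a l c zeta n.
Proof.
move=> l0 u u'; rewrite /hit /in_box.
have E (y t s : R) : y - (t + s) + n.+1%:R * s = y - t + n%:R * s by rewrite -natr1; ring.
rewrite !E /=; case: (boolP (frac (y0 - a + n%:R * al) < l)) => h; last by rewrite /= !andbF.
suff -> : wall_perm rho tau al (height n) = wall_perm rho tau al a.
  by rewrite (inj_eq (@perm_inj _ _)).
have f0 := frac_ge0 (y0 - a + n%:R * al); have F := frac_floor (y0 - a + n%:R * al).
set r := frac _ in h f0 F; set p := Num.floor _ in F.
have hr : 0 <= r < l by rewrite f0.
have e1 : height n = a + r + p%:~R by rewrite /height; lra.
have e2 : height n + al = a + al + r + p%:~R by rewrite e1; ring.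
rewrite /wall_perm e2 e1 !floorDz (uncut_floor u hr) (uncut_floor u' hr).
by congr (_ ^+ absz _ * _)%g; ring.
Qed.

Lemma hit_per_y i (a l c zeta : R) (p : int) n : hit i (a + p%:~R) l c zeta n = hit i a l c zeta n.
Proof.
rewrite /hit /in_box.
have -> : y0 - (a + p%:~R) + n%:R * al = y0 - a + n%:R * al + (- p)%:~R by rewrite intrN; ring.
by rewrite fracDz.
Qed.

Lemma hit_per_z i (a l c zeta : R) (p : int) n : hit i a l (c + p%:~R) zeta n = hit i a l c zeta n.
Proof.
rewrite /hit /in_box.
have -> : z0 - (c + p%:~R) + n%:R * be = z0 - c + n%:R * be + (- p)%:~R by rewrite intrN; ring.
by rewrite fracDz.
Qed.

Lemma hit_full i (a l c c' : R) n : hit i a l c 1 n = hit i a l c' 1 n.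
Proof. by rewrite /hit /in_box !frac_lt1. Qed.

Lemma sum_hit (a l c zeta : R) N :
  (\sum_i \sum_(n < N) hit i a l c zeta n = visits al be N (y0 - a) (z0 - c) l zeta)%N.
Proof.
rewrite exchange_big /=; apply: eq_bigr => n _.
rewrite (bigD1 (itinerary n)) //= big1 ?addn0; first by rewrite /hit eqxx.
by move=> i ne; rewrite /hit eq_sym (negbTE ne).
Qed.

Lemma frequency01 N i (a l c zeta : R) : 0 <= frequency N i a l c zeta <= 1.
Proof.
rewrite divr_ge0 //=; case: N => [|N]; first by rewrite /frequency invr0 mulr0.
rewrite /frequency ler_pdivrMr ?ltr0n // mul1r ler_nat.
rewrite -[X in (_ <= X)%N]card_ord -sum1_card; apply: leq_sum => n _; exact: leq_b1.
Qed.

Hypothesis indep : forall a b c : int,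
  a%:~R + b%:~R * al + c%:~R * be = 0 -> [/\ a = 0, b = 0 & c = 0].

Lemma inv_cvg0 : (n%:R^-1 : R) @[n --> \oo] --> (0 : R).
Proof.
apply/cvgrPdist_lt => e e0; exists (Num.truncn e^-1).+1 => // n /= hn.
have n0 : 0 < n%:R :> R by rewrite ltr0n (leq_trans _ hn).
rewrite sub0r normrN ger0_norm ?invr_ge0 //.
rewrite -[e]invrK ltf_pV2 ?posrE ?invr_gt0 //.
by apply: lt_le_trans (truncnS_gt _) _; rewrite ler_nat.
Qed.

Section Mean.
Variable U : set_system nat.
Hypothesis UU : UltraFilter U.
Hypothesis ooU : \oo `<=` U.
Let UP : ProperFilter U := @ultra_proper _ _ UU.

Definition mean i (a l c zeta : R) : R := lim (frequency N i a l c zeta @[N --> U]).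

Lemma mean_cvg i (a l c zeta : R) : frequency N i a l c zeta @[N --> U] --> mean i a l c zeta.
Proof. by apply: ultra_cvg => // n; exact: frequency01. Qed.

Lemma U_cvg (u : nat -> R) (L : R) : u n @[n --> \oo] --> L -> u n @[n --> U] --> L.
Proof. by move=> h A nA; apply: ooU; exact: h. Qed.

Lemma mean_eq i (a l c zeta : R) (f : nat -> R) (L : R) :
  (forall N, frequency N i a l c zeta = f N) -> f N @[N --> U] --> L -> mean i a l c zeta = L.
Proof.
move=> /funext h; rewrite -h => hf.
exact: (cvg_unique _ (@mean_cvg i a l c zeta) hf).
Qed.

(** Limits of visit frequencies along an ultrafilter. Invariance holds because
    the visits to a box and to its image differ only by the first and the last
    term, and the total mass over all squares is given by [equidistribution]. *)
Lemma mean_content : box_content rho tau al be mean.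
Proof.
have ge0 i (a l c zeta : R) : 0 <= mean i a l c zeta.
  apply: limr_ge; first by apply/cvg_ex; exists (mean i a l c zeta); exact: mean_cvg.
  apply: filterE => N.
  by case/andP: (frequency01 N i a l c zeta).
have tot (a l c zeta : R) : 0 <= l <= 1 -> 0 <= zeta <= 1 -> \sum_i mean i a l c zeta = l * zeta.
  move=> hl hz.
  have h1 : \sum_i frequency N i a l c zeta @[N --> U] --> \sum_i mean i a l c zeta.
    by apply: cvg_big => [|i _]; [exact: add_continuous | exact: mean_cvg].
  apply: (cvg_unique _ h1) => //; apply: U_cvg.
  apply/cvgrPdist_le => e e0; have [N0 hN0] := equidistribution indep e0.
  exists N0.+1 => // N /= hN.
  have N1 : 0 < N%:R :> R by rewrite ltr0n (leq_trans _ hN).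
  rewrite /frequency -mulr_suml -natr_sum sum_hit.
  have := hN0 N (y0 - a) (z0 - c) l zeta (ltnW hN) hl hz.
  rewrite distrC -ler_pdivrMr // => h.
  have -> : l * zeta - (visits al be N (y0 - a) (z0 - c) l zeta)%:R / N%:R =
    (l * zeta * N%:R - (visits al be N (y0 - a) (z0 - c) l zeta)%:R) / N%:R.
    by rewrite mulrBl mulfK ?gt_eqF.
  by rewrite normrM normfV [`|N%:R|]ger0_norm.
split=> //.
- move=> zeta hz; split => //.
  + move=> i a l c hl; have /andP[z0' z1] := hz; have /andP[l0 l1] := hl.
    apply: (@le_trans _ _ (l * zeta)); last by rewrite ler_piMr.
    by rewrite -(tot a l c zeta hl hz) (bigD1 i) //= lerDl sumr_ge0.
  + move=> i a l l' c l0 l'0 ll.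
    apply: (mean_eq (f := fun N => frequency N i a l c zeta + frequency N i (a + l) l' c zeta)).
      move=> N; rewrite /frequency -mulrDl -natrD -big_split /=.
      by congr (_%:R / _); apply: eq_bigr => n _; exact: hit_add_y.
    by apply: cvgD; exact: mean_cvg.
  + move=> i a l c p; apply: (mean_eq (f := fun N => frequency N i a l c zeta)) => [N|].
      by congr (_%:R / _); apply: eq_bigr => n _; rewrite hit_per_y.
    exact: mean_cvg.
  + move=> i a l c l0 u u'.
    pose g := hit (wall_perm rho tau al a i) (a + al) l (c + be) zeta.
    apply: (mean_eq (f := fun N => frequency N i a l c zeta + ((g 0%N)%:R - (g N)%:R) / N%:R)).
      move=> N; rewrite /frequency -mulrDl; congr (_ / _).
      have E1 : (\sum_(n < N.+1) g n = \sum_(n < N) g n + g N)%N by rewrite big_ord_recr.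
      have E2 : (\sum_(n < N.+1) g n = g 0%N + \sum_(n < N) hit i a l c zeta n)%N.
        rewrite big_ord_recl; congr addn; apply: eq_bigr => n _.
        by rewrite -(hit_step i c zeta n l0 u u').
      have := congr1 (fun k : nat => k%:R : R) (etrans (esym E1) E2).
      by rewrite !natrD /g; lra.
    rewrite -[X in _ --> X]addr0; apply: cvgD; first exact: mean_cvg.
    apply: U_cvg; apply/cvgrPdist_le => e e0.
    have /cvgrPdist_lt/(_ e e0) := inv_cvg0; apply: filterS => N.
    rewrite !sub0r !normrN => /ltW; apply: le_trans.
    rewrite normrM [leRHS]ger0_norm ?invr_ge0 // normfV [`|N%:R|]ger0_norm // ler_piMl ?invr_ge0 //.
    by case: (g 0%N); case: (g N); rewrite ?subrr ?subr0 ?sub0r ?normrN ?normr0 ?normr1.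
- move=> i a l c zeta zeta' h0 h0' hh.
  apply: (mean_eq (f := fun N => frequency N i a l c zeta + frequency N i a l (c + zeta) zeta')).
    move=> N; rewrite /frequency -mulrDl -natrD -big_split /=.
    by congr (_%:R / _); apply: eq_bigr => n _; exact: hit_add_z.
  by apply: cvgD; exact: mean_cvg.
- move=> i a l c zeta p; apply: (mean_eq (f := fun N => frequency N i a l c zeta)) => [N|].
    by congr (_%:R / _); apply: eq_bigr => n _; rewrite hit_per_z.
  exact: mean_cvg.
- move=> i a l c c'; apply: (mean_eq (f := fun N => frequency N i a l c' 1)) => [N|].
    by congr (_%:R / _); apply: eq_bigr => n _; rewrite (hit_full _ _ _ _ c').
  exact: mean_cvg.
Qed.

End Mean.

Hypothesis al0 : 0 < al.
Hypothesis trans : forall C : {set 'I_d}, C != finset.set0 ->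
  (forall i, i \in C -> rho i \in C) -> (forall i, i \in C -> tau i \in C) ->
  forall i, i \in C.

(** All ultrafilter limits coincide by [solid_uniform]. *)
Theorem frequency_cvg (Q : nat) i (a l c : R) : (0 < Q)%N -> 0 < l -> uncut a l ->
  frequency N i a l c Q%:R^-1 @[N --> \oo] --> l * Q%:R^-1 / d%:R.
Proof.
move=> Q0 l0 u; apply: cvg_all_ultra => U UU ooU.
rewrite -(solid_uniform indep al0 trans (mean_content UU ooU) i c Q0 l0 u).
exact: mean_cvg.
Qed.

End Itinerary.

(** * Sections at a fixed fractional abscissa *)

Section Sections.
Variables (R : realType) (d : nat) (rho tau : {perm 'I_d}) (al be y0 z0 : R) (i0 : 'I_d).
Hypothesis indep : forall a b c : int,
  a%:~R + b%:~R * al + c%:~R * be = 0 -> [/\ a = 0, b = 0 & c = 0].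
Hypothesis al0 : 0 < al.
Hypothesis trans : forall C : {set 'I_d}, C != finset.set0 ->
  (forall i, i \in C -> rho i \in C) -> (forall i, i \in C -> tau i \in C) ->
  forall i, i \in C.

(** From the vertical edge crossed last, the trajectory has climbed through the
    horizontal edges between the two heights. *)
Definition square_at (X : R) : 'I_d :=
  (tau ^+ absz (Num.floor (y0 + X * al) - Num.floor (height al y0 (Num.truncn X))))%g
    (itinerary rho tau al y0 i0 (Num.truncn X)).

Local Notation hit0 := (hit rho tau al be y0 z0 i0).

Definition section_hit (s : R) i (a l c zeta : R) (n : nat) : bool :=
  [&& square_at (n%:R + s) == i, frac (y0 + (n%:R + s) * al - a) < l &
      frac (z0 + (n%:R + s) * be - c) < zeta].

Lemma truncnDs (n : nat) (s : R) : 0 <= s < 1 -> Num.truncn (n%:R + s) = n.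
Proof.
by move=> /andP[s0 s1]; apply: truncn_def; rewrite -natr1; apply/andP; split; lra.
Qed.

(** Flowing back by [s] reduces a section to the one at integer abscissas, when
    no horizontal edge cuts the interval on the way. *)
Lemma section_hit_uncut (s : R) i (a l c zeta : R) n : 0 <= s < 1 -> 0 < l ->
  uncut a l -> uncut (a - s * al) l ->
  section_hit s i a l c zeta n =
  hit0 ((tau ^+ absz (Num.floor a - Num.floor (a - s * al)))^-1%g i)
       (a - s * al) l (c - s * be) zeta n.
Proof.
move=> hs l0 u u'; rewrite /section_hit /hit /in_box /square_at truncnDs //.
have E (y t v : R) : y + (n%:R + s) * v - t = y - (t - s * v) + n%:R * v by ring.
rewrite !E; case: (boolP (frac (y0 - (a - s * al) + n%:R * al) < l)) => h; last by rewrite /= !andbF.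
congr (_ && _).
have f0 := frac_ge0 (y0 - (a - s * al) + n%:R * al).
have F := frac_floor (y0 - (a - s * al) + n%:R * al).
set r := frac _ in h f0 F; set p := Num.floor _ in F.
have hr : 0 <= r < l by rewrite f0.
have e1 : height al y0 n = a - s * al + r + p%:~R by rewrite /height; lra.
have e2 : y0 + (n%:R + s) * al = a + r + p%:~R by move: e1; rewrite /height; lra.
rewrite e1 e2 !floorDz (uncut_floor u hr) (uncut_floor u' hr).
have -> : Num.floor a + p - (Num.floor (a - s * al) + p) = Num.floor a - Num.floor (a - s * al) by ring.
set t := (_ ^+ _)%g; apply/eqP/eqP => [<-|->]; first by rewrite permK.
by rewrite permKV.
Qed.

Lemma section_hit_add (s : R) i (a l l' c zeta : R) n : 0 <= l -> 0 <= l' -> l + l' <= 1 ->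
  nat_of_bool (section_hit s i a (l + l') c zeta n) =
  (section_hit s i a l c zeta n + section_hit s i (a + l) l' c zeta n)%N.
Proof.
move=> l0 l'0 ll; rewrite /section_hit.
have -> : y0 + (n%:R + s) * al - (a + l) = y0 + (n%:R + s) * al - a - l by ring.
have := frac_split (y0 + (n%:R + s) * al - a) l0 l'0 ll.
by case: eqP => //= _; case: (frac (z0 + _ - c) < zeta); rewrite ?andbT ?andbF.
Qed.

Definition section_frequency (s : R) (N : nat) i (a l c zeta : R) : R :=
  (\sum_(n < N) section_hit s i a l c zeta n)%:R / N%:R.

(** An interval cut on the way back to the integer section splits at the cut
    into two uncut intervals. *)
Lemma section_frequency_cvg (s : R) (Q : nat) i (a l c : R) : 0 <= s < 1 -> (0 < Q)%N ->
  0 < l -> uncut a l ->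
  section_frequency s N i a l c Q%:R^-1 @[N --> \oo] --> l * Q%:R^-1 / d%:R.
Proof.
move=> hs Q0.
have one a' l' : 0 < l' -> uncut a' l' -> uncut (a' - s * al) l' ->
    section_frequency s N i a' l' c Q%:R^-1 @[N --> \oo] --> l' * Q%:R^-1 / d%:R.
  move=> l0 u u'.
  set j := ((tau ^+ absz (Num.floor a' - Num.floor (a' - s * al)))^-1%g i).
  have E : (fun N => section_frequency s N i a' l' c Q%:R^-1) =
      (fun N => frequency rho tau al be y0 z0 i0 N j (a' - s * al) l' (c - s * be) Q%:R^-1).
    apply/funext => N; congr (_%:R / _); apply: eq_bigr => n _.
    by rewrite section_hit_uncut.
  by rewrite E; exact: frequency_cvg.
move=> l0 u; case: (boolP (uncut (a - s * al) l)) => [|cut]; first exact: one.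
have [p /andP[p1 p2]] := uncutPn cut (ltW l0).
pose l1 := p%:~R - (a - s * al); pose l2 := l - l1.
have l10 : 0 < l1 by rewrite /l1; lra.
have l20 : 0 < l2 by rewrite /l2 /l1; lra.
have le1 := uncut_le1 u.
have E : (fun N => section_frequency s N i a l c Q%:R^-1) =
    (fun N => section_frequency s N i a l1 c Q%:R^-1 + section_frequency s N i (a + l1) l2 c Q%:R^-1).
  apply/funext => N; rewrite /section_frequency -mulrDl -natrD -big_split /=.
  have ll : l1 + l2 = l by rewrite /l2; ring.
  congr (_%:R / _); apply: eq_bigr => n _.
  by rewrite -section_hit_add ?(ltW l10) ?(ltW l20) ?ll.
rewrite E; have -> : l * Q%:R^-1 / d%:R = l1 * Q%:R^-1 / d%:R + l2 * Q%:R^-1 / d%:R.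
  by rewrite /l2; ring.
have pa : a + l1 - s * al = p%:~R by rewrite /l1; ring.
apply: cvgD; apply: one => //.
- by apply: (uncut_sub u) => //; rewrite /l2 in l20; lra.
- rewrite /uncut; have -> : a - s * al + l1 = p%:~R by rewrite /l1; ring.
  have : (p - 1 <= Num.floor (a - s * al))%R.
    rewrite floor_ge_int intrB.
    by have := uncut_le1 u; lra.
  by rewrite -(ler_int R) intrB; lra.
- by apply: (uncut_sub u) => //; rewrite /l2; lra.
- by rewrite pa /uncut intrKfloor /l2 /l1; lra.
Qed.

Lemma truncn_cell (Q : nat) (x : R) : (0 < Q)%N -> 0 <= x < 1 ->
  (Num.truncn (x * Q%:R) < Q)%N /\
  (Num.truncn (x * Q%:R))%:R / Q%:R <= x < (Num.truncn (x * Q%:R))%:R / Q%:R + Q%:R^-1.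
Proof.
move=> Q0 /andP[x0 x1]; have QR : 0 < Q%:R :> R by rewrite ltr0n.
have xQ : 0 <= x * Q%:R by rewrite mulr_ge0.
have /andP[h1 h2] := truncn_itv xQ.
split; first by rewrite truncn_lt_nat // gtr_pMl.
rewrite ler_pdivrMr // h1 /=.
have -> : (Num.truncn (x * Q%:R))%:R / Q%:R + Q%:R^-1 = (Num.truncn (x * Q%:R)).+1%:R / Q%:R :> R.
  by rewrite -natr1 mulrDl mul1r.
by rewrite ltr_pdivlMr.
Qed.

Lemma cell_frac (Q : nat) (x : R) (b : nat) : (b < Q)%N ->
  (frac (x - b%:R / Q%:R) < Q%:R^-1) = (Num.truncn (frac x * Q%:R) == b).
Proof.
move=> bQ; have Q0 : (0 < Q)%N by apply: leq_ltn_trans bQ.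
have QR : 0 < Q%:R :> R by rewrite ltr0n.
have f0 := frac_ge0 x; have f1 := frac_lt1 x; have E := frac_floor x.
set u := frac x in f0 f1 E *; set w := Num.floor x in E.
have b0 : 0 <= b%:R / Q%:R :> R by rewrite divr_ge0.
have b1 : b%:R / Q%:R + Q%:R^-1 <= 1 :> R.
  by rewrite -[X in _ + X]mul1r -mulrDl natr1 ler_pdivrMr // mul1r ler_nat.
have bi : 0 < Q%:R^-1 :> R by rewrite invr_gt0.
rewrite truncn_eq ?mulr_ge0 // -ler_pdivrMr // -natr1.
have -> : (u * Q%:R < b%:R + 1) = (u < b%:R / Q%:R + Q%:R^-1).
  by rewrite -ltr_pdivlMr // mulrDl mul1r.
set v := b%:R / Q%:R in b0 b1 *.
have [h|h] := leP v u.
  have e : x - v - w%:~R = u - v by lra.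
  rewrite (@frac_eq _ _ w) e; last by apply/andP; split; lra.
  by rewrite andTb ltrBlDl.
have e : x - v - (w - 1)%:~R = u - v + 1 by rewrite intrB; lra.
rewrite (@frac_eq _ _ (w - 1)) e; last by apply/andP; split; lra.
by apply/negbTE; rewrite -leNgt; lra.
Qed.

(** Each point of the section is replaced by the corner of its cell of the
    [Q] by [Q] grid; the visits to the cells are counted by
    [section_frequency_cvg]. *)
Lemma section_average (s : R) (Q : nat) (eps eta : R) (g : 'I_d -> R -> R -> R) :
  0 <= s < 1 -> (0 < Q)%N ->
  (forall i y z (b c : nat), 0 <= y < 1 -> 0 <= z < 1 -> (b < Q)%N -> (c < Q)%N ->
     b%:R / Q%:R <= y < b%:R / Q%:R + Q%:R^-1 ->
     c%:R / Q%:R <= z < c%:R / Q%:R + Q%:R^-1 ->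
     `|g i y z - g i (b%:R / Q%:R) (c%:R / Q%:R)| <= eps) ->
  0 < eta ->
  \forall N \near \oo,
   `|(\sum_(n < N) g (square_at (n%:R + s)) (frac (y0 + (n%:R + s) * al))
          (frac (z0 + (n%:R + s) * be))) / N%:R -
     (\sum_i \sum_(b < Q) \sum_(c < Q) g i (b%:R / Q%:R) (c%:R / Q%:R)) / (Q * Q * d)%:R|
    <= eps + eta.
Proof.
move=> hs Q0 hg eta0; have QR : 0 < Q%:R :> R by rewrite ltr0n.
pose G i (b c : 'I_Q) := g i (b%:R / Q%:R) (c%:R / Q%:R).
pose F N i (b c : 'I_Q) := section_frequency s N i (b%:R / Q%:R) Q%:R^-1 (c%:R / Q%:R) Q%:R^-1.
have lim1 : \sum_i \sum_(b < Q) \sum_(c < Q) F N i b c * G i b c @[N --> \oo] -->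
    \sum_i \sum_(b < Q) \sum_(c < Q) (Q%:R^-1 * Q%:R^-1 / d%:R) * G i b c.
  apply: cvg_big => [|i _]; first exact: add_continuous.
  apply: cvg_big => [|b _]; first exact: add_continuous.
  apply: cvg_big => [|c _]; first exact: add_continuous.
  apply: cvgMl; apply: section_frequency_cvg => //; first by rewrite invr_gt0.
  have b0 : 0 <= b%:R / Q%:R :> R by rewrite divr_ge0.
  have b1 : b%:R / Q%:R + Q%:R^-1 <= 1 :> R.
    by rewrite -[X in _ + X]mul1r -mulrDl natr1 ler_pdivrMr // mul1r ler_nat ltn_ord.
  have bi : 0 < Q%:R^-1 :> R by rewrite invr_gt0.
  have h : 0 <= (b%:R / Q%:R : R) < 1 by apply/andP; split; lra.
  by rewrite /uncut (floor01 h) mulr0z add0r.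
have E1 : \sum_i \sum_(b < Q) \sum_(c < Q) (Q%:R^-1 * Q%:R^-1 / d%:R) * G i b c =
   (\sum_i \sum_(b < Q) \sum_(c < Q) G i b c) / (Q * Q * d)%:R.
  rewrite mulr_suml; apply: eq_bigr => i _; rewrite mulr_suml; apply: eq_bigr => b _.
  rewrite mulr_suml; apply: eq_bigr => c _; rewrite mulrC; congr (_ * _).
  by rewrite !natrM !invfM; ring.
rewrite E1 in lim1.
move/cvgrPdist_le : lim1 => /(_ eta eta0); apply: filterS2 (nbhs_infty_gt 0) => N N0 h.
have NR : 0 < N%:R :> R by rewrite ltr0n.
rewrite -[X in `|X|](subrKA (\sum_i \sum_(b < Q) \sum_(c < Q) F N i b c * G i b c)).
apply: le_trans (ler_normD _ _) _; apply: lerD; last by rewrite distrC.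
have pick n : \sum_i \sum_(b < Q) \sum_(c < Q)
    (section_hit s i (b%:R / Q%:R) Q%:R^-1 (c%:R / Q%:R) Q%:R^-1 n)%:R * G i b c =
   g (square_at (n%:R + s))
     ((Num.truncn (frac (y0 + (n%:R + s) * al) * Q%:R))%:R / Q%:R)
     ((Num.truncn (frac (z0 + (n%:R + s) * be) * Q%:R))%:R / Q%:R).
  set i1 := square_at _; set y := y0 + _; set z := z0 + _.
  have fy : 0 <= frac y < 1 by rewrite frac_ge0 frac_lt1.
  have fz : 0 <= frac z < 1 by rewrite frac_ge0 frac_lt1.
  have [bQ _] := truncn_cell Q0 fy; have [cQ _] := truncn_cell Q0 fz.
  rewrite (bigD1 i1) //= [X in _ + X]big1 => [|i ne]; last first.
    rewrite big1 // => b _; rewrite big1 // => c _.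
    by rewrite /section_hit -/i1 eq_sym (negbTE ne) mul0r.
  rewrite addr0 (bigD1 (Ordinal bQ)) //= [X in _ + X]big1 => [|b ne]; last first.
    rewrite big1 // => c _; rewrite /section_hit cell_frac //.
    have -> : (Num.truncn (frac y * Q%:R) == b) = false.
      by apply/negbTE; apply: contra ne => /eqP e; apply/eqP/val_inj.
    by rewrite andbF mul0r.
  rewrite addr0 (bigD1 (Ordinal cQ)) //= [X in _ + X]big1 => [|c ne]; last first.
    rewrite /section_hit (@cell_frac Q z) //.
    have -> : (Num.truncn (frac z * Q%:R) == c) = false.
      by apply/negbTE; apply: contra ne => /eqP e; apply/eqP/val_inj.
    by rewrite !andbF mul0r.
  by rewrite addr0 /section_hit -/i1 eqxx !cell_frac // !eqxx mul1r.
have -> : \sum_i \sum_(b < Q) \sum_(c < Q) F N i b c * G i b c =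
  (\sum_(n < N) \sum_i \sum_(b < Q) \sum_(c < Q)
    (section_hit s i (b%:R / Q%:R) Q%:R^-1 (c%:R / Q%:R) Q%:R^-1 n)%:R * G i b c) / N%:R.
  rewrite [in RHS]exchange_big mulr_suml /=; apply: eq_bigr => i _.
  rewrite [in RHS]exchange_big mulr_suml /=; apply: eq_bigr => b _.
  rewrite [in RHS]exchange_big mulr_suml /=; apply: eq_bigr => c _.
  by rewrite -mulr_suml mulrAC; congr (_ * _); rewrite /F /section_frequency natr_sum.
rewrite -mulrBl -sumrB normrM normfV [`|N%:R|]ger0_norm // ler_pdivrMr //.
apply: le_trans (ler_norm_sum _ _ _) _.
rewrite mulr_natr -[N in X in _ <= X]card_ord -sumr_const; apply: ler_sum => n _.
rewrite pick.
set y := y0 + _; set z := z0 + _.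
have fy : 0 <= frac y < 1 by rewrite frac_ge0 frac_lt1.
have fz : 0 <= frac z < 1 by rewrite frac_ge0 frac_lt1.
have [bQ hb] := truncn_cell Q0 fy; have [cQ hc] := truncn_cell Q0 fz.
exact: hg.
Qed.

End Sections.

(** * Averages along the trajectory *)

Section TimeAverage.
Variables (R : realType) (d : nat) (rho tau : {perm 'I_d}) (al be y0 z0 : R) (i0 : 'I_d).
Hypothesis indep : forall a b c : int,
  a%:~R + b%:~R * al + c%:~R * be = 0 -> [/\ a = 0, b = 0 & c = 0].
Hypothesis al0 : 0 < al.
Hypothesis trans : forall C : {set 'I_d}, C != finset.set0 ->
  (forall i, i \in C -> rho i \in C) -> (forall i, i \in C -> tau i \in C) ->
  forall i, i \in C.
Local Notation sq := (square_at rho tau al y0 i0).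
Variables (g : 'I_d -> R -> R -> R -> R) (H : R -> R) (B eps : R) (Q : nat).
Hypothesis Q0 : (0 < Q)%N.
Hypothesis eps0 : 0 <= eps.
Hypothesis g_per : forall i x y z (p : int), g i x y (z + p%:~R) = g i x y z.
Hypothesis g_bound : forall i x y z, `|g i x y z| <= B.
Hypothesis g_mod : forall i x y z x' y' z', 0 <= x <= 1 -> 0 <= x' <= 1 ->
  0 <= y <= 1 -> 0 <= y' <= 1 ->
  `|x - x'| <= Q%:R^-1 -> `|y - y'| <= (al + 1) / Q%:R ->
  `|z - z'| <= (`|be| + 1) / Q%:R -> `|g i x y z - g i x' y' z'| <= eps.

Definition observable (X : R) : R :=
  g (sq X) (frac X) (frac (y0 + X * al)) (z0 + X * be).

Hypothesis H0 : H 0 = 0.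
Hypothesis H_mvt : forall X1 X2, 0 <= X1 -> X1 < X2 ->
  exists2 xi, X1 < xi < X2 & H X2 - H X1 = observable xi * (X2 - X1).

Let Y X : R := y0 + X * al.
Let X_ (n a : nat) : R := n%:R + a%:R / Q%:R.

Lemma QR0 : 0 < Q%:R :> R. Proof. by rewrite ltr0n. Qed.

Lemma X_S n a : X_ n a.+1 = X_ n a + Q%:R^-1.
Proof. by rewrite /X_ -natr1 mulrDl mul1r addrA. Qed.

Lemma X_ge0 n a : 0 <= X_ n a.
Proof. by rewrite addr_ge0 // divr_ge0. Qed.

Lemma frac_cell (n a : nat) (u : R) : (a < Q)%N -> X_ n a <= u < X_ n a.+1 ->
  Num.truncn u = n /\ frac u = u - n%:R.
Proof.
move=> aQ /andP[h1 h2]; have a0 : 0 <= a%:R / Q%:R :> R by rewrite divr_ge0.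
have a1 : a.+1%:R / Q%:R <= 1 :> R by rewrite ler_pdivrMr ?QR0 // mul1r ler_nat.
rewrite /X_ in h1 h2; split.
  by apply: truncn_def; rewrite -natr1; apply/andP; split; lra.
by rewrite (@frac_eq _ _ n%:Z) // -[n%:~R]/(n%:R); apply/andP; split; lra.
Qed.

(** On a cell of abscissas the observable is almost constant, unless a
    horizontal edge is crossed, where it may jump. The number of crossings is
    the increment of the floor, which telescopes when cells are added up. *)
Lemma observable_cell (n a : nat) (xi : R) : (a < Q)%N -> X_ n a < xi < X_ n a.+1 ->
  `|observable xi - observable (X_ n a)| <=
     eps + 2 * B * (Num.floor (Y (X_ n a.+1)) - Num.floor (Y (X_ n a)))%:~R.
Proof.
move=> aQ /andP[h1 h2]; have QR := QR0.
have Qi : 0 < Q%:R^-1 :> R by rewrite invr_gt0.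
have mono u v : u <= v -> Y u <= Y v by move=> uv; rewrite lerD2l ler_pM2r.
have le0 : X_ n a <= X_ n a.+1 by lra.
have fl := le_floor (mono _ _ le0).
have B0 : 0 <= B by apply: le_trans (g_bound i0 0 0 0).
have [e|ne] := eqVneq (Num.floor (Y (X_ n a.+1))) (Num.floor (Y (X_ n a))); last first.
  have : (1 <= Num.floor (Y (X_ n a.+1)) - Num.floor (Y (X_ n a)))%R.
    by move: fl ne; set u := Num.floor _; set v := Num.floor _; clear; lia.
  rewrite -(@ler_int R) => h.
  apply: le_trans (ler_normB _ _) _.
  have ob u : `|observable u| <= B by exact: g_bound.
  have o1 := ob xi; have o2 := ob (X_ n a).
  set k : R := (Num.floor (Y (X_ n a.+1)) - _)%:~R in h *.
  have : 2 * B * 1 <= 2 * B * k by rewrite ler_wpM2l // mulr_ge0.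
  rewrite mulr1 => h3; apply: le_trans (lerD o1 o2) _; rewrite -[B + B]mulr2n -[B *+ 2]mulr_natl.
  by apply: le_trans h3 _; rewrite lerDr.
rewrite e subrr mulr0z mulr0 addr0.
have fY : Num.floor (Y xi) = Num.floor (Y (X_ n a)).
  apply/eqP; rewrite eq_le; apply/andP; split; last by apply: le_floor; apply: mono; lra.
  by rewrite -e; apply: le_floor; apply: mono; lra.
have [t1 f1] : Num.truncn xi = n /\ frac xi = xi - n%:R.
  by apply: (frac_cell aQ); rewrite (ltW h1).
have [t2 f2] : Num.truncn (X_ n a) = n /\ frac (X_ n a) = X_ n a - n%:R.
  by apply: (frac_cell aQ); rewrite lexx /=; lra.
have es : sq xi = sq (X_ n a) by rewrite /square_at t1 t2 -/(Y xi) -/(Y (X_ n a)) fY.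
rewrite /observable es; rewrite X_S in h2.
have c01 (u : R) : 0 <= frac u <= 1 by rewrite frac_ge0 ltW ?frac_lt1.
apply: g_mod => //.
- by rewrite f1 f2 ger0_norm; lra.
- rewrite /frac -/(Y xi) -/(Y (X_ n a)) fY /Y.
  have -> : y0 + xi * al - (Num.floor (y0 + X_ n a * al))%:~R -
    (y0 + X_ n a * al - (Num.floor (y0 + X_ n a * al))%:~R) = (xi - X_ n a) * al by ring.
  rewrite ger0_norm; last by rewrite mulr_ge0 ?(ltW al0) //; lra.
  rewrite mulrC; apply: (@le_trans _ _ (al * Q%:R^-1)); first by rewrite ler_pM2l //; lra.
  by rewrite ler_pM2r //; lra.
have -> : z0 + xi * be - (z0 + X_ n a * be) = (xi - X_ n a) * be by ring.
rewrite normrM [`|xi - _|]ger0_norm; last by lra.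
rewrite mulrC; apply: (@le_trans _ _ (`|be| * Q%:R^-1)); first by rewrite ler_wpM2l //; lra.
by rewrite ler_pM2r //; lra.
Qed.

Lemma H_cell (n a : nat) : (a < Q)%N ->
  `|H (X_ n a.+1) - H (X_ n a) - observable (X_ n a) / Q%:R| <=
     (eps + 2 * B * (Num.floor (Y (X_ n a.+1)) - Num.floor (Y (X_ n a)))%:~R) / Q%:R.
Proof.
move=> aQ; have Qi : 0 < Q%:R^-1 :> R by rewrite invr_gt0 QR0.
have lt : X_ n a < X_ n a.+1 by rewrite X_S; lra.
have [xi hxi ->] := H_mvt (X_ge0 n a) lt.
have -> : X_ n a.+1 - X_ n a = Q%:R^-1 by rewrite X_S; ring.
rewrite -mulrBl normrM [`|Q%:R^-1|]ger0_norm ?(ltW Qi) // ler_pM2r //.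
exact: observable_cell.
Qed.

Lemma H_unit (n : nat) :
  `|H n.+1%:R - H n%:R - (\sum_(a < Q) observable (X_ n a)) / Q%:R| <=
     eps + 2 * B / Q%:R * (Num.floor (Y n.+1%:R) - Num.floor (Y n%:R))%:~R.
Proof.
have QR := QR0.
have XQ : X_ n Q = n.+1%:R by rewrite /X_ divff ?gt_eqF // natr1.
have X0 : X_ n 0 = n%:R by rewrite /X_ mul0r addr0.
have tel (f : R -> R) : \sum_(a < Q) (f (X_ n a.+1) - f (X_ n a)) = f n.+1%:R - f n%:R.
  rewrite -(big_mkord xpredT (fun a => f (X_ n a.+1) - f (X_ n a))).
  by rewrite (telescope_sumr (fun a => f (X_ n a))) // XQ X0.
rewrite -(tel H) mulr_suml -sumrB; apply: le_trans (ler_norm_sum _ _ _) _.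
apply: (@le_trans _ _ (\sum_(a < Q) (eps + 2 * B * (Num.floor (Y (X_ n a.+1)) - Num.floor (Y (X_ n a)))%:~R) / Q%:R)).
  by apply: ler_sum => a _; exact: H_cell.
rewrite -mulr_suml big_split /= sumr_const card_ord -mulr_sumr.
have -> : \sum_(a < Q) (Num.floor (Y (X_ n a.+1)) - Num.floor (Y (X_ n a)))%:~R =
   (Num.floor (Y n.+1%:R) - Num.floor (Y n%:R))%:~R :> R.
  rewrite intrB -(tel (fun x => (Num.floor (Y x))%:~R)).
  by apply: eq_bigr => a _; rewrite intrB.
rewrite -[eps *+ Q]mulr_natr; set k := _%:~R.
have -> : (eps * Q%:R + 2 * B * k) / Q%:R = eps + 2 * B / Q%:R * k by field; rewrite gt_eqF.
by [].
Qed.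

Lemma H_nat (N : nat) : (0 < N)%N ->
  `|H N%:R / N%:R - (\sum_(a < Q) (\sum_(n < N) observable (X_ n a)) / N%:R) / Q%:R| <=
     eps + 2 * B * (al + 1) / Q%:R.
Proof.
move=> N0; have QR := QR0; have NR : 0 < N%:R :> R by rewrite ltr0n.
have B0 : 0 <= B by apply: le_trans (g_bound i0 0 0 0).
have main : `|H N%:R - (\sum_(n < N) \sum_(a < Q) observable (X_ n a)) / Q%:R| <=
    eps * N%:R + 2 * B / Q%:R * (Num.floor (Y N%:R) - Num.floor (Y 0))%:~R.
  elim: {N0 NR} N => [|N IH].
    by rewrite big_ord0 mul0r subr0 H0 normr0 subrr mulr0z !mulr0 addr0.
  rewrite big_ord_recr /=.
  have -> : H N.+1%:R - (\sum_(n < N) \sum_(a < Q) observable (X_ n a) + \sum_(a < Q) observable (X_ N a)) / Q%:R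
    = (H N%:R - (\sum_(n < N) \sum_(a < Q) observable (X_ n a)) / Q%:R) +
      (H N.+1%:R - H N%:R - (\sum_(a < Q) observable (X_ N a)) / Q%:R) by ring.
  apply: le_trans (ler_normD _ _) _; apply: le_trans (lerD IH (H_unit N)) _.
  have -> : eps * N.+1%:R = eps * N%:R + eps by rewrite -natr1; ring.
  by rewrite le_eqVlt; apply/orP; left; apply/eqP; rewrite !intrB; ring.
have -> : H N%:R / N%:R - (\sum_(a < Q) (\sum_(n < N) observable (X_ n a)) / N%:R) / Q%:R =
   (H N%:R - (\sum_(n < N) \sum_(a < Q) observable (X_ n a)) / Q%:R) / N%:R.
  by rewrite [in RHS]exchange_big /= -mulr_suml; ring.
rewrite normrM normfV [`|N%:R|]ger0_norm // ler_pdivrMr //.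
apply: le_trans main _; rewrite [leRHS]mulrDl lerD2l.
have fl : (Num.floor (Y N%:R) - Num.floor (Y 0))%:~R <= (al + 1) * N%:R :> R.
  have h1 := floor_le (Y N%:R); have h2 := floorD1_gt (Y 0).
  rewrite intrB; rewrite intrD in h2; rewrite /Y in h1 h2 *.
  have : 1 <= N%:R :> R by rewrite ler1n.
  by lra.
have -> : 2 * B * (al + 1) / Q%:R * N%:R = 2 * B / Q%:R * ((al + 1) * N%:R) by ring.
by rewrite ler_wpM2l // divr_ge0 // mulr_ge0.
Qed.

Definition riemann_mean : R :=
  (\sum_i \sum_(a < Q) \sum_(b < Q) \sum_(c < Q) g i (a%:R / Q%:R) (b%:R / Q%:R) (c%:R / Q%:R))
   / (Q * Q * Q * d)%:R.

(** [H] plays the part of an antiderivative of the observable: only its mean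
    value property is used. The increments of [H] over the cells with a given
    index form the average over one section, treated by
    [section_average]. *)
Lemma time_average (eta : R) : 0 < eta ->
  \forall N \near \oo, `|H N%:R / N%:R - riemann_mean| <=
     2 * eps + eta + 2 * B * (al + 1) / Q%:R.
Proof.
move=> eta0; have QR := QR0.
pose S (a : 'I_Q) := (\sum_i \sum_(b < Q) \sum_(c < Q) g i (a%:R / Q%:R) (b%:R / Q%:R) (c%:R / Q%:R)) / (Q * Q * d)%:R.
have bi : 0 < Q%:R^-1 :> R by rewrite invr_gt0.
have cell01 (b : nat) : (b < Q)%N -> 0 <= b%:R / Q%:R :> R /\ b%:R / Q%:R + Q%:R^-1 <= 1 :> R.
  move=> bQ; split; first by rewrite divr_ge0.
  by rewrite -[X in _ + X]mul1r -mulrDl natr1 ler_pdivrMr // mul1r ler_nat.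
have sec : \forall N \near \oo, forall a : 'I_Q,
   `|(\sum_(n < N) observable (X_ n a)) / N%:R - S a| <= eps + eta.
  apply: filter_forall => a; have [a0 a1] := cell01 a (ltn_ord a).
  have hs : 0 <= (a%:R / Q%:R : R) < 1 by apply/andP; split; lra.
  have := @section_average _ _ rho tau al be y0 z0 i0 indep al0 trans (a%:R / Q%:R) Q eps eta
     (fun i y z => g i (a%:R / Q%:R) y z) hs Q0 _ eta0.
  have P : (forall i y z (b c : nat), 0 <= y < 1 -> 0 <= z < 1 -> (b < Q)%N -> (c < Q)%N ->
     b%:R / Q%:R <= y < b%:R / Q%:R + Q%:R^-1 ->
     c%:R / Q%:R <= z < c%:R / Q%:R + Q%:R^-1 ->
     `|g i (a%:R / Q%:R) y z - g i (a%:R / Q%:R) (b%:R / Q%:R) (c%:R / Q%:R)| <= eps).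
    move=> i y z b c /andP[y0' y1] /andP[z0' z1] bQ cQ /andP[b1 b2] /andP[c1 c2].
    have [b0 b1'] := cell01 b bQ; have [c0 c1'] := cell01 c cQ.
    have e1 : Q%:R^-1 <= (al + 1) / Q%:R by rewrite ler_pMl // lerDr ltW.
    have e2 : Q%:R^-1 <= (`|be| + 1) / Q%:R by rewrite ler_pMl // lerDr.
    have sa : 0 <= (a%:R / Q%:R : R) <= 1 by rewrite a0 /=; lra.
    have sb : 0 <= (b%:R / Q%:R : R) <= 1 by rewrite b0 /=; lra.
    have sy : 0 <= y <= 1 by rewrite y0' ltW.
    have near (t r q : R) : r <= t -> t < r + q -> `|t - r| <= q.
      by move=> h1 h2; rewrite ger0_norm ?subr_ge0 // lerBlDl ltW.
    apply: g_mod => //; first by rewrite subrr normr0 ltW.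
    - exact: le_trans (near _ _ _ b1 b2) e1.
    - exact: le_trans (near _ _ _ c1 c2) e2.
  move=> /(_ P); apply: filterS => N; rewrite -/(S a).
  have -> // : \sum_(n < N) observable (X_ n a) = \sum_(n < N)
       g (sq (n%:R + a%:R / Q%:R)) (a%:R / Q%:R) (frac (y0 + (n%:R + a%:R / Q%:R) * al))
         (frac (z0 + (n%:R + a%:R / Q%:R) * be)).
  apply: eq_bigr => n _; rewrite /observable -/(X_ n a).
  have [_ ->] : Num.truncn (X_ n a) = n /\ frac (X_ n a) = X_ n a - n%:R.
    by apply: (frac_cell (ltn_ord a)); rewrite lexx X_S /=; lra.
  have -> : X_ n a - n%:R = a%:R / Q%:R by rewrite /X_; ring.
  by rewrite {1}[z0 + _]frac_floor g_per.
apply: filterS2 sec (nbhs_infty_gt 0) => N hsec N0.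
have h1 := H_nat N0.
have E : riemann_mean = (\sum_(a < Q) S a) / Q%:R.
  rewrite /riemann_mean /S -mulr_suml exchange_big /= -mulrA; congr (_ * _).
  by rewrite -invfM -natrM; congr (_%:R^-1); lia.
rewrite E; set M := (\sum_(a < Q) (\sum_(n < N) observable (X_ n a)) / N%:R) / Q%:R in h1.
have h2 : `|M - (\sum_(a < Q) S a) / Q%:R| <= eps + eta.
  rewrite /M -mulrBl -sumrB normrM normfV [`|Q%:R|]ger0_norm // ler_pdivrMr //.
  apply: le_trans (ler_norm_sum _ _ _) _.
  rewrite mulr_natr -[Q in X in _ <= X]card_ord -sumr_const; apply: ler_sum => a _; exact: hsec.
rewrite -[X in `|X|](subrKA M); apply: le_trans (ler_normD _ _) _.
by lra.
Qed.

End TimeAverage.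

(** * Points of the glued surface *)

Local Open Scope quotient_scope.

Section SurfaceFacts.
Variables (R : realType) (d : nat) (right top : {perm 'I_d}).

(** A function of the squares respects the equivalence generated by the gluing
    as soon as it respects the gluing. *)
Lemma surface_inv (T : Type) (Phi : squares R d -> T) :
  (forall a b, Defs.glue right top a b -> Phi a = Phi b) ->
  forall a b, \pi_(surface R right top) a = \pi_(surface R right top) b -> Phi a = Phi b.
Proof.
move=> h a b /eqmodP /asboolP.
by elim => [u v /h //|//|u v _ -> //|u v w _ -> _ -> //].
Qed.

Lemma surface_point_glue (i i' : 'I_d) (x y x' y' : R) :
  Defs.glue right top (in_square i x y) (in_square i' x' y') ->
  surface_point right top i x y = surface_point right top i' x' y'.
Proof. by move=> h; apply/eqmodP; apply/asboolP; exact: rst_step. Qed.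

Definition coords (a : squares R d) : 'I_d * (R * R) := (projT1 a, \val (projT2 a)).

Lemma coords_in_square (i : 'I_d) (x y : R) : 0 <= x <= 1 -> 0 <= y <= 1 ->
  coords (in_square i x y) = (i, (x, y)).
Proof.
move=> hx hy; rewrite /coords /in_square /=; congr (_, _).
by rewrite val_insubd ifT //; apply/mem_set; split; rewrite /= in_itv.
Qed.

Hypothesis hconn : connected [set: surface R right top].

(** The union of the squares of [C] would be open and closed in the surface. *)
Lemma surface_transitive (C : {set 'I_d}) : C != finset.set0 ->
  (forall i, (right i \in C) = (i \in C)) -> (forall i, (top i \in C) = (i \in C)) ->
  forall i, i \in C.
Proof.
move=> /finset.set0Pn[i0 i0C] hr ht i.
pose phi (a : squares R d) : bool := projT1 a \in C.
have inv a b : Defs.glue right top a b -> phi a = phi b.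
  by case=> j s _; rewrite /phi /= ?hr ?ht.
have cphi : continuous phi.
  apply/continuousP => A _; apply/sigT_openP => j.
  have [jA|jA] := pselect (A (j \in C)).
    rewrite (_ : _ @^-1` _ = setT); first exact: openT.
    by rewrite eqEsubset; split.
  rewrite (_ : _ @^-1` _ = set0); first exact: open0.
  by rewrite eqEsubset; split.
have cF : continuous (phi \o repr : surface R right top -> bool).
  apply: repr_comp_continuous => // a b /eqP ab; apply/eqP.
  exact: (surface_inv inv ab).
pose S := (phi \o repr : surface R right top -> bool) @^-1` [set true].
have phi_pi a : S (\pi_(surface R right top) a) <-> phi a.
  have E : phi (repr (\pi_(surface R right top) a)) = phi a.
    by apply: (surface_inv inv); rewrite reprK.
  by rewrite /S /= E.
have ST : S = [set: surface R right top].
  apply: hconn.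
  - by exists (\pi_(surface R right top) (existT _ i0 (origin R))); apply/phi_pi.
  - exists S; last by rewrite setTI.
    by move/continuousP : cF; apply; exact: discrete_open.
  - exists S; last by rewrite setTI.
    by move/continuous_closedP : cF; apply; exact: discrete_closed.
have : S (\pi_(surface R right top) (existT _ i (origin R))) by rewrite ST.
by move/phi_pi.
Qed.

End SurfaceFacts.

(** * Coordinates oriented along the direction *)

Section RealInduction.
Variable R : realType.

(** The supremum of the initial segments on which [P] holds can neither be
    missed by [P] nor be passed. *)
Lemma real_induction (P : R -> Prop) :
  P 0 ->
  (forall t, 0 <= t -> P t -> exists2 e, 0 < e & forall s, 0 <= s <= e -> P (t + s)) ->
  (forall t, 0 < t -> (forall s, 0 <= s < t -> P s) -> P t) ->
  forall t, 0 <= t -> P t.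
Proof.
move=> P0 Pright Pleft T T0; apply: contrapT => nPT.
pose S : set R := [set t | 0 <= t /\ forall s, 0 <= s <= t -> P s].
have S0 : S 0 by split=> // s /andP[s0 s1]; have -> : s = 0 by apply/eqP; rewrite eq_le s0 s1.
have ubS : has_ubound S.
  exists T => t [t0 ht]; rewrite leNgt; apply/negP => lt.
  by apply: nPT; apply: ht; rewrite T0 ltW.
have supS : has_sup S by split => //; exists 0.
pose m := sup S.
have m0 : 0 <= m by exact: (ub_le_sup ubS S0).
have below s : 0 <= s < m -> P s.
  move=> /andP[s0 sm]; have ms : 0 < m - s by lra.
  have [t [t0 ht] tm] := sup_adherent ms supS.
  by apply: ht; rewrite s0 /=; rewrite -/m in tm; lra.
have Pm : P m.
  move: m0; rewrite le_eqVlt => /orP[/eqP <- //|m0]; exact: Pleft.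
have [e e0 he] := Pright m m0 Pm.
have : S (m + e).
  split=> [|s /andP[s0 s1]]; first lra.
  have [lt|ge] := ltP s m; first by apply: below; rewrite s0.
  by have -> : s = m + (s - m); [ring | apply: he; apply/andP; split; lra].
by move=> /(ub_le_sup ubS); rewrite -/m; lra.
Qed.

Lemma fracP (x y : R) : frac x = frac y <-> exists p : int, x = y + p%:~R.
Proof.
split=> [h|[p ->]]; last exact: fracDz.
exists (Num.floor x - Num.floor y); rewrite intrB.
by have := frac_floor x; have := frac_floor y; rewrite h; lra.
Qed.

End RealInduction.

Section Flip.
Variables (R : realType) (d : nat) (right top : {perm 'I_d}) (e1 e2 : bool).

(** Reflecting an axis exchanges opposite sides of the squares, and so replaces
    the gluing permutation by its inverse ([turn] below). *)
Definition flip (e : bool) (x : R) : R := if e then 1 - x else x.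
Definition turn (e : bool) (s : {perm 'I_d}) : {perm 'I_d} := if e then s^-1%g else s.

Local Notation rho := (turn e1 right).
Local Notation tau := (turn e2 top).

Lemma flipK e : involutive (flip e).
Proof. by case: e => x //=; ring. Qed.

Lemma flip01 e x : (0 <= flip e x <= 1) = (0 <= x <= 1).
Proof. by case: e => //=; apply/idP/idP => /andP[h1 h2]; apply/andP; split; lra. Qed.

Definition oriented_point (i : 'I_d) (x y z : R) : manifold R right top :=
  cube_point right top i (flip e1 x) (flip e2 y) z.

Local Notation cp := oriented_point.

Lemma circle_point_eq (z z' : R) : (circle_point z = circle_point z') <-> frac z = frac z'.
Proof.
rewrite fracP; split.
  by move=> /eqmodP; rewrite /= /equiv /= => /intrP[p h]; exists p; rewrite -h; ring.
by move=> [p ->]; apply/eqmodP; rewrite /= /equiv /= /congr_int addrAC subrr add0r intr_int.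
Qed.

Lemma oriented_glue_x (i : 'I_d) (y z : R) : 0 <= y <= 1 -> cp i 1 y z = cp (rho i) 0 y z.
Proof.
move=> hy; rewrite /cp /cube_point; congr (_, _).
have hy' : 0 <= flip e2 y <= 1 by rewrite flip01.
case: (e1) => /=; last by apply: surface_point_glue; exact: glue_right.
rewrite subrr subr0; apply: esym; apply: surface_point_glue.
by rewrite -{2}[i](permKV right); exact: glue_right.
Qed.

Lemma oriented_glue_y (i : 'I_d) (x z : R) : 0 <= x <= 1 -> cp i x 1 z = cp (tau i) x 0 z.
Proof.
move=> hx; rewrite /cp /cube_point; congr (_, _).
have hx' : 0 <= flip e1 x <= 1 by rewrite flip01.
case: (e2) => /=; last by apply: surface_point_glue; exact: glue_top.
rewrite subrr subr0; apply: esym; apply: surface_point_glue.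
by rewrite -{2}[i](permKV top); exact: glue_top.
Qed.

(** A normal form for the identifications away from the vertices: points of the
    far sides are moved to the near sides. All vertices are sent to [None],
    since several corners may be glued together there. *)
Definition canonical_form (p : 'I_d * (R * R)) : option ('I_d * (R * R)) :=
  let X := flip e1 p.2.1 in let Y := flip e2 p.2.2 in
  if ((X == 0) || (X == 1)) && ((Y == 0) || (Y == 1)) then None
  else if X == 1 then Some (rho p.1, (0, Y))
  else if Y == 1 then Some (tau p.1, (X, 0)) else Some (p.1, (X, Y)).

Lemma canonical_glue (a b : squares R d) : Defs.glue right top a b ->
  canonical_form (coords a) = canonical_form (coords b).
Proof.
have h0 : 0 <= (0 : R) <= 1 by rewrite lexx ler01.
have h1 : 0 <= (1 : R) <= 1 by rewrite lexx ler01.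
have n01 : (0 == 1 :> R) = false by rewrite eq_sym oner_eq0.
case=> i s hs; rewrite !coords_in_square // /canonical_form /=.
  set Y := flip e2 s; case: (boolP ((Y == 0) || (Y == 1))) => hY.
    by case: (e1); rewrite /= ?subrr ?subr0 ?eqxx ?orbT.
  rewrite !andbF; move: hY; rewrite negb_or => /andP[_ /negbTE ->].
  by case: (e1); rewrite /= ?subrr ?subr0 ?eqxx ?n01 ?permK.
set X := flip e1 s; case: (boolP ((X == 0) || (X == 1))) => hX.
  by case: (e2); rewrite /= ?subrr ?subr0 ?eqxx ?orbT.
rewrite /=; move: hX; rewrite negb_or => /andP[_ /negbTE ->].
by case: (e2); rewrite /= ?subrr ?subr0 ?eqxx ?n01 ?permK.
Qed.

Lemma oriented_inj (i i' : 'I_d) (x y z x' y' z' : R) :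
  0 <= x < 1 -> 0 <= y < 1 -> 0 <= x' < 1 -> 0 <= y' < 1 ->
  ~~ ((x' == 0) && (y' == 0)) -> cp i x y z = cp i' x' y' z' ->
  [/\ i = i', x = x', y = y' & frac z = frac z'].
Proof.
have c (u : R) : 0 <= u < 1 -> 0 <= u <= 1 by move=> /andP[-> /ltW ->].
have n1 (u : R) : 0 <= u < 1 -> (u == 1) = false by move=> /andP[_ h]; rewrite lt_eqF.
move=> hx hy hx' hy' nv E.
have Es : (cp i x y z).1 = (cp i' x' y' z').1 by rewrite E.
have /circle_point_eq Ez : (cp i x y z).2 = (cp i' x' y' z').2 by rewrite E.
have := surface_inv (Phi := fun a => canonical_form (coords a)) canonical_glue Es.
rewrite !coords_in_square ?flip01 ?c // /canonical_form /= !flipK !n1 // !orbF (negbTE nv).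
by case: ifP => // _ [-> -> ->].
Qed.

(** Gluing changes the first two coordinates by integers only. *)
Lemma oriented_mod (i i' : 'I_d) (x y z x' y' z' : R) :
  0 <= x <= 1 -> 0 <= y <= 1 -> 0 <= x' <= 1 -> 0 <= y' <= 1 ->
  cp i x y z = cp i' x' y' z' ->
  [/\ frac x = frac x', frac y = frac y' & frac z = frac z'].
Proof.
have h0 : 0 <= (0 : R) <= 1 by rewrite lexx ler01.
have h1 : 0 <= (1 : R) <= 1 by rewrite lexx ler01.
have f1 : frac (1 : R) = frac (0 : R) by apply/fracP; exists 1; rewrite add0r.
move=> hx hy hx' hy' E.
have Es : (cp i x y z).1 = (cp i' x' y' z').1 by rewrite E.
have /circle_point_eq Ez : (cp i x y z).2 = (cp i' x' y' z').2 by rewrite E.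
pose Phi (a : squares R d) := (frac (flip e1 (coords a).2.1), frac (flip e2 (coords a).2.2)).
have inv a b : Defs.glue right top a b -> Phi a = Phi b.
  case=> j s hs; rewrite /Phi !coords_in_square //=; congr (_, _).
    by case: (e1); rewrite /= ?subrr ?subr0.
  by case: (e2); rewrite /= ?subrr ?subr0.
have := surface_inv inv Es.
by rewrite /Phi !coords_in_square ?flip01 //= !flipK => -[-> ->].
Qed.

Lemma oriented_circle (i : 'I_d) (x y z z' : R) : frac z = frac z' -> cp i x y z = cp i x y z'.
Proof. by move=> /circle_point_eq h; rewrite /cp /cube_point h. Qed.

End Flip.

(** * Coding of a geodesic *)

Section Coding.
Variables (R : realType) (d : nat) (right top : {perm 'I_d}) (e1 e2 : bool).
Variables (w1 w2 u3 : R) (L : R -> manifold R right top).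
Hypothesis w10 : 0 < w1.
Hypothesis w20 : 0 < w2.
Local Notation rho := (turn e1 right).
Local Notation tau := (turn e2 top).
Local Notation cp := (oriented_point right top e1 e2).
Let al := w2 / w1.
Let be := u3 / w1.
Hypothesis indep : forall a b c : int,
  a%:~R + b%:~R * al + c%:~R * be = 0 -> [/\ a = 0, b = 0 & c = 0].

Hypothesis forward : forall t, 0 <= t -> exists2 e, 0 < e & exists i x y z,
  forall s, 0 <= s <= e -> [/\ 0 <= x + s * w1 <= 1, 0 <= y + s * w2 <= 1 &
    L (t + s) = cp i (x + s * w1) (y + s * w2) (z + s * u3)].
Hypothesis backward : forall t, 0 < t -> exists2 e, 0 < e <= t & exists i x y z,
  forall s, 0 <= s <= e -> [/\ 0 <= x - s * w1 <= 1, 0 <= y - s * w2 <= 1 &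
    L (t - s) = cp i (x - s * w1) (y - s * w2) (z - s * u3)].

Lemma fracD (a b c : R) : frac a = frac b -> frac (a + c) = frac (b + c).
Proof. by move=> /fracP[p ->]; apply/fracP; exists p; ring. Qed.

Definition lies_over (t x' y' z' : R) : Prop := exists i x y z,
  [/\ 0 <= x <= 1, 0 <= y <= 1, L t = cp i x y z &
      [/\ frac x = frac x', frac y = frac y' & frac z = frac z']].

Lemma lies_over_rep t x' y' z' i x y z : lies_over t x' y' z' ->
  0 <= x <= 1 -> 0 <= y <= 1 -> L t = cp i x y z ->
  [/\ frac x = frac x', frac y = frac y' & frac z = frac z'].
Proof.
move=> [j [x1 [y1 [z1 [hx1 hy1 E [<- <- <-]]]]]] hx hy E'.
exact: (oriented_mod hx hy hx1 hy1 (etrans (esym E') E)).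
Qed.

(** Within a cube the motion is linear, and passing to another cube changes the
    coordinates by integers; real induction propagates this to all times. *)
Lemma linear_mod : exists x0 y0 z0, forall t, 0 <= t ->
  lies_over t (x0 + t * w1) (y0 + t * w2) (z0 + t * u3).
Proof.
have [e e0 [i [x0 [y0 [z0 h]]]]] := forward (lexx 0).
exists x0, y0, z0; apply: real_induction.
- have [|hx hy E] := h 0; first by rewrite lexx ltW.
  by exists i, (x0 + 0 * w1), (y0 + 0 * w2), (z0 + 0 * u3); split => //; rewrite -E addr0.
- move=> t t0 ht; have [e' e'0 [j [x [y [z h']]]]] := forward t0.
  exists e' => // s hs; have [hx hy E] := h' s hs.
  have [|hx0 hy0 E0] := h' 0; first by rewrite lexx ltW.
  rewrite !mul0r !addr0 in hx0 hy0 E0.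
  have [fx fy fz] := lies_over_rep ht hx0 hy0 E0.
  exists j, (x + s * w1), (y + s * w2), (z + s * u3); split => //.
  by rewrite !mulrDl !addrA; split; apply: fracD.
- move=> t t0 ht; have [e' /andP[e'0 e't] [j [x [y [z h']]]]] := backward t0.
  have [|hx hy E] := h' e'; first by rewrite lexx ltW.
  have [|hx0 hy0 E0] := h' 0; first by rewrite lexx ltW.
  rewrite !mul0r !subr0 in hx0 hy0 E0.
  have te : 0 <= t - e' < t by apply/andP; split; lra.
  have [fx fy fz] := lies_over_rep (ht _ te) hx hy E.
  exists j, x, y, z; split => //.
  have back (a a' v : R) : frac (a - e' * v) = frac (a' + (t - e') * v) -> frac a = frac (a' + t * v).
    move=> /(fracD (e' * v)); rewrite subrK => ->; congr frac; ring.
  by split; apply: back.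
Qed.

(** Two passages at vertices would make the slope rational. *)
Lemma lattice_once x0 y0 : exists2 T, 0 <= T & forall t, T < t ->
  ~ (frac (x0 + t * w1) = 0 /\ frac (y0 + t * w2) = 0).
Proof.
have [[T [T0 [hx hy]]]|H] := pselect (exists T, 0 <= T /\
    (frac (x0 + T * w1) = 0 /\ frac (y0 + T * w2) = 0)); last first.
  by exists 0 => // t t0 h; apply: H; exists t; rewrite ltW.
exists T => // t Tt [hx' hy'].
pose p := Num.floor (x0 + t * w1) - Num.floor (x0 + T * w1).
pose q := Num.floor (y0 + t * w2) - Num.floor (y0 + T * w2).
have ep : (t - T) * w1 = p%:~R.
  rewrite intrB; have := frac_floor (x0 + t * w1); have := frac_floor (x0 + T * w1).
  by rewrite hx hx'; lra.
have eq : (t - T) * w2 = q%:~R.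
  rewrite intrB; have := frac_floor (y0 + t * w2); have := frac_floor (y0 + T * w2).
  by rewrite hy hy'; lra.
have [] := @indep q (- p) 0.
  rewrite mul0r addr0 intrN -ep -eq /al; field; exact: lt0r_neq0.
move=> _ /eqP; rewrite oppr_eq0 => /eqP p0 _.
have : 0 < (t - T) * w1 by rewrite mulr_gt0 // subr_gt0.
by rewrite ep p0 mulr0z ltxx.
Qed.

Section Tail.
Variables (t0 y0 z0 : R) (i0 : 'I_d).
Hypothesis t00 : 0 <= t0.
Hypothesis over : forall X, 0 <= X -> lies_over (t0 + X / w1) X (y0 + X * al) (z0 + X * be).
Hypothesis off_lattice : forall X, 0 <= X -> ~ (frac X = 0 /\ frac (y0 + X * al) = 0).
Hypothesis start : exists x y z, [/\ 0 <= x < 1, 0 <= y < 1 & L t0 = cp i0 x y z].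
Local Notation sq := (square_at rho tau al y0 i0).

Lemma al_gt0 : 0 < al. Proof. by rewrite divr_gt0. Qed.

Definition coded (X : R) : Prop :=
  L (t0 + X / w1) = cp (sq X) (frac X) (frac (y0 + X * al)) (z0 + X * be).

Lemma frac_itv (x : R) : 0 <= frac x < 1.
Proof. by rewrite frac_ge0 frac_lt1. Qed.

Lemma coded_rep X i x y z : 0 <= X -> coded X -> 0 <= x < 1 -> 0 <= y < 1 ->
  L (t0 + X / w1) = cp i x y z ->
  [/\ i = sq X, x = frac X, y = frac (y0 + X * al) & frac z = frac (z0 + X * be)].
Proof.
move=> X0 cX hx hy E; apply: (oriented_inj hx hy (frac_itv _) (frac_itv _) _ (etrans (esym E) cX)).
by apply/negP => /andP[/eqP h1 /eqP h2]; apply: (off_lattice X0).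
Qed.

Lemma coded0 : coded 0.
Proof.
have [x [y [z [hx hy E]]]] := start.
have c (u : R) : 0 <= u < 1 -> 0 <= u <= 1 by move=> /andP[-> /ltW ->].
rewrite /coded mul0r addr0.
have sq0 : sq 0 = i0 by rewrite /square_at truncn0 /= /height mul0r subrr perm1.
have E' : L (t0 + 0 / w1) = cp i0 x y z by rewrite mul0r addr0.
have [fx fy fz] := lies_over_rep (over (lexx 0)) (c _ hx) (c _ hy) E'.
rewrite sq0 E -fx -fy (frac_id hx) (frac_id hy).
exact: oriented_circle.
Qed.

Lemma square_at_const X X' : 0 <= X -> Num.truncn X = Num.truncn X' ->
  Num.floor (y0 + X * al) = Num.floor (y0 + X' * al) -> sq X = sq X'.
Proof. by move=> X0 h1 h2; rewrite /square_at h1 h2. Qed.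

Lemma coded_right X : 0 <= X -> coded X ->
  exists2 e, 0 < e & forall s, 0 <= s <= e -> coded (X + s).
Proof.
move=> X0 cX.
have t1 : 0 <= t0 + X / w1 by rewrite addr_ge0 // divr_ge0 // ltW.
have [e e0 [i [x [y [z h]]]]] := forward t1.
have al0 := al_gt0.
have [|/andP[x0 _] /andP[y0' _] E] := h 0; first by rewrite lexx ltW.
have [|/andP[_ x1] /andP[_ y1] _] := h e; first by rewrite lexx ltW.
have ew1 : 0 < e * w1 by rewrite mulr_gt0.
have ew2 : 0 < e * w2 by rewrite mulr_gt0.
rewrite !mul0r !addr0 in x0 y0' E.
have hx : 0 <= x < 1 by rewrite x0 /=; lra.
have hy : 0 <= y < 1 by rewrite y0' /=; lra.
have [ei ex ey ez] := coded_rep X0 cX hx hy E.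
pose e' := Num.min (e * w1) (Num.min ((1 - x) / 2) ((1 - y) / 2 / al)).
have /andP[hx0 hx1] := hx; have /andP[hy0 hy1] := hy.
have e'0 : 0 < e' by rewrite !lt_min ew1 !divr_gt0 // subr_gt0.
exists e' => // s /andP[s0]; rewrite !le_min => /and3P[s1 s2 s3].
have sw : 0 <= s / w1 <= e.
  by rewrite divr_ge0 ?(ltW w10) //= ler_pdivrMr.
have [_ _ Es] := h _ sw.
have s3' : s * al <= (1 - y) / 2 by rewrite -ler_pdivlMr.
have sal : 0 <= s * al by rewrite mulr_ge0 // ltW.
have xs01 : 0 <= x + s < 1 by apply/andP; split; lra.
have ys01 : 0 <= y + s * al < 1 by apply/andP; split; lra.
have EX : X + s = x + s + (Num.floor X)%:~R by rewrite ex {1}(frac_floor X) addrAC.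
have EY : y0 + (X + s) * al = y + s * al + (Num.floor (y0 + X * al))%:~R.
  by rewrite mulrDl addrA {1}(frac_floor (y0 + X * al)) -ey addrAC.
have fX := frac_unique EX xs01; have fY := frac_unique EY ys01.
have flX := floor_unique EX xs01; have flY := floor_unique EY ys01.
have sqs : sq (X + s) = i.
  rewrite ei; apply: square_at_const => //; first by lra.
  by rewrite !truncn_floor flX X0 (_ : 0 <= X + s); last by lra.
rewrite /coded sqs fX fY mulrDl addrA Es.
have -> : s / w1 * w1 = s by rewrite divfK // lt0r_neq0.
have -> : s / w1 * w2 = s * al by rewrite /al; ring.
apply: oriented_circle; rewrite mulrDl addrA.
have -> : s / w1 * u3 = s * be by rewrite /be; ring.
exact: fracD.
Qed.

(** A limit time is reached from the interior of the last segment: its square is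
    the coded one just before. If the limit point lies on the far vertical or
    horizontal side of that square, the gluing moves it to the next square, in
    the way [square_at] prescribes; it cannot lie on both sides because vertices
    are avoided. *)
Lemma coded_left X : 0 < X -> (forall X', 0 <= X' < X -> coded X') -> coded X.
Proof.
move=> X0 below; have al0 := al_gt0.
have t1 : 0 < t0 + X / w1 by rewrite ltr_wpDl // divr_gt0.
have [e /andP[e0 _] [i [x [y [z h]]]]] := backward t1.
have [|hx hy E] := h 0; first by rewrite lexx ltW.
rewrite !mul0r !subr0 in hx hy E.
have [fx fy fz] := lies_over_rep (over (ltW X0)) hx hy E.
have /andP[x0 x1] := hx; have /andP[y0' y1] := hy.
(* a nearby earlier time, in the interior of the last segment *)
pose s := Num.min (e * w1) X.
have s0 : 0 < s by rewrite lt_min mulr_gt0.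
have [se sX] : s <= e * w1 /\ s <= X by split; rewrite ge_min lexx ?orbT.
clearbody s.
have sal : 0 < s * al by rewrite mulr_gt0.
have sw : 0 <= s / w1 <= e by rewrite divr_ge0 ?(ltW w10) ?(ltW s0) //= ler_pdivrMr.
have [hxs hys Es] := h _ sw.
have e1' : s / w1 * w1 = s by rewrite divfK // lt0r_neq0.
have e2' : s / w1 * w2 = s * al by rewrite /al; ring.
rewrite e1' in hxs Es; rewrite e2' in hys Es.
have /andP[xs0 _] := hxs; have /andP[ys0 _] := hys.
have hX' : 0 <= X - s < X by apply/andP; split; lra.
have /andP[X'0 _] := hX'.
have hxs' : 0 <= x - s < 1 by rewrite xs0 /=; lra.
have hys' : 0 <= y - s * al < 1 by rewrite ys0 /=; lra.
have Es' : L (t0 + (X - s) / w1) = cp i (x - s) (y - s * al) (z - s / w1 * u3).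
  by rewrite -Es; congr L; ring.
have [ei ex ey _] := coded_rep X'0 (below _ hX') hxs' hys' Es'.
have Eal : y0 + (X - s) * al = y0 + X * al - s * al by ring.
have fl' := frac_floor (X - s); have flY' := frac_floor (y0 + (X - s) * al).
rewrite -ex in fl'; rewrite -ey Eal in flY'.
set p := Num.floor (X - s) in fl'; set q := Num.floor _ in flY'.
have Xp : X = x + p%:~R by lra.
have Yq : y0 + X * al = y + q%:~R by lra.
have p0 : 0 <= p by rewrite /p floor_ge0.
have [n pn] : exists n : nat, p = n%:Z by exists (absz p); rewrite gez0_abs.
have tX' : Num.truncn (X - s) = n by rewrite truncn_floor X'0 -/p pn.
have nX : n%:R = p%:~R :> R by rewrite pn.
have notcorner : ~ (x = 1 /\ y = 1).
  move=> [ex1 ey1]; apply: (off_lattice (ltW X0)).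
  rewrite -fx -fy ex1 ey1; have -> : frac (1 : R) = 0.
    by rewrite -[1]add0r (fracDz 0 1) frac_id // lexx ltr01.
  by [].
have Hn : Num.floor (height al y0 n) <= q.
  rewrite /q -Eal; apply: le_floor; rewrite /height lerD2l ler_pM2r //.
  by rewrite nX; lra.
have circ j x' y' : cp j x' y' z = cp j x' y' (z0 + X * be) by exact: oriented_circle.
have sqX' : i = (tau ^+ absz (q - Num.floor (height al y0 n)))%g (itinerary rho tau al y0 i0 n).
  by rewrite ei /square_at tX' /q Eal.
rewrite /coded E circ.
have [x1'|x1'] := eqVneq x 1.
  have yn1 : y < 1.
    by rewrite lt_neqAle y1 andbT; apply/negP => /eqP ey1; apply: notcorner.
  have hyy : 0 <= y < 1 by rewrite y0'.
  have XS : X = n.+1%:R by rewrite Xp x1' -nX -natr1 addrC.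
  have flY : Num.floor (y0 + X * al) = q := floor_unique Yq hyy.
  rewrite x1' oriented_glue_x //; congr (cp _ _ _ _).
  - rewrite /square_at XS natrK [in X in _ = X]/height subrr perm1 /= /wall_perm permM sqX'.
    congr (rho ((tau ^+ absz (_ - _))%g _)).
    by rewrite -flY XS /height -natr1; congr Num.floor; ring.
  - by rewrite XS -[n.+1%:R]add0r (fracDz 0 n.+1) frac_id // lexx ltr01.
  - by rewrite -fy frac_id.
have xn1 : x < 1 by rewrite lt_neqAle x1'.
have hxx : 0 <= x < 1 by rewrite x0.
have flX : Num.truncn X = n by rewrite truncn_floor ltW // (floor_unique Xp hxx) pn.
have [y1'|y1'] := eqVneq y 1.
  have flY : Num.floor (y0 + X * al) = q + 1.
    apply: (@floor_unique _ _ 0); last by rewrite lexx ltr01.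
    by rewrite Yq y1' intrD add0r addrC.
  rewrite y1' oriented_glue_y //; congr (cp _ _ _ _).
  - rewrite /square_at flX flY sqX' -permM -expgSr; congr ((tau ^+ _)%g _).
    by move: Hn; set k := Num.floor _; clear; lia.
  - by rewrite -fx frac_id.
  - by rewrite Yq y1' addrC -[1]/(1%:~R) -intrD -[_%:~R]add0r fracDz frac_id // lexx ltr01.
have yn1 : y < 1 by rewrite lt_neqAle y1'.
have hyy : 0 <= y < 1 by rewrite y0'.
have flY : Num.floor (y0 + X * al) = q := floor_unique Yq hyy.
congr (cp _ _ _ _).
- by rewrite /square_at flX flY.
- by rewrite -fx frac_id.
- by rewrite -fy frac_id.
Qed.

Lemma coded_all X : 0 <= X -> coded X.
Proof.
apply: real_induction; [exact: coded0 | exact: coded_right | exact: coded_left].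
Qed.

End Tail.

(** The trajectory is followed from a time [t0] at which the abscissa is an
    integer and after which no vertex is met. *)
Theorem coding : exists t0 y0 z0 i0, 0 <= t0 /\ forall X, 0 <= X ->
  L (t0 + X / w1) = cp (square_at rho tau al y0 i0 X) (frac X) (frac (y0 + X * al)) (z0 + X * be).
Proof.
have [x0 [y0 [z0 lin]]] := linear_mod.
have [T T0 off] := lattice_once x0 y0.
pose n := Num.floor (x0 + T * w1) + 1.
pose t0 := (n%:~R - x0) / w1.
have Tt : T < t0.
  rewrite /t0 ltr_pdivlMr // /n intrD.
  by have := floorD1_gt (x0 + T * w1); rewrite intrD; lra.
have t00 : 0 <= t0 by apply: le_trans (ltW Tt).
have t0w : t0 * w1 = n%:~R - x0 by rewrite /t0 divfK // lt0r_neq0.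
have Ex X : x0 + (t0 + X / w1) * w1 = X + n%:~R.
  by rewrite mulrDl t0w divfK ?lt0r_neq0 //; ring.
have Ey X : y0 + (t0 + X / w1) * w2 = y0 + t0 * w2 + X * al by rewrite /al; ring.
have Ez X : z0 + (t0 + X / w1) * u3 = z0 + t0 * u3 + X * be by rewrite /be; ring.
have later X : 0 <= X -> T < t0 + X / w1.
  by move=> X0; apply: lt_le_trans Tt _; rewrite lerDl divr_ge0 // ltW.
have [e e0 [i [x [y [z h]]]]] := forward t00.
exists t0, (y0 + t0 * w2), (z0 + t0 * u3), i; split => // X.
apply: coded_all => //.
- move=> {}X X0; have t1 : 0 <= t0 + X / w1 by apply: le_trans (ltW (later X X0)).
  have [j [a [b [c [ha hb hc [f1 f2 f3]]]]]] := lin _ t1.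
  exists j, a, b, c; split => //; split; last 2 first.
  + by rewrite f2 Ey.
  + by rewrite f3 Ez.
  by rewrite f1 Ex fracDz.
- move=> {}X X0 [h1 h2]; apply: (off _ (later X X0)).
  by rewrite Ex Ey fracDz.
exists x, y, z.
have [|/andP[x0' _] /andP[y0' _] E] := h 0; first by rewrite lexx ltW.
have [|/andP[_ x1] /andP[_ y1] _] := h e; first by rewrite lexx ltW.
have ew1 : 0 < e * w1 by rewrite mulr_gt0.
have ew2 : 0 < e * w2 by rewrite mulr_gt0.
rewrite !mul0r !addr0 in x0' y0' E.
by rewrite x0' y0' E /=; split=> //; lra.
Qed.

End Coding.

(** * Continuous functions in cube coordinates *)

Section Clamp.
Variable R : realType.

(** Composing with this retraction onto the unit interval extends a function on
    a square to a continuous function on the plane. *)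
Definition clamp (x : R) : R := Num.max 0 (Num.min x 1).

Lemma clamp_id x : 0 <= x <= 1 -> clamp x = x.
Proof. by move=> /andP[h0 h1]; rewrite /clamp (min_idPl h1) (max_idPr h0). Qed.

Lemma clamp01 x : 0 <= clamp x <= 1.
Proof. by rewrite /clamp le_max lexx /= ge_max ler01 /= ge_min lexx orbT. Qed.

Lemma clamp_lip x y : `|clamp x - clamp y| <= `|x - y|.
Proof.
wlog xy : x y / x <= y.
  move=> W; have [|/ltW] := leP x y; first exact: W.
  by move=> yx; rewrite distrC [leRHS]distrC; exact: W.
rewrite distrC [leRHS]distrC [leRHS]ger0_norm ?subr_ge0 // ler_norml /clamp.
have [x1|x1] := leP x 1; have [y1|y1] := leP y 1.
- by have [x0|x0] := leP 0 x; have [y0|y0] := leP 0 y; apply/andP; split; lra.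
- by have [x0|x0] := leP 0 x; rewrite (max_idPr (ler01 : 0 <= (1 : R))); apply/andP; split; lra.
- by exfalso; lra.
- by rewrite (max_idPr (ler01 : 0 <= (1 : R))); apply/andP; split; lra.
Qed.

Lemma clamp_continuous : continuous clamp.
Proof.
move=> x; apply/cvgrPdist_lt => e e0.
have /cvgrPdist_lt/(_ e e0) : y @[y --> x] --> x by exact: cvg_id.
by apply: filterS => y; apply: le_lt_trans; exact: clamp_lip.
Qed.

End Clamp.

Lemma continuous_pair (T U V : topologicalType) (f : T -> U) (g : T -> V) :
  continuous f -> continuous g -> continuous (fun w => (f w, g w)).
Proof. by move=> cf cg w; exact: (cvg_pair (cf w) (cg w)). Qed.

Lemma continuous_compose (T U V : topologicalType) (f : T -> U) (g : U -> V) :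
  continuous f -> continuous g -> continuous (fun w => g (f w)).
Proof. by move=> cf cg w; exact: (continuous_comp (cf w) (cg (f w))). Qed.

Lemma continuous_fst (T U : topologicalType) : continuous (fst : T * U -> T).
Proof. by move=> w; exact: cvg_fst. Qed.

Lemma continuous_snd (T U : topologicalType) : continuous (snd : T * U -> U).
Proof. by move=> w; exact: cvg_snd. Qed.

Section CubeFunction.
Variables (R : realType) (d : nat) (right top : {perm 'I_d}).
Variable f : manifold R right top -> R.
Hypothesis cf : continuous f.

Definition cube_function (i : 'I_d) (w : R * R * R) : R :=
  f (cube_point right top i (clamp w.1.1) (clamp w.1.2) w.2).

Lemma in_square_continuous (i : 'I_d) :
  continuous (fun w : R * R => in_square i (clamp w.1) (clamp w.2)).
Proof.
have h : continuous (fun w : R * R => insubd (origin R) (clamp w.1, clamp w.2) : set_type (@unit_square R)).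
  apply: continuous_comp_initial.
  have -> : set_val \o (fun w : R * R => insubd (origin R) (clamp w.1, clamp w.2) : set_type (@unit_square R))
     = (fun w : R * R => (clamp w.1, clamp w.2)).
    apply/funext => w /=; rewrite set_valE /=; rewrite val_insubd ifT //.
    by apply/mem_set; split; rewrite /= in_itv /= clamp01.
  apply: continuous_pair.
    exact: (continuous_compose (@continuous_fst _ _) (@clamp_continuous R)).
  exact: (continuous_compose (@continuous_snd _ _) (@clamp_continuous R)).
exact: (continuous_compose h (@existT_continuous _ _ i)).
Qed.

(** Both the inclusion of a square in the disjoint union and the quotient maps
    are continuous. *)
Lemma cube_function_continuous i : continuous (cube_function i).
Proof.
have h1 : continuous (fun w : R * R => surface_point right top i (clamp w.1) (clamp w.2)).
  have hpi : continuous (fun a : squares R d =>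
      \pi_(quotient_topology {eq_quot (@glued_equiv R d right top)}) a : surface R right top).
    exact: pi_continuous.
  exact: (continuous_compose (@in_square_continuous i) hpi).
have h2 : continuous (@circle_point R) by exact: pi_continuous.
apply: (continuous_compose _ cf); apply: continuous_pair.
  exact: (continuous_compose (@continuous_fst _ _) h1).
exact: (continuous_compose (@continuous_snd _ _) h2).
Qed.

Lemma cube_function_periodic i x y z (p : int) :
  cube_function i (x, y, z + p%:~R) = cube_function i (x, y, z).
Proof.
rewrite /cube_function /cube_point /=; congr (f (_, _)).
by apply/eqmodP; rewrite /= /equiv /= /congr_int addrAC subrr add0r intr_int.
Qed.

Lemma cube_function_clamp i x y z :
  cube_function i (x, y, z) = cube_function i (clamp x, clamp y, frac z).
Proof.
rewrite {1}[z](frac_floor z) cube_function_periodic.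
by rewrite /cube_function /= !(clamp_id (clamp01 _)).
Qed.

Let cube : set (R * R * R) := (`[0, 1] `*` `[0, 1]) `*` `[0, 1].

Lemma cube_compact : compact cube.
Proof. by apply: compact_setX; [apply: compact_setX|]; exact: segment_compact. Qed.

Lemma cube_function_bounded : exists B, forall i w, `|cube_function i w| <= B.
Proof.
have /choice[B hB] : forall i : 'I_d, exists B, forall w, `|cube_function i w| <= B.
  move=> i; have : compact (cube_function i @` cube).
    apply: continuous_compact; last exact: cube_compact.
    by apply: continuous_subspaceT; exact: cube_function_continuous.
  move=> /compact_bounded [B0 [_ hB]]; exists (B0 + 1) => -[[x y] z].
  apply: (hB (B0 + 1)); first by rewrite ltrDl.
  exists (clamp x, clamp y, frac z); last by rewrite [RHS]cube_function_clamp.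
  by split; [split|]; rewrite /= in_itv /= ?clamp01 // frac_ge0 ltW // frac_lt1.
exists (\sum_i `|B i|) => i w; apply: le_trans (hB i w) _; apply: le_trans (ler_norm _) _.
by rewrite (bigD1 i) //= lerDl sumr_ge0.
Qed.

(** Uniform continuity is obtained by compactness of the unit cube, then for
    every third coordinate by periodicity. *)
Lemma cube_function_unif (eps : R) : 0 < eps -> exists2 delta, 0 < delta &
  forall i x y z x' y' z', 0 <= x <= 1 -> 0 <= y <= 1 ->
    `|x - x'| < delta -> `|y - y'| < delta -> `|z - z'| < delta ->
    `|cube_function i (x, y, z) - cube_function i (x', y', z')| <= eps.
Proof.
move=> eps0; have e2 : 0 < eps / 2 by rewrite divr_gt0.
have near0 : \forall delta \near (0 : R)^'+, cube `<=` [set w | forall i w', ball w delta w' ->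
    `|cube_function i w - cube_function i w'| <= eps].
  apply: ((iffLR (compact_near_coveringP _) cube_compact) R (0^'+)
    (fun delta w => forall i w', ball w delta w' -> `|cube_function i w - cube_function i w'| <= eps)).
  move=> w0 _.
  have : \forall w \near w0, forall i, `|cube_function i w0 - cube_function i w| < eps / 2.
    apply: (@filter_forall _ _ (fun i w => `|cube_function i w0 - cube_function i w| < eps / 2) _ (@nbhs_filter _ w0)) => i.
    by have /cvgrPdist_lt/(_ _ e2) := @cube_function_continuous i w0.
  move=> /nbhs_ballP[r /= r0 hr]; have r2 : 0 < r / 2 by rewrite divr_gt0.
  exists (ball w0 (r / 2), [set delta | delta < r / 2]) => /=.
    by split; [exact: nbhsx_ballx | exact: nbhs_right_lt].
  move=> [w delta] /= [hw hd] i w' hw'.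
  have h1 : `|cube_function i w0 - cube_function i w| < eps / 2.
    by apply: hr; apply: le_ball hw; lra.
  have h2 : `|cube_function i w0 - cube_function i w'| < eps / 2.
    by apply: hr; have -> : r = r / 2 + r / 2; [field | apply: (ball_triangle hw); apply: le_ball hw'; lra].
  rewrite -[X in `|X|](subrKA (cube_function i w0)).
  by apply: le_trans (ler_normD _ _) _; rewrite distrC; lra.
have [delta [delta0 H]] : exists delta, 0 < delta /\ cube `<=` [set w | forall i w', ball w delta w' ->
    `|cube_function i w - cube_function i w'| <= eps].
  have := filter_ex (filterI near0 (nbhs_right_gt (0 : R))).
  by move=> [delta [h1 h2]]; exists delta.
exists delta => // i x y z x' y' z' hx hy h1 h2 h3.
have {1}-> : z = frac z + (Num.floor z)%:~R := frac_floor z.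
rewrite cube_function_periodic.
have -> : cube_function i (x', y', z') = cube_function i (x', y', z' - (Num.floor z)%:~R).
  by rewrite -mulrNz cube_function_periodic.
apply: H.
  by split; [split|]; rewrite /= in_itv /= ?hx ?hy // frac_ge0 ltW // frac_lt1.
split; first by split.
rewrite /ball /= /frac; have -> // : z - (Num.floor z)%:~R - (z' - (Num.floor z)%:~R) = z - z' by ring.
Qed.

End CubeFunction.

(** * Riemann sums over the unit cube *)

Section RiemannSums.
Variable R : realType.
Local Notation lambda := (@lebesgue_measure R).
Local Notation mu := ((lambda \x lambda) \x lambda)%E.

Lemma product_box (A B C : set R) : measurable A -> measurable B -> measurable C ->
  (mu ((A `*` B) `*` C) = lambda A * lambda B * lambda C)%E.
Proof.
move=> mA mB mC; transitivity ((lambda \x lambda) (A `*` B) * lambda C)%E.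
  by apply: product_measure1E => //; exact: measurableX.
by congr (_ * _)%E; exact: product_measure1E.
Qed.

(** The last cell is closed on the right, so that the cells partition the closed
    unit interval. *)
Definition cell (Q : nat) (a : nat) : interval R :=
  Interval (BLeft (a%:R / Q%:R)) (BSide (a.+1 != Q) (a.+1%:R / Q%:R)).

Lemma cell_bounds Q a x : x \in cell Q a -> a%:R / Q%:R <= x <= a.+1%:R / Q%:R.
Proof.
by rewrite /cell itv_boundlr => /andP[]; case: eqP => _; rewrite !bnd_simp => -> // /ltW.
Qed.

Lemma cell_ex Q x : (0 < Q)%N -> 0 <= x <= 1 -> exists a : 'I_Q, x \in cell Q a.
Proof.
move=> Q0 /andP[x0]; rewrite le_eqVlt => /orP[/eqP ->|x1].
  case: Q Q0 => // Q _; exists ord_max; rewrite /cell /= eqxx itv_boundlr /= !bnd_simp.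
  by rewrite divff ?lexx ?andbT ?gt_eqF // ler_pdivrMr // mul1r ler_nat.
have QR : 0 < Q%:R :> R by rewrite ltr0n.
have xQ : 0 <= x * Q%:R by rewrite mulr_ge0 // ltW.
have /andP[h1 h2] := truncn_itv xQ.
have aQ : (Num.truncn (x * Q%:R) < Q)%N.
  by rewrite -(ltr_nat R); apply: le_lt_trans h1 _; rewrite gtr_pMl.
exists (Ordinal aQ); rewrite /cell itv_boundlr /= bnd_simp ler_pdivrMr // h1 /=.
by case: eqP => _; rewrite !bnd_simp; rewrite ?ler_pdivlMr ?ltr_pdivlMr // ltW.
Qed.

Lemma cell_inj Q (a b : 'I_Q) x : x \in cell Q a -> x \in cell Q b -> a = b.
Proof.
have lt (a' b' : 'I_Q) : x \in cell Q a' -> x \in cell Q b' -> ~~ (a' < b')%N.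
  move=> ha /cell_bounds/andP[hb _]; apply/negP => ab.
  have ne : a'.+1 != Q by rewrite neq_ltn (leq_ltn_trans ab).
  have QR : 0 < Q%:R :> R by rewrite ltr0n; apply: leq_ltn_trans (ltn_ord b').
  move: ha; rewrite /cell ne itv_boundlr => /andP[_]; rewrite bnd_simp => h.
  have := le_lt_trans hb h; rewrite ltNge ler_pM2r ?invr_gt0 // ler_nat.
  by rewrite ab.
move=> ha hb; apply: ord_inj; apply/eqP; rewrite eqn_leq [X in X && _]leqNgt [X in _ && X]leqNgt.
by rewrite (lt _ _ hb ha) (lt _ _ ha hb).
Qed.

Lemma cell_measure Q a : (0 < Q)%N -> lambda [set` cell Q a] = (Q%:R^-1)%:E.
Proof.
move=> Q0; rewrite lebesgue_measure_itv /= lte_fin ltr_pM2r ?invr_gt0 ?ltr0n // ltr_nat leqnn.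
by rewrite EFinN -EFinB -mulrBl -natr1 addrAC subrr add0r mul1r.
Qed.

Definition cell3 Q (t : 'I_Q * 'I_Q * 'I_Q) : set (R * R * R) :=
  ([set` cell Q t.1.1] `*` [set` cell Q t.1.2]) `*` [set` cell Q t.2].

Definition step Q (c : 'I_Q * 'I_Q * 'I_Q -> R) (w : R * R * R) : R :=
  \sum_t c t * \1_(cell3 t) w.

Lemma cell3_ex Q w : (0 < Q)%N -> unit_cube w -> exists t : 'I_Q * 'I_Q * 'I_Q, cell3 t w.
Proof.
move=> Q0 [[/= hx hy] hz]; rewrite !in_itv /= in hx hy hz.
have [a ha] := cell_ex Q0 hx; have [b hb] := cell_ex Q0 hy; have [c hc] := cell_ex Q0 hz.
by exists (a, b, c).
Qed.

Lemma step_cell Q c (t : 'I_Q * 'I_Q * 'I_Q) w : cell3 t w -> step c w = c t.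
Proof.
move=> ht; rewrite /step (bigD1 t) //= indicE mem_set // mulr1 big1 ?addr0 // => s st.
rewrite indicE; have [|_] := boolP (w \in cell3 s); last by rewrite mulr0.
rewrite inE => hs; case/eqP: st.
case: t ht => -[a b] e ht; case: s hs => -[a' b'] e' hs.
have [[/= ha hb] he] := ht; have [[/= ha' hb'] he'] := hs.
by rewrite (cell_inj ha ha') (cell_inj hb hb') (cell_inj he he').
Qed.

Lemma cell3_measurable Q (t : 'I_Q * 'I_Q * 'I_Q) : measurable (cell3 t).
Proof. by apply: measurableX; [apply: measurableX|]; exact: measurable_itv. Qed.

Lemma cell3_measure Q (t : 'I_Q * 'I_Q * 'I_Q) : (0 < Q)%N ->
  mu (cell3 t) = ((Q * Q * Q)%:R^-1)%:E.
Proof.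
move=> Q0; rewrite product_box //; try exact: measurable_itv.
by rewrite !cell_measure // -!EFinM !natrM !invfM.
Qed.

Lemma step_measurable Q (c : 'I_Q * 'I_Q * 'I_Q -> R) D : measurable_fun D (step c).
Proof.
apply: measurable_sum => t; apply: measurable_funM => //.
by apply: measurable_indic; exact: cell3_measurable.
Qed.

Lemma cube_measurable : measurable (@unit_cube R).
Proof. by apply: measurableX; [apply: measurableX|]; exact: measurable_itv. Qed.

Lemma cube_measure : mu (@unit_cube R) = 1%:E.
Proof.
rewrite product_box; try exact: measurable_itv.
rewrite !lebesgue_measure_itv /= lte_fin ltr01.
by rewrite EFinN -EFinB subr0 !mule1.
Qed.

Lemma cube_finite : (mu (@unit_cube R) < +oo)%E.
Proof. by rewrite cube_measure ltry. Qed.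

Lemma cell3_sub Q (t : 'I_Q * 'I_Q * 'I_Q) : cell3 t `<=` @unit_cube R.
Proof.
have one (a : 'I_Q) x : x \in cell Q a -> 0 <= x <= 1.
  move=> /cell_bounds /andP[h1 h2].
  have QR : 0 < Q%:R :> R by rewrite ltr0n; apply: leq_ltn_trans (ltn_ord a).
  apply/andP; split; first by apply: le_trans h1; rewrite divr_ge0.
  by apply: le_trans h2 _; rewrite ler_pdivrMr // mul1r ler_nat.
by move=> w [[/= /one h1 /one h2] /one h3]; split; [split|]; rewrite /= in_itv.
Qed.

Lemma bounded_integrable (G : R * R * R -> R) B : measurable_fun (@unit_cube R) G ->
  (forall w, `|G w| <= B) -> mu.-integrable (@unit_cube R) (EFin \o G).
Proof.
move=> mG hB; apply: measurable_bounded_integrable => //.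
- exact: cube_measurable.
- exact: cube_finite.
by exists B; split; [exact: num_real | move=> x /ltW xB w _; apply: le_trans (hB w) xB].
Qed.

Lemma step_integral Q (c : 'I_Q * 'I_Q * 'I_Q -> R) : (0 < Q)%N ->
  (\int[mu]_(w in @unit_cube R) (step c w)%:E = ((\sum_t c t) / (Q * Q * Q)%:R)%:E)%E.
Proof.
move=> Q0; under eq_integral do rewrite /step -sumEFin.
have mI t : measurable_fun (@unit_cube R) (\1_(cell3 t) : R * R * R -> R).
  by apply: measurable_indic; exact: cell3_measurable.
have le1 t (w : R * R * R) : `|\1_(cell3 t) w| <= 1 :> R.
  by rewrite indicE; case: (_ \in _); rewrite ?normr1 ?normr0.
rewrite integral_sum; first last.
- move=> t; apply: (@bounded_integrable _ `|c t|); first exact: measurable_funM.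
  by move=> w; rewrite normrM ler_piMr.
- exact: cube_measurable.
rewrite mulr_suml -sumEFin; apply: eq_bigr => t _.
under eq_integral do rewrite EFinM.
rewrite integralZl; first last.
- exact: (@bounded_integrable _ 1).
- exact: cube_measurable.
rewrite integral_indic; [|exact: cube_measurable|exact: cell3_measurable].
rewrite setIidl; last exact: cell3_sub.
by rewrite EFinM; congr (_ * _)%E; exact: cell3_measure.
Qed.

(** The values [c t] are arbitrary, which leaves the choice of the sample point
    in each cell free. *)
Lemma riemann_cube Q (c : 'I_Q * 'I_Q * 'I_Q -> R) (G : R * R * R -> R) B eps :
  (0 < Q)%N -> measurable_fun (@unit_cube R) G -> (forall w, `|G w| <= B) ->
  (forall t w, cell3 t w -> `|G w - c t| <= eps) ->
  `|\int[mu]_(w in @unit_cube R) G w - (\sum_t c t) / (Q * Q * Q)%:R| <= eps.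
Proof.
move=> Q0 mG hB heps; have cm := cube_measurable.
have iG := bounded_integrable mG hB.
have near w : unit_cube w -> `|G w - step c w| <= eps.
  by move=> /(cell3_ex Q0)[t ht]; rewrite (step_cell _ ht); exact: heps.
have bS w : `|step c w| <= \sum_t `|c t|.
  apply: le_trans (ler_norm_sum _ _ _) _; apply: ler_sum => t _.
  by rewrite normrM ler_piMr // indicE; case: (_ \in _); rewrite ?normr1 ?normr0.
have iS : mu.-integrable (@unit_cube R) (EFin \o step c).
  by apply: (bounded_integrable _ bS); exact: step_measurable.
have <- : \int[mu]_(w in @unit_cube R) step c w = (\sum_t c t) / (Q * Q * Q)%:R.
  by rewrite /Rintegral step_integral.
have mD : measurable_fun (@unit_cube R) (fun w => G w - step c w).
  by apply: measurable_funB => //; exact: step_measurable.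
have bD w : `|G w - step c w| <= B + \sum_t `|c t|.
  by apply: le_trans (ler_normB _ _) _; apply: lerD.
have -> : eps = \int[mu]_(w in @unit_cube R) eps.
  by rewrite Rintegral_cst // [X in fine X]cube_measure mulr1.
rewrite -RintegralB //; apply: le_trans (le_normr_Rintegral _ _) _ => //.
  exact: (bounded_integrable mD bD).
apply: le_Rintegral; [exact: cm| | |exact: near].
  apply: (@bounded_integrable _ (B + \sum_t `|c t|)); first exact: measurableT_comp.
  by move=> w; rewrite normr_id.
by apply: (@bounded_integrable _ `|eps|).
Qed.

(** A uniformly continuous function is a pointwise limit of step functions. This
    avoids comparing the product sigma-algebra with the open sets of the
    product. *)
Lemma uniform_measurable (G : R * R * R -> R) :
  (forall eps, 0 < eps -> exists2 delta, 0 < delta &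
    forall x y z x' y' z', 0 <= x <= 1 -> 0 <= y <= 1 ->
    `|x - x'| < delta -> `|y - y'| < delta -> `|z - z'| < delta ->
    `|G (x, y, z) - G (x', y', z')| <= eps) ->
  measurable_fun (@unit_cube R) G.
Proof.
move=> unif.
pose c n (t : 'I_n.+1 * 'I_n.+1 * 'I_n.+1) : R :=
  G (t.1.1%:R / n.+1%:R, t.1.2%:R / n.+1%:R, t.2%:R / n.+1%:R).
apply: (@measurable_fun_cvg _ _ _ _ (fun n => step (@c n))).
  by move=> n; exact: step_measurable.
move=> [[x y] z] hw; apply/cvgrPdist_le => eps eps0.
have [delta delta0 hd] := unif eps eps0.
near=> n; have [t ht] := cell3_ex (ltn0Sn n) hw.
rewrite (step_cell _ ht) /c; move: hw => [[/= hx hy] hz]; rewrite !in_itv /= in hx hy hz.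
have small u (a : 'I_n.+1) : u \in cell n.+1 a -> `|u - a%:R / n.+1%:R| < delta.
  move=> /cell_bounds/andP[h1 h2].
  have : n.+1%:R^-1 < delta by near: n; exact: near_infty_natSinv_lt (PosNum delta0).
  rewrite -[a.+1%:R]natr1 mulrDl mul1r in h2 => hn; by rewrite ger0_norm ?subr_ge0 //; apply: le_lt_trans hn; rewrite lerBlDl.
by move: ht => [[/= h1 h2] h3]; apply: hd => //; exact: small.
Unshelve. all: end_near. Qed.

End RiemannSums.

(** * Primitives along a geodesic *)

Section Primitive.
Variables (R : realType) (phi : R -> R).
Hypothesis phi_cont : forall t, 0 < t -> {for t, continuous phi}.
Hypothesis phi_right : phi @ (0 : R)^'+ --> phi 0.

Definition primitive (T : R) : R := \int[lebesgue_measure]_(t in `[0, T]) phi t.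

Lemma phi_within b : 0 < b -> {within `[0, b], continuous phi}.
Proof.
move=> b0; apply/continuous_within_itvP => //; split => //.
  by move=> t; rewrite in_itv /= => /andP[t0 _]; exact: phi_cont.
by have /left_right_continuousP[] := phi_cont b0.
Qed.

Lemma phi_integrable b : 0 < b -> lebesgue_measure.-integrable `[0, b] (EFin \o phi).
Proof.
move=> b0; apply: continuous_compact_integrable; first exact: segment_compact.
exact: phi_within.
Qed.

(** The fundamental theorem of calculus together with the mean value theorem. *)
Lemma primitive_mean_value a b : 0 <= a -> a < b ->
  exists2 xi, a < xi < b & primitive b - primitive a = phi xi * (b - a).
Proof.
move=> a0 ab; have b0 : 0 < b by apply: le_lt_trans ab.
have [xi xiab E] : exists2 c, c \in `]a, b[%R & primitive b - primitive a = phi c * (b - a).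
  apply: MVT => //.
    move=> x; rewrite in_itv /= => /andP[ax xb]; have x0 : 0 < x by apply: le_lt_trans ax.
    have [] := continuous_FTC1_closed xb (phi_integrable b0) x0 (phi_cont x0).
    by move=> dx <-; rewrite derive1E; apply: DeriveDef.
  apply: (@continuous_subspaceW _ _ _ `[0, b]).
    by apply: subset_itvr; rewrite bnd_simp.
  exact: (parameterized_integral_continuous (ltW b0) (phi_integrable b0)).
by exists xi => //; move: xiab; rewrite in_itv.
Qed.

Lemma primitive_lipschitz B a b : (forall t, 0 <= t -> `|phi t| <= B) -> 0 <= a -> a <= b ->
  `|primitive b - primitive a| <= B * (b - a).
Proof.
move=> hB a0; rewrite le_eqVlt => /orP[/eqP ->|ab]; first by rewrite !subrr normr0 mulr0.
have [xi /andP[axi _] ->] := primitive_mean_value a0 ab.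
have ba : 0 <= b - a by rewrite subr_ge0 ltW.
by rewrite normrM (ger0_norm ba) ler_wpM2r // hB // (le_trans a0) // ltW.
Qed.

(** Between consecutive integer multiples of [w^-1] after [t0] the primitive
    changes by a bounded amount, and so does the initial part up to [t0]; both
    disappear after division by [T]. *)
Lemma average_limit (B t0 w M : R) : (forall t, 0 <= t -> `|phi t| <= B) -> 0 <= t0 -> 0 < w ->
  (forall eps, 0 < eps -> \forall N \near \oo,
     `|w * (primitive (t0 + N%:R / w) - primitive t0) / N%:R - M| <= eps) ->
  (T^-1 * primitive T) @[T --> +oo] --> M.
Proof.
move=> hB t00 w0 hM; apply/cvgrPdist_le => eps eps0.
have e3 : 0 < eps / (2 * w) by rewrite divr_gt0 // mulr_gt0.
have B0 : 0 <= B by apply: le_trans (hB 0 (lexx 0)).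
pose e1 := eps / 2; have e10 : 0 < e1 by rewrite divr_gt0.
have [N0 _ hN0] := hM e1 e10.
pose K := `|primitive t0| + `|M| * t0 + (B + `|M|) / w.
have K0 : 0 <= K by rewrite !addr_ge0 ?mulr_ge0 ?addr_ge0 ?invr_ge0 // ltW.
near=> T.
have hT1 : t0 + (N0.+1%:R) / w <= T by near: T; exact: nbhs_pinfty_ge (num_real _).
have hT2 : K / e1 <= T by near: T; exact: nbhs_pinfty_ge (num_real _).
have hT3 : 0 < T by near: T; exact: nbhs_pinfty_gt (num_real _).
pose X := (T - t0) * w; pose N := Num.truncn X.
have X0 : N0.+1%:R <= X by rewrite /X -ler_pdivrMr // lerBrDl.
have X00 : 0 <= X by apply: le_trans X0.
have /andP[NX XN] := truncn_itv X00.
have NN0 : (N0 < N)%N by rewrite -(ltr_nat R) -(ltrD2r 1) natr1; apply: le_lt_trans X0 _; rewrite natr1.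
have NR : 0 < N%:R :> R by rewrite ltr0n; apply: leq_ltn_trans NN0.
have := hN0 N (ltnW NN0); rewrite -/N in NX XN *.
set P := primitive (t0 + N%:R / w) => h1.
have h2 : `|w * (P - primitive t0) - M * N%:R| <= e1 * N%:R.
  have -> : w * (P - primitive t0) - M * N%:R = (w * (P - primitive t0) / N%:R - M) * N%:R.
    by rewrite mulrBl divfK // gt_eqF.
  by rewrite normrM (gtr0_norm NR) ler_pM2r.
have TX : T = t0 + X / w by rewrite /X mulfK ?gt_eqF // subrKC.
have NX' : N%:R / w <= X / w by rewrite ler_pM2r // invr_gt0.
have XN' : X / w - N%:R / w <= w^-1.
  by rewrite -mulrBl -[leRHS]mul1r ler_pM2r ?invr_gt0 // lerBlDl natr1 ltW.
have h3 : `|primitive T - P| <= B / w.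
  apply: le_trans (primitive_lipschitz hB _ _) _.
  - by rewrite addr_ge0 // divr_ge0 // ltW.
  - by rewrite TX lerD2l.
  by rewrite ler_wpM2l // TX; lra.
have wi : 0 < w^-1 by rewrite invr_gt0.
have h4 : `|(P - primitive t0) - M * (N%:R / w)| <= e1 * (N%:R / w).
  have -> : (P - primitive t0) - M * (N%:R / w) = (w * (P - primitive t0) - M * N%:R) / w.
    by rewrite mulrBl [w * _]mulrC mulfK ?gt_eqF // mulrA.
  by rewrite normrM [`|w^-1|]gtr0_norm // mulrA ler_pM2r.
have main : `|primitive T - M * T| <= K + e1 * T.
  have -> : primitive T - M * T = (primitive T - P) + ((P - primitive t0) - M * (N%:R / w))
     + (primitive t0 - M * t0) - M * (X / w - N%:R / w) by rewrite {2}TX; ring.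
  apply: le_trans (ler_normB _ _) _.
  have g1 : `|M * (X / w - N%:R / w)| <= `|M| / w.
    by rewrite normrM ler_wpM2l // ger0_norm // subr_ge0.
  have g2 : `|primitive t0 - M * t0| <= `|primitive t0| + `|M| * t0.
    by apply: le_trans (ler_normB _ _) _; rewrite normrM (ger0_norm t00).
  have g3 : e1 * (N%:R / w) <= e1 * T.
    by rewrite ler_pM2l // TX; apply: le_trans NX' _; rewrite lerDr.
  have g4 := ler_normD ((primitive T - P) + ((P - primitive t0) - M * (N%:R / w))) (primitive t0 - M * t0).
  have g5 := ler_normD (primitive T - P) ((P - primitive t0) - M * (N%:R / w)).
  have g6 : K = `|primitive t0| + `|M| * t0 + B / w + `|M| / w by rewrite /K; ring.
  by rewrite g6; lra.
rewrite distrC; have -> : T^-1 * primitive T - M = (primitive T - M * T) / T.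
  by rewrite mulrBl mulfK ?gt_eqF // mulrC.
rewrite normrM normfV (gtr0_norm hT3) ler_pdivrMr //; apply: le_trans main _.
move: hT2; rewrite ler_pdivrMr // => hT2.
have -> : eps = e1 + e1 by rewrite /e1; field.
by rewrite mulrDl lerD2r mulrC.
Unshelve. all: by end_near. Qed.

End Primitive.

Section GeodesicContinuity.
Variables (R : realType) (d : nat) (right top : {perm 'I_d}).
Variable f : manifold R right top -> R.
Hypothesis cf : continuous f.

(** Along a segment the coordinates stay in the closed square, where [clamp] is
    the identity. *)
Lemma segment_continuous u e (gamma : R -> manifold R right top) : 0 < e ->
  straight_segment u e gamma -> forall eps, 0 < eps ->
  exists2 delta, 0 < delta & forall s, 0 <= s < delta -> `|f (gamma 0) - f (gamma s)| < eps.
Proof.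
move=> e0 [i [x [y [z h]]]] eps eps0.
pose w s : R * R * R := (x + s * u 0 0, y + s * u 0 1, z + s * u 0 2%:R).
have E s : 0 <= s <= e -> f (gamma s) = cube_function f i (w s).
  by move=> /h[hx hy ->]; rewrite /cube_function /= !clamp_id.
have cw : continuous (fun s => cube_function f i (w s)).
  apply: (continuous_compose _ (cube_function_continuous cf (i := i))).
  have lin (a b : R) : continuous (fun s : R => a + s * b).
    by move=> s; apply: cvgD; [exact: cvg_cst | apply: cvgMl; exact: cvg_id].
  by apply: continuous_pair => //; exact: continuous_pair.
have /cvgrPdist_lt/(_ _ eps0)/nbhs_ballP[r /= r0 hr] := cw 0.
exists (Num.min r e); first by rewrite lt_min r0.
move=> s /andP[s0]; rewrite lt_min => /andP[sr se].
have -> : f (gamma 0) = cube_function f i (w 0) by apply: E; rewrite lexx ltW.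
have -> : f (gamma s) = cube_function f i (w s) by apply: E; rewrite s0 ltW.
apply: hr.
by rewrite /ball /= sub0r normrN ger0_norm.
Qed.

Variables (v : 'rV[R]_3) (L : R -> manifold R right top).
Hypothesis hL : half_infinite_geodesic v L.

Lemma geodesic_right_continuous t : 0 <= t -> (fun t => f (L t)) @ t^'+ --> f (L t).
Proof.
move=> /hL[[e e0 h] _]; apply/cvgrPdist_lt => eps eps0.
have [delta d0 hd] := segment_continuous e0 h eps0.
near=> s; have st : t < s by near: s; exact: nbhs_right_gt.
have sd : s < t + delta by near: s; apply: nbhs_right_lt; rewrite ltrDl.
have := hd (s - t); rewrite addr0 subrKC; apply.
by rewrite subr_ge0 ltW //= ltrBlDl.
Unshelve. all: by end_near. Qed.

Lemma geodesic_continuous t : 0 < t -> {for t, continuous (fun t => f (L t))}.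
Proof.
move=> t0; apply/left_right_continuousP; split; last exact/geodesic_right_continuous/ltW.
have [_ /(_ t0)[e /andP[e0 _] h]] := hL (ltW t0); apply/cvgrPdist_lt => eps eps0.
have [delta d0 hd] := segment_continuous e0 h eps0.
near=> s; have st : s < t by near: s; exact: nbhs_left_lt.
have sd : t - delta < s by near: s; apply: nbhs_left_gt; rewrite ltrBlDr ltrDl.
have := hd (t - s); rewrite subr0 subKr; apply.
by rewrite subr_ge0 ltW //=; lra.
Unshelve. all: by end_near. Qed.

End GeodesicContinuity.

(** * Time averages against space averages *)

Section SpaceAverage.
Variables (R : realType) (d : nat) (right top : {perm 'I_d}) (e1 e2 : bool).
Variable f : manifold R right top -> R.
Hypothesis cf : continuous f.

Definition oriented_function (i : 'I_d) (x y z : R) : R :=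
  cube_function f i (flip e1 x, flip e2 y, z).

Lemma oriented_functionE i x y z : 0 <= x <= 1 -> 0 <= y <= 1 ->
  f (oriented_point right top e1 e2 i x y z) = oriented_function i x y z.
Proof. by move=> hx hy; rewrite /oriented_function /cube_function /= !clamp_id ?flip01. Qed.

(** When an axis is reflected, the lower end of a cell becomes the upper end of
    the reflected cell, whose index is reversed. *)
Definition turn_ord (e : bool) Q (a : 'I_Q) : 'I_Q := if e then rev_ord a else a.

Lemma turn_ordK e Q : involutive (@turn_ord e Q).
Proof. by case: e => a //; exact: rev_ordK. Qed.

Lemma flip_cell e Q (a : 'I_Q) (x : R) : x \in cell R Q a ->
  `|x - flip e ((turn_ord e a)%:R / Q%:R)| <= Q%:R^-1.
Proof.
move=> /cell_bounds/andP[h1 h2]; rewrite -[a.+1%:R]natr1 mulrDl mul1r in h2.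
have QR : 0 < Q%:R :> R by rewrite ltr0n; apply: leq_ltn_trans (ltn_ord a).
case: e => /=; last by rewrite ger0_norm ?subr_ge0 // lerBlDl.
have -> : 1 - (Q - a.+1)%:R / Q%:R = a%:R / Q%:R + Q%:R^-1 :> R.
  by rewrite natrB // -natr1; field; exact: lt0r_neq0.
by rewrite ler0_norm ?subr_le0 // opprB lerBlDl -lerBlDr addrK.
Qed.

Lemma flip_dist e (x y : R) : `|flip e x - flip e y| = `|x - y|.
Proof. by case: e => //=; rewrite distrC; congr `|_|; ring. Qed.

(** After the cells are reversed along the reflected axes, [riemann_mean] is a
    Riemann sum of the integral, with samples at ends of the cells. *)
Lemma space_average Q eps : (0 < Q)%N -> (0 < d)%N ->
  (forall i x y z x' y' z', 0 <= x <= 1 -> 0 <= y <= 1 ->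
    `|x - x'| <= Q%:R^-1 -> `|y - y'| <= Q%:R^-1 -> `|z - z'| <= Q%:R^-1 ->
    `|cube_function f i (x, y, z) - cube_function f i (x', y', z')| <= eps) ->
  `|d%:R^-1 * manifold_integral f - riemann_mean oriented_function Q| <= eps.
Proof.
move=> Q0 d0 modulus; have [B hB] := cube_function_bounded cf.
have dR : 0 < d%:R :> R by rewrite ltr0n.
pose c i (t : 'I_Q * 'I_Q * 'I_Q) : R := oriented_function i
  ((turn_ord e1 t.1.1)%:R / Q%:R) ((turn_ord e2 t.1.2)%:R / Q%:R) (t.2%:R / Q%:R).
have cE i : \sum_t c i t = \sum_(a < Q) \sum_(b < Q) \sum_(k < Q)
    oriented_function i (a%:R / Q%:R) (b%:R / Q%:R) (k%:R / Q%:R).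
  rewrite [RHS](reindex_inj (inv_inj (@turn_ordK e1 Q))) /=.
  under [RHS]eq_bigr do rewrite (reindex_inj (inv_inj (@turn_ordK e2 Q))) /=.
  rewrite pair_bigA /= pair_bigA /=.
  by apply: eq_bigr => -[[a b] k].
have est i : `|\int[@lambda3 R]_(w in @unit_cube R) f (cube_point right top i w.1.1 w.1.2 w.2)
    - (\sum_t c i t) / (Q * Q * Q)%:R| <= eps.
  have -> : \int[@lambda3 R]_(w in @unit_cube R) f (cube_point right top i w.1.1 w.1.2 w.2) =
    \int[@lambda3 R]_(w in @unit_cube R) cube_function f i w.
    apply: eq_Rintegral => -[[x y] z]; rewrite inE => -[[/= hx hy] _].
    by rewrite !in_itv /= in hx hy; rewrite /cube_function /= !clamp_id.
  apply: (riemann_cube Q0 _ (hB i)).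
    apply: uniform_measurable => e e0; have [delta delta0 hd] := cube_function_unif cf e0.
    by exists delta => // x y z x' y' z'; exact: hd.
  move=> t w ht; have := cell3_sub ht; case: t ht => -[a b] k.
  case: w => -[x y] z [[/= ha hb] hk] [[/= hx hy] _]; rewrite !in_itv /= in hx hy.
  by apply: modulus => //; try exact: flip_cell; exact: (flip_cell false).
have -> : d%:R^-1 * manifold_integral f - riemann_mean oriented_function Q =
   d%:R^-1 * \sum_(i < d) (\int[@lambda3 R]_(w in @unit_cube R) f (cube_point right top i w.1.1 w.1.2 w.2)
    - (\sum_t c i t) / (Q * Q * Q)%:R).
  rewrite /manifold_integral /riemann_mean sumrB mulrBr; congr (_ - _).
  under eq_bigr do rewrite -cE.
  by rewrite -mulr_suml [in LHS]natrM invfM mulrA [RHS]mulrC.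
rewrite normrM [`|d%:R^-1|]ger0_norm ?invr_ge0 // mulrC ler_pdivrMr //.
apply: le_trans (ler_norm_sum _ _ _) _.
by rewrite mulr_natr -[X in eps *+ X]card_ord -sumr_const; apply: ler_sum => i _; exact: est.
Qed.

End SpaceAverage.

Section Equidistribution.
Variables (R : realType) (d : nat) (right top : {perm 'I_d}) (e1 e2 : bool).
Variables (v : 'rV[R]_3) (L : R -> manifold R right top) (w1 al be t0 y0 z0 : R) (i0 : 'I_d).
Local Notation rho := (turn e1 right).
Local Notation tau := (turn e2 top).
Hypothesis hL : half_infinite_geodesic v L.
Hypothesis w10 : 0 < w1.
Hypothesis al0 : 0 < al.
Hypothesis indep : forall a b c : int,
  a%:~R + b%:~R * al + c%:~R * be = 0 -> [/\ a = 0, b = 0 & c = 0].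
Hypothesis trans : forall C : {set 'I_d}, C != finset.set0 ->
  (forall i, i \in C -> rho i \in C) -> (forall i, i \in C -> tau i \in C) ->
  forall i, i \in C.
Hypothesis t00 : 0 <= t0.
Hypothesis code : forall X, 0 <= X -> L (t0 + X / w1) =
  oriented_point right top e1 e2 (square_at rho tau al y0 i0 X)
    (frac X) (frac (y0 + X * al)) (z0 + X * be).

(** The mesh [Q] is chosen so fine that the observable varies by less than
    [eps / 8] on a cell and that the jumps counted by [time_average]
    contribute at most [eps / 4]. *)
Theorem coded_geodesic_uniform : uniformly_distributed L.
Proof.
move=> f cf; have [B hB] := cube_function_bounded cf.
have d0 : (0 < d)%N by apply: leq_ltn_trans (ltn_ord i0).
have B0 : 0 <= B by apply: le_trans (hB i0 (0, 0, 0)).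
set M := d%:R^-1 * manifold_integral f.
pose phi t := f (L t).
have phi_cont t : 0 < t -> {for t, continuous phi} by exact: (geodesic_continuous cf hL).
have phi_right : phi @ (0 : R)^'+ --> phi 0 by exact: (geodesic_right_continuous cf hL).
have phi_bound t : 0 <= t -> `|phi t| <= B.
  move=> /hL[[e e0 [i [x [y [z h]]]]] _].
  have [|hx hy] := h 0; first by rewrite lexx ltW.
  rewrite addr0 /phi => ->; rewrite !mul0r !addr0 in hx hy *.
  by have := hB i (x, y, z); rewrite /cube_function /= !clamp_id.
apply: (average_limit phi_cont phi_right phi_bound t00 w10) => eps eps0.
have e8 : 0 < eps / 8 by rewrite divr_gt0.
have [delta delta0 hd] := cube_function_unif cf e8.
(* a number of cells above K makes the three meshes below delta and the
   contribution of the jumps below eps / 4 *)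
pose K := Num.max ((al + `|be| + 1) / delta) (2 * B * (al + 1) / (eps / 4)).
pose Q := (Num.truncn K).+1.
have QR : 0 < Q%:R :> R by [].
have KQ : K < Q%:R by exact: truncnS_gt.
have m1 : (al + `|be| + 1) / Q%:R < delta.
  rewrite ltr_pdivrMr // mulrC -ltr_pdivrMr //.
  by apply: le_lt_trans KQ; rewrite le_max lexx.
have m2 : 2 * B * (al + 1) / Q%:R <= eps / 4.
  rewrite ler_pdivrMr // [leRHS]mulrC -ler_pdivrMr; last by rewrite divr_gt0.
  by apply/ltW; apply: le_lt_trans KQ; rewrite le_max lexx orbT.
have small u : 0 <= u -> u <= al + `|be| + 1 -> u / Q%:R < delta.
  by move=> u0 hu; apply: le_lt_trans m1; rewrite ler_pM2r // invr_gt0.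
have be0 : 0 <= `|be| by exact: normr_ge0.
clearbody Q.
have s1 : Q%:R^-1 < delta by rewrite -[_^-1]mul1r; apply: small; move: al0 be0; lra.
have s2 : (al + 1) / Q%:R < delta by apply: small; move: al0 be0; lra.
have s3 : (`|be| + 1) / Q%:R < delta by apply: small; move: al0 be0; lra.
have Q0 : (0 < Q)%N by rewrite -(ltr_nat R).
have space : `|M - riemann_mean (oriented_function e1 e2 f) Q| <= eps / 8.
  apply: space_average => // i x y z x' y' z' hx hy h1 h2 h3.
  by apply: hd => //; apply: le_lt_trans s1.
pose H X := w1 * (primitive phi (t0 + X / w1) - primitive phi t0).
have H0 : H 0 = 0 by rewrite /H mul0r addr0 subrr mulr0.
have H_mvt X1 X2 : 0 <= X1 -> X1 < X2 -> exists2 xi, X1 < xi < X2 &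
    H X2 - H X1 = observable rho tau al be y0 z0 i0 (oriented_function e1 e2 f) xi * (X2 - X1).
  move=> X10 X12.
  have a0 : 0 <= t0 + X1 / w1 by rewrite addr_ge0 // divr_ge0 // ltW.
  have ab : t0 + X1 / w1 < t0 + X2 / w1 by rewrite ltrD2l ltr_pM2r // invr_gt0.
  have [s /andP[s1' s2'] E] := primitive_mean_value phi_cont phi_right a0 ab.
  exists ((s - t0) * w1).
    apply/andP; split; first by rewrite -ltr_pdivrMr // ltrBrDl.
    by rewrite -ltr_pdivlMr // ltrBlDl.
  rewrite /H -mulrBr opprB addrA subrK E.
  have -> : phi s = observable rho tau al be y0 z0 i0 (oriented_function e1 e2 f) ((s - t0) * w1).
    have X0 : 0 <= (s - t0) * w1.
      by rewrite -ler_pdivrMr // lerBrDl ltW //; apply: le_lt_trans s1'; rewrite mul0r lerD2l divr_ge0 // ltW.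
    have := code X0; rewrite mulfK ?gt_eqF // subrKC /phi => ->.
    have c01 (u : R) : 0 <= frac u <= 1 by rewrite frac_ge0 ltW ?frac_lt1.
    by rewrite oriented_functionE.
  by field; exact: lt0r_neq0.
have g_per i x y z (p : int) : oriented_function e1 e2 f i x y (z + p%:~R) =
    oriented_function e1 e2 f i x y z by exact: cube_function_periodic.
have g_bound i x y z : `|oriented_function e1 e2 f i x y z| <= B by exact: hB.
have g_mod i x y z x' y' z' : 0 <= x <= 1 -> 0 <= x' <= 1 -> 0 <= y <= 1 -> 0 <= y' <= 1 ->
    `|x - x'| <= Q%:R^-1 -> `|y - y'| <= (al + 1) / Q%:R -> `|z - z'| <= (`|be| + 1) / Q%:R ->
    `|oriented_function e1 e2 f i x y z - oriented_function e1 e2 f i x' y' z'| <= eps / 8.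
  move=> hx _ hy _ h1 h2 h3; apply: hd; rewrite ?flip01 ?flip_dist //.
  - exact: le_lt_trans h1 s1.
  - exact: le_lt_trans h2 s2.
  - exact: le_lt_trans h3 s3.
have time := time_average indep al0 trans Q0 (ltW e8) g_per g_bound g_mod H0 H_mvt e8.
apply: filterS time => N; rewrite -/(H _) distrC in space *.
move=> h; rewrite -[X in `|X|](subrKA (riemann_mean (oriented_function e1 e2 f) Q)).
apply: le_trans (ler_normD _ _) _.
apply: le_trans (lerD h space) _.
have -> : eps = (2 * (eps / 8) + eps / 8 + eps / 4) + eps / 8 + eps / 4 by field.
by rewrite lerD //; lra.
Qed.

End Equidistribution.

(** * Kronecker directions *)

Section Direction.
Variables (R : realType) (v : 'rV[R]_3).
Hypothesis hv : kronecker_direction v.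

Lemma sum3E (F : 'I_3 -> R) : \sum_(k < 3) F k = F 0 + F 1 + F 2%:R.
Proof.
rewrite !big_ord_recl big_ord0 addr0 addrA.
by congr (_ + F _ + F _); apply: val_inj.
Qed.

Lemma integral_relation (a b c : int) :
  a%:~R * v 0 0 + b%:~R * v 0 1 + c%:~R * v 0 2%:R = 0 -> [/\ a = 0, b = 0 & c = 0].
Proof.
move=> h; pose q : 'rV[rat]_3 := \row_k (nth 0 [:: a; b; c] k)%:~R.
have /hv q0 : \sum_(k < 3) ratr (q 0 k) * v 0 k = 0.
  by rewrite sum3E !mxE !ratr_int.
have e k : nth 0 [:: a; b; c] (k : 'I_3) = 0.
  by apply/eqP; rewrite -(intr_eq0 rat); have /matrixP/(_ 0 k) := q0; rewrite !mxE => ->.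
by split; [exact: (e 0) | exact: (e 1) | exact: (e 2%:R)].
Qed.

Lemma direction_neq0 : [/\ v 0 0 != 0, v 0 1 != 0 & 0 < euclidean_norm v].
Proof.
have v0 : v 0 0 != 0.
  apply/eqP => h; have [] // := @integral_relation 1 0 0.
  by rewrite h !mul0r mulr0 !addr0.
have v1 : v 0 1 != 0.
  apply/eqP => h; have [] // := @integral_relation 0 1 0.
  by rewrite h !mul0r mulr0 !addr0.
split => //; rewrite /euclidean_norm sqrtr_gt0 sum3E.
by rewrite -addrA ltr_pwDl ?addr_ge0 ?sqr_ge0 // exprn_even_gt0.
Qed.

End Direction.

(** A subset of a finite set that is mapped into itself by a permutation is
    mapped onto itself, so replacing a permutation by its inverse does not
    affect transitivity. *)
Lemma turn_trans (d : nat) (right top : {perm 'I_d}) (e1 e2 : bool) :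
  (forall C : {set 'I_d}, C != finset.set0 -> (forall i, (right i \in C) = (i \in C)) ->
    (forall i, (top i \in C) = (i \in C)) -> forall i, i \in C) ->
  forall C : {set 'I_d}, C != finset.set0 ->
  (forall i, i \in C -> turn e1 right i \in C) -> (forall i, i \in C -> turn e2 top i \in C) ->
  forall i, i \in C.
Proof.
move=> H C C0 h1 h2; apply: H => //.
- case: e1 h1 => /stable_perm h1 i; last exact: h1.
  by rewrite -[i in RHS](permK right) h1.
- case: e2 h2 => /stable_perm h2 i; last exact: h2.
  by rewrite -[i in RHS](permK top) h2.
Qed.

Theorem theorem3 (R : realType) (d : nat) (right top : {perm 'I_d})
    (hconn : connected [set: surface R right top])
    (v : 'rV[R]_3) (hv : kronecker_direction v)
    (L : R -> manifold R right top) (hL : half_infinite_geodesic v L)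
    (hsing : ~ hits_singularity L) :
  uniformly_distributed L.
Proof.
have [v0 v1 n0] := direction_neq0 hv.
pose u := unit_vector v.
have uE k : u 0 k = (euclidean_norm v)^-1 * v 0 k by rewrite /u /unit_vector mxE.
have ni : 0 < (euclidean_norm v)^-1 by rewrite invr_gt0.
have u0 : u 0 0 != 0 by rewrite uE mulf_neq0 // gt_eqF.
have u1 : u 0 1 != 0 by rewrite uE mulf_neq0 // gt_eqF.
pose e1 := u 0 0 < 0; pose e2 := u 0 1 < 0.
(* reflecting an axis multiplies the velocity along it by sg *)
pose sg (e : bool) : int := if e then -1 else 1.
pose w1 := (sg e1)%:~R * u 0 0; pose w2 := (sg e2)%:~R * u 0 1.
have sgT : (sg true)%:~R = -1 :> R by rewrite /sg mulrN1z.
have sgF : (sg false)%:~R = 1 :> R by [].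
have sg_gt0 (x : R) : x != 0 -> 0 < (sg (x < 0))%:~R * x.
  move=> x0; have [h|h] := ltP x 0; first by rewrite sgT mulN1r oppr_gt0.
  by rewrite sgF mul1r lt_neqAle eq_sym x0.
have w10 : 0 < w1 := sg_gt0 _ u0.
have w20 : 0 < w2 := sg_gt0 _ u1.
have flipD e x s y : flip e (x + s * y) = flip e x + s * ((sg e)%:~R * y) :> R.
  by case: e; rewrite /flip ?sgT ?sgF; ring.
have flipB e x s y : flip e (x + s * (- y)) = flip e x - s * ((sg e)%:~R * y) :> R.
  by rewrite flipD; ring.
have indep (a b c : int) : a%:~R + b%:~R * (w2 / w1) + c%:~R * (u 0 2%:R / w1) = 0 ->
    [/\ a = 0, b = 0 & c = 0].
  move=> h.
  have E : (a * sg e1)%:~R * v 0 0 + (b * sg e2)%:~R * v 0 1 + c%:~R * v 0 2%:R = 0.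
    apply: (mulfI (lt0r_neq0 ni)); rewrite mulr0 -[RHS](mulr0 w1) -h !intrM.
    have -> : w1 * (a%:~R + b%:~R * (w2 / w1) + c%:~R * (u 0 2%:R / w1)) =
       a%:~R * w1 + b%:~R * w2 + c%:~R * u 0 2%:R by field; exact: lt0r_neq0.
    by rewrite /w1 /w2 !uE; ring.
  have [a0 b0 ->] := integral_relation hv E.
  have sg0 e z : z * sg e = 0 -> z = 0.
    by rewrite /sg; case: e => /eqP; rewrite ?mulrN1 ?oppr_eq0 ?mulr1 => /eqP.
  by rewrite (sg0 _ _ a0) (sg0 _ _ b0).
have [t0 [y0 [z0 [i0 [t00 code]]]]] : exists t0 y0 z0 i0, 0 <= t0 /\ forall X, 0 <= X ->
    L (t0 + X / w1) = oriented_point right top e1 e2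
      (square_at (turn e1 right) (turn e2 top) (w2 / w1) y0 i0 X)
      (frac X) (frac (y0 + X * (w2 / w1))) (z0 + X * (u 0 2%:R / w1)).
  apply: (coding w10 w20 indep) => t t0.
  - have [[e e0 [i [x [y [z h]]]]] _] := hL t t0.
    exists e => //; exists i, (flip e1 x), (flip e2 y), z => s /h [hx hy ->].
    by rewrite /oriented_point -!flipD !flip01 !flipK.
  - have [_ /(_ t0)[e e0 [i [x [y [z h]]]]]] := hL t (ltW t0).
    exists e => //; exists i, (flip e1 x), (flip e2 y), z => s /h.
    rewrite ![(- unit_vector v) _ _]mxE => -[hx hy ->].
    by rewrite /oriented_point -!flipB !flip01 !flipK -[- (s * u 0 2%:R)]mulrN.
apply: (coded_geodesic_uniform hL w10 (divr_gt0 w20 w10) indep _ t00 code).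
exact: (turn_trans (surface_transitive hconn)).
Qed.
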